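(* For each $n\ge 1$ there is a unique continuous map $\gamma\colon \mathrm{Herm}(n)\to\mathrm{Herm}^+(n)$ with the following three properties: (a) $\gamma$ intertwines the Gelfand-Zeitlin maps: $\mu\circ\gamma=\lambda$. (b) $\gamma$ intertwines the Gelfand-Zeitlin torus actions on $\mathrm{Herm}_0(n)$ and $\mathrm{Herm}_0^+(n)$, i.e. $\gamma(t\bullet A)=t\bullet\gamma(A)$ for all $A\in \mathrm{Herm}_0(n)$ and $t\in T(n-1)\times\cdots\times T(1)$. (c) For any connected component $S$ of $\mathrm{Sym}_0(n)\subset\mathrm{Herm}(n)$, $\gamma(S)\subset S$. In fact, $\gamma$ is a diffeomorphism, and has the following additional properties: (d) $\gamma$ is equivariant for the conjugation action of $T(n)\subset \mathrm{U}(n)$. (e) $\gamma(A+uI)=e^u\gamma(A)$ for all $A\in\mathrm{Herm}(n)$, $u\in\mathbb{R}$. (f) $\gamma(\overline{A})=\overline{\gamma(A)}$, where the bar denotes complex conjugation. (g) For $k\le n$, writing $\gamma_k$ for the map $\gamma$ on $\mathrm{Herm}(k)$ and $\gamma_n$ for the one on $\mathrm{Herm}(n)$: one has $\gamma_n(A)^{(k)}=\gamma_k(A^{(k)})$ for all $A\in\mathrm{Herm}(n)$, and $\gamma_n(j_0(B))=j_1(\gamma_k(B))$ for all $B\in\mathrm{Herm}(k)$, where $j_0\colon\mathrm{Herm}(k)\to\mathrm{Herm}(n)$ and $j_1\colon\mathrm{Herm}^+(k)\to\mathrm{Herm}^+(n)$ are the inclusions as the upper left corner, extended by $0$'s respectively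 $1$'s along the diagonal (and zeros off the diagonal).
   Context: $\mathrm{Herm}(n)$ is the space of complex Hermitian $n\times n$ matrices, $\mathrm{Herm}^+(n)$ the positive definite ones, $\mathrm{Sym}(n)\subset\mathrm{Herm}(n)$ the real symmetric ones. For $k\le n$, $A^{(k)}$ is the upper left $k\times k$ corner of $A$, with ordered eigenvalues $\lambda^{(k)}_1(A)\le\cdots\le\lambda^{(k)}_k(A)$. The Gelfand-Zeitlin map is $\lambda(A)=(\lambda^{(k)}_i(A))_{1\le i\le k\le n}\in\mathbb{R}^{n(n+1)/2}$ on $\mathrm{Herm}(n)$, and the logarithmic Gelfand-Zeitlin map is $\mu(A)=(\log\lambda^{(k)}_i(A))_{1\le i\le k\le n}$ on $\mathrm{Herm}^+(n)$. Both have image the cone $\mathfrak{C}(n)\subset\mathbb{R}^{n(n+1)/2}$ cut out by the inequalities $\lambda_i^{(k+1)}\le\lambda_i^{(k)}\le\lambda_{i+1}^{(k+1)}$, $1\le i\le k\le n-1$. Let $\mathfrak{C}_0(n)$ be the subset where all these inequalities are strict, $\mathrm{Herm}_0(n)=\lambda^{-1}(\mathfrak{C}_0(n))$, $\mathrm{Herm}_0^+(n)=\mathrm{Herm}_0(n)\cap\mathrm{Herm}^+(n)=\mu^{-1}(\mathfrak{C}_0(n))$, and $\mathrm{Sym}_0(n)=\mathrm{Herm}_0(n)\cap\mathrm{Sym}(n)$. $T(k)\subset\mathrm{U}(k)$ is the torus of diagonal unitary matrices, and $\mathrm{U}(k)\subset\mathrm{U}(n)$ is embedded as the upper left corner (extended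 by $1$'s on the diagonal). $T(k)$ acts on $\mathrm{Herm}_0(n)$ by $t\bullet A=(U^{-1}tU)\,A\,(U^{-1}tU)^{-1}$, where $U\in\mathrm{U}(k)$ is any matrix such that $UA^{(k)}U^{-1}$ is diagonal with entries $\lambda_1^{(k)}(A),\ldots,\lambda_k^{(k)}(A)$ (this is independent of the choice of $U$). These actions commute for different $k$ and preserve $\lambda$ and $\mathrm{Herm}_0^+(n)$; together they define the action of the Gelfand-Zeitlin torus $T(n-1)\times\cdots\times T(1)$ on $\mathrm{Herm}_0(n)$ and on $\mathrm{Herm}_0^+(n)$. *)

(* Defs.v *)
From HB Require Import structures.
From mathcomp Require Import all_boot all_order all_algebra.
From mathcomp Require Import complex lra.
From mathcomp Require Import all_classical all_reals all_analysis.
Set Implicit Arguments.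
Unset Strict Implicit.
Unset Printing Implicit Defensive.
Import Order.TTheory GRing.Theory Num.Theory numFieldNormedType.Exports.
Local Open Scope classical_set_scope.
Local Open Scope ring_scope.
Local Open Scope complex_scope.
Local Open Scope sesquilinear_scope.

(* The usual topology of the complex numbers R[i]; it induces the usual
   (entrywise) topology on the matrix spaces 'M[R[i]]_n. *)
HB.instance Definition _ (R : rcfType) := NormedModule.copy R[i] R[i]^o.

Section HermitianMatrices.
Variables (R : realType) (n : nat).
Local Notation C := R[i].

Definition Herm : set 'M[C]_n := [set A | A \is hermsymmx].

Definition Herm_pos : set 'M[C]_n :=
  [set A | A \is hermsymmx /\
           forall v : 'cV[C]_n, v != 0 -> 0 < (v ^t* *m A *m v) ord0 ord0].

Definition torus : set 'rV[C]_n := [set t | forall i, `|t ord0 i| = 1].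

Definition conjg_mx (V A : 'M[C]_n) : 'M[C]_n := V *m A *m invmx V.

(* The roots of the characteristic polynomial, counted with multiplicity and
   listed in nondecreasing order. Only used for Hermitian A, whose eigenvalues
   are real, so that taking real parts loses nothing. *)
Definition eigenvalues (A : 'M[C]_n) : seq R :=
  sort <=%R
    [seq complex.Re z | z <- sval (closed_field_poly_normal (char_poly A))].

End HermitianMatrices.
Arguments Herm R n : clear implicits.
Arguments Herm_pos R n : clear implicits.

Definition corner (T : Type) (k n : nat) (hk : (k <= n)%N) (A : 'M[T]_n) :
  'M[T]_k := mxsub (widen_ord hk) (widen_ord hk) A.

(* [extend hk c B] is block-diagonal with blocks B and c I. Thus j_0 is
   [extend hk 0], while j_1 and the inclusion of U(k) in U(n) are
   [extend hk 1]. *)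
Definition extend (T : pzRingType) (k n : nat) (hk : (k <= n)%N) (c : T)
    (B : 'M[T]_k) : 'M[T]_n :=
  castmx (subnKC hk, subnKC hk) (block_mx B 0 0 c%:M).

(* Triangular arrays (x^(k)_i), 1 <= i <= k <= n; the index i is shifted so as
   to start from 0. *)
Definition gz_array (R : Type) (n : nat) :=
  forall k : nat, (k <= n)%N -> 'I_k -> R.

Section GelfandZeitlin.
Variables (R : realType) (n : nat).
Local Notation C := R[i].

Definition gz_lambda (A : 'M[C]_n) : gz_array R n :=
  fun k hk i => (eigenvalues (corner hk A))`_i.

Definition gz_mu (A : 'M[C]_n) : gz_array R n :=
  fun k hk i => ln (gz_lambda A hk i).

Definition gz_open_cone : set (gz_array R n) :=
  [set x | forall k (hk : (k.+1 <= n)%N) (i : 'I_k),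
     x k.+1 hk (widen_ord (leqnSn k) i) < x k (ltnW hk) i
     /\ x k (ltnW hk) i < x k.+1 hk (lift ord0 i)].

Definition Herm0 : set 'M[C]_n := Herm R n `&` gz_lambda @^-1` gz_open_cone.

Definition Sym0 : set 'M[C]_n := Herm0 `&` [set A | A \is a realmx].

(* U ranges over the unitary matrices diagonalizing the k x k corner of A, with
   the eigenvalues in increasing order; for A in [Herm0] such a U exists, and
   U^-1 t U below does not depend on which one is chosen. *)
Definition gz_diagonalizer k (hk : (k <= n)%N) (A : 'M[C]_n) : 'M[C]_k :=
  xget 1%:M [set U | U \is unitarymx /\
    conjg_mx U (corner hk A) = diag_mx (\row_i (gz_lambda A hk i)%:C)].

Definition gz_act1 k (hk : (k <= n)%N) (t : 'rV[C]_k) (A : 'M[C]_n) :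
    'M[C]_n :=
  let U := gz_diagonalizer hk A in
  conjg_mx (extend hk 1 (invmx U *m diag_mx t *m U)) A.

(* The action of T(n-1) x ... x T(1), one factor after the other (they
   commute). The index k ranges over 0 <= k < n; the factor T(0) is trivial and
   acts trivially. *)
Definition gz_act (t : forall k : 'I_n, 'rV[C]_k) (A : 'M[C]_n) : 'M[C]_n :=
  foldr (fun (k : 'I_n) B => gz_act1 (ltnW (ltn_ord k)) (t k) B) A (enum 'I_n).

Definition gz_intertwines_maps (g : 'M[C]_n -> 'M[C]_n) : Prop :=
  forall A, Herm R n A -> gz_mu (g A) = gz_lambda A.

Definition gz_intertwines_actions (g : 'M[C]_n -> 'M[C]_n) : Prop :=
  forall A, Herm0 A -> forall t : (forall k : 'I_n, 'rV[C]_k),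
    (forall k, torus (t k)) -> g (gz_act t A) = gz_act t (g A).

Definition preserves_Sym0_components (g : 'M[C]_n -> 'M[C]_n) : Prop :=
  forall A, Sym0 A ->
    g @` connected_component Sym0 A `<=` connected_component Sym0 A.

(* Maps Herm(n) -> Herm^+(n) are represented by functions on all matrices, of
   which only the restriction to [Herm R n] matters. *)
Definition is_gz_map (g : 'M[C]_n -> 'M[C]_n) : Prop :=
  [/\ set_fun (Herm R n) (Herm_pos R n) g,
      {within Herm R n, continuous g},
      gz_intertwines_maps g,
      gz_intertwines_actions g
    & preserves_Sym0_components g].

End GelfandZeitlin.

Section Smooth.
Variables (R : realType) (V W : normedModType R).

(* f is of class C^k on the open set D. *)
Fixpoint class_C (k : nat) (D : set V) (f : V -> W) : Prop :=
  if k is k'.+1 then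
    (forall x, D x -> differentiable f x) /\
    (forall v : V, class_C k' D (fun x => 'D_v f x))
  else forall x, D x -> {for x, continuous f}.

Definition smooth_on (D : set V) (f : V -> W) : Prop :=
  forall k, class_C k D f.

End Smooth.

Section HermitianCoordinates.
Variables (R : realType) (n : nat).
Local Notation C := R[i].

(* Global linear coordinates on the real vector space Herm(n): since Re A is
   symmetric and Im A antisymmetric, A |-> Re A + Im A is an R-linear
   isomorphism from Herm(n) onto the real n x n matrices. *)
Definition hcoord (A : 'M[C]_n) : 'M[R]_n :=
  map_mx (@complex.Re R) A + map_mx (@complex.Im R) A.

Definition hmat (X : 'M[R]_n) : 'M[C]_n :=
  \matrix_(i, j) (((X i j + X j i) / 2) +i* ((X i j - X j i) / 2)).

Lemma hmat_Herm X : Herm R n (hmat X).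
Proof.
rewrite /Herm /=; apply/is_hermitianmxP.
rewrite expr0 scale1r; apply/matrixP => i j; rewrite !mxE /=.
by congr (_ +i* _); [rewrite addrC | rewrite -mulNr opprB].
Qed.

Lemma hmatK : cancel hmat hcoord.
Proof.
by move=> X; apply/matrixP => i j; rewrite !mxE /=; lra.
Qed.

Lemma hcoordK A : Herm R n A -> hmat (hcoord A) = A.
Proof.
move=> /is_hermitianmxP; rewrite expr0 scale1r => AE.
apply/matrixP => i j; rewrite !mxE.
have -> : A j i = (A i j)^*%C by rewrite {1}AE !mxE.
case: (A i j) => a b /=.
by congr (_ +i* _); lra.
Qed.

(* Smoothness, on a relatively open subset D of Herm(n), of a map with values
   in Herm(n). *)
Definition Herm_smooth (D : set 'M[C]_n) (f : 'M[C]_n -> 'M[C]_n) : Prop :=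
  smooth_on (hmat @^-1` D) (hcoord \o f \o hmat).

Definition Herm_diffeo (D E : set 'M[C]_n) (f : 'M[C]_n -> 'M[C]_n) : Prop :=
  set_bij D E f /\ Herm_smooth D f /\
  exists2 g : 'M[C]_n -> 'M[C]_n,
    {in D, cancel f g} & Herm_smooth E g.

End HermitianCoordinates.

(* Main.v *)
Require Import Defs.
From HB Require Import structures.
From mathcomp Require Import all_boot all_order all_algebra.
From mathcomp Require Import perm complex ring lra zify.
From mathcomp Require Import all_classical all_reals all_analysis.
Set Implicit Arguments. Unset Strict Implicit. Unset Printing Implicit Defensive.
Import Order.TTheory GRing.Theory Num.Theory numFieldNormedType.Exports.
Local Open Scope classical_set_scope.
Local Open Scope ring_scope.
Local Open Scope complex_scope.
Local Open Scope sesquilinear_scope.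

(** Why the theorem holds.

    The construction goes by induction on the size. Write [A] of size [n + 1] with
    corner [B], border [b] and eigenvalues [x], and let [y] be the eigenvalues of [B].
    The map will be [gzexp A = psi A * exp A * (psi A)^*] with [psi A] unitary, so the
    eigenvalues of [A] itself cause no trouble; what has to be arranged is that the corner
    of [gzexp A] is [gzexp B]. It suffices to find a unitary [polar A] such that
    [polar A * exp A * (polar A)^*] has corner [exp B], and to put
    [psi A = diag(psi B, 1) * polar A].

    Which matrix should this conjugate of [exp A] be? In an eigenbasis of [B] the
    spectrum of [A] is governed by the secular equation
      [prod_j (y_i - x_j) = - |b_i|^2 prod_(k <> i) (y_i - y_k)]
    ([secular_eq]), together with the trace. With [E(s, t) = (e^s - e^t) / (s - t)], the
    same products formed from [e^x] and [e^y] are those formed from [x] and [y] times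
    products of values of [E]. Hence the matrix [twist A] with corner [exp B] and border
    [f(B) b] has eigenvalues [e^x] if
      [f(s)^2 = e^s prod_j E(s, x_j) / prod_k E(s, y_k)]
    ([exp_secular]). All values of [E] are positive, so [f] is positive and
    depends smoothly on [A], even where eigenvalues collide: this is why the map extends
    smoothly to all Hermitian matrices. An explicit matrix [pretwist A] intertwines
    [exp A] and [twist A]: the first rows solve a Sylvester equation, with solution
    [1/E(B, A)] applied to the projection on the first coordinates, and the last row is
    the last basis vector. For strictly interlaced spectra this is a computation
    ([pretwist_intertwine_strict]), by Lagrange interpolation at the [e^(y_i)]; it extends
    by density ([chain_dense], [pretwist_intertwine]). The matrix [pretwist A] is always
    invertible ([pretwist_inj]) and [polar A] is its unitary polar factor.

    Smoothness. Every ingredient is a function of one or two Hermitian matrices, built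
    from [exp], [ln], [E], [1/E] and from sums [sum_j ln E(., x_j)], which are partial
    traces of logarithms ([ptrace_ln]). The exponential of block triangular matrices
    contains the divided differences, so that increments and derivatives of [exp] and
    [ln] are values of [E] and [1/E] at two matrices; together with the criterion
    [class_C_increment] this gives all orders of differentiability at once ([mC_expmx],
    [mC_fc_ln]), and the matrix entries of all other ingredients are obtained by algebra.

    Inverse. The recursion can be run backwards ([gzlog]), because [f] involves only the
    eigenvalues of [A], known from those of the image, and the corner [B], known by
    induction. That it inverts [gzexp] on the right needs the secular equation once more
    ([lam_gzlog]), for simple spectra, and density.

    Symmetries. [polar] commutes with conjugation by [diag(Z, w)] ([polar_blk]) and with
    complex conjugation, and is unchanged when a scalar is added to [A]. The first fact gives
    the equivariance under the diagonal torus and, for [Z] commuting with a corner, under the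
    Gelfand-Zeitlin torus ([gzexp_act1]). The path
      [s |-> psi(s A) ((exp(s A) - 1) / s + s) (psi(s A))^*]
    joins [A] to [gzexp A] and stays in Sym_0 when [A] is in Sym_0
    ([gzexp_components]).

    Uniqueness. The eigenvalues of all corners determine an element of a given component
    of Sym_0, since they determine the borders up to signs, which are locally constant
    ([gz_lambda_inj]); so two maps with the properties (a) and (c) agree on Sym_0. Every
    element of Herm_0 is moved to Sym_0 by the torus, one corner after the other
    ([gz_map_real_corner]), and Herm_0 is dense. *)

(** * Spectral decompositions and functional calculus *)

HB.lock Definition lam (R : realType) n (A : 'M[R[i]]_n) (i : 'I_n) : R :=
  (eigenvalues A)`_i.

HB.lock Definition eigbasis (R : realType) n (A : 'M[R[i]]_n) : 'M[R[i]]_n :=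
  xget 1%:M [set U | U \is unitarymx /\
    A = U^t* *m diag_mx (\row_i (lam A i)%:C) *m U].

(** For [B] and [A] Hermitian, [fc2 K B A] multiplies the matrix entries of
    [X] in the eigenbases of [B] and [A] by the values of [K]: it is the
    function [K] of the commuting operators of left multiplication by [B] and
    right multiplication by [A]. *)
HB.lock Definition fc2 (R : realType) (K : R -> R -> R) m n (B : 'M[R[i]]_m)
    (A : 'M[R[i]]_n) (X : 'M[R[i]]_(m, n)) : 'M[R[i]]_(m, n) :=
  (eigbasis B)^t* *m (\matrix_(i, j) ((K (lam B i) (lam A j))%:C
     * (eigbasis B *m X *m (eigbasis A)^t*) i j)) *m eigbasis A.

HB.lock Definition fc (R : realType) (h : R -> R) n (A : 'M[R[i]]_n) :
    'M[R[i]]_n :=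
  (eigbasis A)^t* *m diag_mx (\row_i (h (lam A i))%:C) *m eigbasis A.

Section Adjoint.
Variable R : realType.
Local Notation C := R[i].

Lemma adjmxM m n p (A : 'M[C]_(m, n)) (B : 'M[C]_(n, p)) :
  (A *m B)^t* = B^t* *m A^t*.
Proof. by rewrite trmx_mul map_mxM. Qed.

Lemma colM m n p (A : 'M[C]_(m, n)) (B : 'M[C]_(n, p)) j :
  col j (A *m B) = A *m col j B.
Proof. by rewrite !colE mulmxA. Qed.

Lemma adjmxD m n (A B : 'M[C]_(m, n)) : (A + B)^t* = A^t* + B^t*.
Proof. by rewrite linearD map_mxD. Qed.

Lemma adjmxB m n (A B : 'M[C]_(m, n)) : (A - B)^t* = A^t* - B^t*.
Proof. by rewrite linearB map_mxB. Qed.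

Lemma adjmxZ m n a (A : 'M[C]_(m, n)) : (a *: A)^t* = a^* *: A^t*.
Proof. by rewrite linearZ map_mxZ. Qed.

Lemma adjmx1 n : (1%:M : 'M[C]_n)^t* = 1%:M.
Proof. by rewrite trmx1 map_mx1. Qed.

Lemma adjmx_scalar n (a : C) : (a%:M : 'M[C]_n)^t* = (a^*)%:M.
Proof. by rewrite tr_scalar_mx map_scalar_mx. Qed.

Lemma conjC_real (r : R) : Num.conj (r%:C) = r%:C.
Proof. exact: conjc_real. Qed.

Lemma adjmx_diag n (d : 'I_n -> R) :
  (diag_mx (\row_i (d i)%:C))^t* = diag_mx (\row_i (d i)%:C).
Proof.
rewrite tr_diag_mx map_diag_mx; congr diag_mx.
by apply/rowP => i; rewrite !mxE; exact: conjC_real.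
Qed.

Lemma HermP n (A : 'M[C]_n) : Herm R n A <-> A^t* = A.
Proof.
split=> [/is_hermitianmxP|AE]; first by rewrite expr0 scale1r => {2}->.
by apply/is_hermitianmxP; rewrite expr0 scale1r AE.
Qed.

Lemma unitaryVmx n (U : 'M[C]_n) : U \is unitarymx -> U^t* *m U = 1%:M.
Proof. by move=> /unitarymxP/mulmx1C. Qed.

Lemma unitarymxI n (U : 'M[C]_n) : U^t* *m U = 1%:M -> U \is unitarymx.
Proof. by move=> h; apply/unitarymxP/mulmx1C. Qed.

Lemma mulmx_adjK m n (W : 'M[C]_n) (X : 'M[C]_(m, n)) : W \is unitarymx ->
  X *m W^t* *m W = X.
Proof. by move=> Wu; rewrite -mulmxA unitaryVmx// mulmx1. Qed.

Lemma hermDscalar n (A : 'M[C]_n) (r : R) :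
  A^t* = A -> (A + (r%:C)%:M)^t* = A + (r%:C)%:M.
Proof. by move=> AE; rewrite adjmxD AE adjmx_scalar conjC_real. Qed.

Lemma hermZ n (A : 'M[C]_n) (r : R) :
  A^t* = A -> (r%:C *: A)^t* = r%:C *: A.
Proof. by move=> AE; rewrite adjmxZ AE conjC_real. Qed.

Lemma herm_conj m n (S : 'M[C]_(m, n)) (A : 'M[C]_n) :
  A^t* = A -> (S *m A *m S^t*)^t* = S *m A *m S^t*.
Proof. by move=> AE; rewrite !adjmxM trmxCK AE mulmxA. Qed.

Lemma char_poly_similar n (P Q A : 'M[C]_n) :
  P *m Q = 1%:M -> char_poly (P *m A *m Q) = char_poly A.
Proof.
move=> PQ; rewrite /char_poly /char_poly_mx.
have -> : 'X%:M - map_mx polyC (P *m A *m Q) =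
   map_mx polyC P *m ('X%:M - map_mx polyC A) *m map_mx polyC Q.
  rewrite mulmxBr mulmxBl scalar_mxC -!mulmxA -!map_mxM PQ.
  by rewrite map_mx1 mulmx1 !mulmxA.
rewrite !det_mulmx mulrC mulrA -det_mulmx -map_mxM (mulmx1C PQ) map_mx1.
by rewrite det1 mul1r.
Qed.

Lemma char_poly_diag n (d : 'I_n -> C) :
  char_poly (diag_mx (\row_i d i)) = \prod_i ('X - (d i)%:P).
Proof.
rewrite char_poly_trig ?diag_mx_is_trig//.
by apply: eq_bigr => i _; rewrite !mxE eqxx.
Qed.

Lemma size_eigenvalues n (A : 'M[C]_n) : size (eigenvalues A) = n.
Proof.
rewrite /eigenvalues size_sort size_map.
case: closed_field_poly_normal => /= r /(congr1 (fun p : {poly C} => size p)).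
rewrite size_char_poly size_scale ?lead_coef_eq0 ?monic_neq0 ?char_poly_monic//.
by rewrite size_prod_XsubC => -[].
Qed.

Lemma eigenvalues_sorted n (A : 'M[C]_n) : sorted <=%R (eigenvalues A).
Proof. by apply: sort_sorted; exact: le_total. Qed.

Lemma char_poly_eigenvalues n (A : 'M[C]_n) (s : seq R) :
  char_poly A = \prod_(x <- s) ('X - x%:C%:P) -> perm_eq (eigenvalues A) s.
Proof.
move=> As; rewrite perm_sort.
case: closed_field_poly_normal => /= r.
rewrite (monicP (char_poly_monic A)) scale1r As.
rewrite -(big_map (fun x : R => x%:C) xpredT (fun x => 'X - x%:P)).
move=> /prod_XsubC_eq/(perm_map (@complex.Re R)); rewrite -map_comp.
by rewrite perm_sym (@eq_map _ _ _ id) ?map_id.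
Qed.

Lemma lam_le n (A : 'M[C]_n) (i j : 'I_n) : (i <= j)%N -> lam A i <= lam A j.
Proof.
rewrite lam.unlock => ij; apply: (sorted_leq_nth le_trans lexx); first exact: eigenvalues_sorted.
- by rewrite inE size_eigenvalues.
- by rewrite inE size_eigenvalues.
- exact: ij.
Qed.

Lemma eigenvaluesE n (A : 'M[C]_n) : eigenvalues A = [seq lam A i | i : 'I_n].
Proof.
apply: (@eq_from_nth _ 0); first by rewrite size_eigenvalues size_map size_enum_ord.
move=> i; rewrite size_eigenvalues => ilt.
by rewrite (nth_map (Ordinal ilt)) ?size_enum_ord// lam.unlock nth_enum_ord.
Qed.

Lemma lam_unique n (A : 'M[C]_n) (d : 'I_n -> R) :
  char_poly A = \prod_i ('X - (d i)%:C%:P) ->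
  {homo d : i j / (i <= j)%N >-> i <= j} -> lam A =1 d.
Proof.
move=> Ad dh i.
have e : eigenvalues A = [seq d i | i : 'I_n].
  apply: (sorted_eq le_trans le_anti); first exact: eigenvalues_sorted.
    have : sorted leq (map val (enum 'I_n)).
      by rewrite val_enum_ord iota_sorted.
    by rewrite !sorted_map; apply: sub_sorted => x y /=; exact: dh.
  by apply: char_poly_eigenvalues; rewrite big_map big_enum.
by rewrite lam.unlock e (nth_map i) ?size_enum_ord// nth_ord_enum.
Qed.

Lemma herm_diag n (A : 'M[C]_n) : A^t* = A ->
  exists2 U : 'M[C]_n, U \is unitarymx &
    A = U^t* *m diag_mx (\row_i (lam A i)%:C) *m U.
Proof.
move=> /HermP AH.
have /orthomx_spectralP := hermitian_normalmx AH.
have Uu := spectral_unitarymx A.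
rewrite invmx_unitary//; set U := spectralmx A in Uu *.
pose d i : R := complex.Re (spectral_diag A 0 i).
have -> : spectral_diag A = \row_i (d i)%:C.
  apply/rowP => i; rewrite mxE RRe_real//.
  by apply: (mxOverP (hermitian_spectral_diag_real AH)).
move=> AE.
have : perm_eq (eigenvalues A) [seq d i | i : 'I_n].
  apply: char_poly_eigenvalues; rewrite {1}AE char_poly_similar ?unitaryVmx//.
  by rewrite char_poly_diag big_map big_enum.
move=> As.
have [p dp] : exists p : 'S_n, forall i, lam A i = d (p i).
  have sE : size (eigenvalues A) == n by rewrite size_eigenvalues.
  have : perm_eq (eigenvalues A) (mktuple d) by rewrite (perm_trans As).
  move=> /perm.tuple_permP[p pE]; exists p => i.
  by rewrite lam.unlock pE -(tnth_nth 0 _ i) !tnth_mktuple.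
exists (\matrix_(i, j) U (p i) j).
  apply/unitarymxP/matrixP => i j; move/unitarymxP/matrixP : Uu.
  move=> /(_ (p i) (p j)); rewrite !mxE (inj_eq perm_inj) => <-.
  by apply: eq_bigr => k _; rewrite !mxE.
rewrite {1}AE; apply/matrixP => a b; rewrite !mul_mx_diag !mxE.
rewrite (reindex_inj (@perm_inj _ p))/=; apply: eq_bigr => k _.
by rewrite !mxE dp.
Qed.


(** * Functional calculus *)

Lemma eigbasisP n (A : 'M[C]_n) : A^t* = A ->
  eigbasis A \is unitarymx /\
  A = (eigbasis A)^t* *m diag_mx (\row_i (lam A i)%:C) *m eigbasis A.
Proof.
move=> /herm_diag[U Uu UE]; rewrite eigbasis.unlock; case: xgetP => [V _ //|].
by move=> /(_ U)/= h; exfalso; apply: h.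
Qed.

Section Eigenvectors.
Variables (n : nat) (A : 'M[C]_n).
Hypothesis AE : A^t* = A.
Let U := eigbasis A.

Lemma eigbasis_unitary : U \is unitarymx. Proof. by case: (eigbasisP AE). Qed.
Lemma eigbasisKV : U *m U^t* = 1%:M.
Proof. by apply/unitarymxP; exact: eigbasis_unitary. Qed.
Lemma eigbasisVK : U^t* *m U = 1%:M.
Proof. by apply: unitaryVmx; exact: eigbasis_unitary. Qed.

Lemma eigbasisE : A = U^t* *m diag_mx (\row_i (lam A i)%:C) *m U.
Proof. by case: (eigbasisP AE). Qed.

Lemma char_poly_lam : char_poly A = \prod_i ('X - (lam A i)%:C%:P).
Proof.
by rewrite {1}eigbasisE char_poly_similar ?eigbasisVK// char_poly_diag.
Qed.

Lemma eigbasis_col j : A *m col j (U^t*) = (lam A j)%:C *: col j (U^t*).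
Proof.
have AU : A *m U^t* = U^t* *m diag_mx (\row_i (lam A i)%:C).
  by rewrite {1}eigbasisE -!mulmxA eigbasisKV mulmx1.
by rewrite -colM AU mul_mx_diag; apply/colP => i; rewrite !mxE mulrC.
Qed.

Lemma eigbasis_row i : row i U *m A = (lam A i)%:C *: row i U.
Proof.
have UA : U *m A = diag_mx (\row_i (lam A i)%:C) *m U.
  by rewrite {1}eigbasisE !mulmxA eigbasisKV mul1mx.
by rewrite -row_mul UA mul_diag_mx; apply/rowP => j; rewrite !mxE.
Qed.

(** Eigenvectors span. Most identities between functions of Hermitian matrices are
    checked on them. *)
Lemma eig_ext p (Z Z' : 'M[C]_(p, n)) :
  (forall (v : 'cV[C]_n) x, A *m v = x%:C *: v -> Z *m v = Z' *m v) -> Z = Z'.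
Proof.
move=> h; rewrite -[Z]mulmx1 -[Z']mulmx1 -eigbasisVK !mulmxA; congr (_ *m _).
apply/matrixP => i j.
by have := h _ _ (eigbasis_col j); rewrite -!colM => /colP/(_ i); rewrite !mxE.
Qed.

Lemma eig_coord (v : 'cV[C]_n) x i : A *m v = x%:C *: v ->
  (U *m v) i 0 != 0 -> lam A i = x.
Proof.
move=> vx; have /colP/(_ i) := congr1 (mulmx U) vx.
rewrite {1}eigbasisE -!mulmxA mulmxA eigbasisKV mul1mx mul_diag_mx -scalemxAr !mxE.
by move=> e w0; apply/complexI/(mulIf w0).
Qed.

Lemma eig_coordr (u : 'rV[C]_n) y i : u *m A = y%:C *: u ->
  (u *m U^t*) 0 i != 0 -> lam A i = y.
Proof.
move=> uy; have /rowP/(_ i) := congr1 (mulmx^~ (U^t*)) uy.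
rewrite {1}eigbasisE !mulmxA mulmxtVK ?eigbasis_unitary// mul_mx_diag -scalemxAl.
rewrite mxE [X in _ * X]mxE [RHS]mxE mulrC => e w0.
by apply/complexI/(mulIf w0); exact: e.
Qed.

Lemma fc_eig h (v : 'cV[C]_n) x : A *m v = x%:C *: v ->
  fc h A *m v = (h x)%:C *: v.
Proof.
move=> vx; rewrite -[in RHS](mul1mx v) -eigbasisVK fc.unlock -!mulmxA scalemxAr.
congr (_ *m _); apply/colP => i; rewrite mul_diag_mx [LHS]mxE [X in X * _]mxE [RHS]mxE -/U.
have [->|w0] := eqVneq ((U *m v) i 0) 0; first by rewrite !mulr0.
by rewrite (eig_coord vx).
Qed.

Lemma fc_herm h : (fc h A)^t* = fc h A.
Proof. by rewrite fc.unlock !adjmxM trmxCK adjmx_diag mulmxA. Qed.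

Lemma fc_eigr h (u : 'rV[C]_n) y : u *m A = y%:C *: u ->
  u *m fc h A = (h y)%:C *: u.
Proof.
move=> uy; rewrite -[LHS]trmxCK adjmxM fc_herm.
rewrite (@fc_eig _ _ y) ?adjmxZ ?trmxCK ?conjC_real//.
by rewrite -{1}AE -adjmxM uy adjmxZ conjC_real.
Qed.

End Eigenvectors.

Lemma fc2_eig K m n (B : 'M[C]_m) (A : 'M[C]_n) (X : 'M[C]_(m, n))
    (u : 'rV[C]_m) (v : 'cV[C]_n) y x :
  B^t* = B -> A^t* = A -> u *m B = y%:C *: u -> A *m v = x%:C *: v ->
  u *m fc2 K B A X *m v = (K y x)%:C *: (u *m X *m v).
Proof.
move=> BE AE uy vx; rewrite fc2.unlock.
rewrite -[in RHS](mulmx1 u) -(eigbasisVK BE) -[in RHS](mul1mx v) -(eigbasisVK AE).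
rewrite !mulmxA; set a := u *m _; set b := eigbasis A.
set Y := eigbasis B *m X *m b^t*.
have -> : a *m eigbasis B *m X *m b^t* = a *m Y by rewrite /Y !mulmxA.
rewrite -[LHS]mulmxA -[in RHS]mulmxA.
have hw i : (b *m v) i 0 != 0 -> lam A i = x by exact: eig_coord.
move: (b *m v) hw => w hw.
apply/matrixP => i0 j0; rewrite !ord1 !mxE mulr_sumr; apply: eq_bigr => j _.
rewrite !mxE !mulr_suml mulr_sumr; apply: eq_bigr => i _.
rewrite [X in _ * X * _]mxE -/Y.
have [->|a0] := eqVneq (a 0 i) 0; first by rewrite !mul0r mulr0.
have [->|w0] := eqVneq (w j 0) 0; first by rewrite !mulr0.
by rewrite (eig_coordr BE uy a0) (hw _ w0) !mulrA [a 0 i * _]mulrC.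
Qed.

Lemma eig_ext2 m n (B : 'M[C]_m) (A : 'M[C]_n) (Z Z' : 'M[C]_(m, n)) :
  B^t* = B -> A^t* = A ->
  (forall (u : 'rV[C]_m) (v : 'cV[C]_n) y x,
     u *m B = y%:C *: u -> A *m v = x%:C *: v -> u *m Z *m v = u *m Z' *m v) ->
  Z = Z'.
Proof.
move=> BE AE h; apply: (eig_ext AE) => v x vx.
rewrite -[LHS]mul1mx -[RHS]mul1mx -(eigbasisVK BE) -!mulmxA; congr (_ *m _).
apply/row_matrixP => i; rewrite !row_mul !mulmxA.
exact: (h _ _ _ _ (eigbasis_row BE i) vx).
Qed.


Lemma fc_ext g h n (A : 'M[C]_n) :
  (forall i, g (lam A i) = h (lam A i)) -> fc g A = fc h A.
Proof.
move=> gh; rewrite fc.unlock.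
suff -> : \row_i (g (lam A i))%:C = \row_i (h (lam A i))%:C by [].
by apply/rowP => i; rewrite !mxE gh.
Qed.

Lemma fc2_ext K K' m n (B : 'M[C]_m) (A : 'M[C]_n) X :
  (forall i j, K (lam B i) (lam A j) = K' (lam B i) (lam A j)) ->
  fc2 K B A X = fc2 K' B A X.
Proof.
move=> KK; rewrite fc2.unlock.
set Y := \matrix_(i, j) _; set Y' := \matrix_(i, j) ((K' _ _)%:C * _).
suff -> : Y = Y' by [].
by apply/matrixP => i j; rewrite !mxE KK.
Qed.

(** [S] maps the eigenvectors of [B] to eigenvectors of [A], or to zero, with the same
    eigenvalue. *)
Lemma fc_intertwine h m n (A : 'M[C]_m) (B : 'M[C]_n) (S : 'M[C]_(m, n)) :
  A^t* = A -> B^t* = B -> A *m S = S *m B -> fc h A *m S = S *m fc h B.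
Proof.
move=> AE BE AS; apply: (eig_ext BE) => v x vx.
rewrite -!mulmxA (fc_eig BE h vx) -scalemxAr; apply: (fc_eig AE).
by rewrite mulmxA AS -mulmxA vx scalemxAr.
Qed.

Lemma fc_unique n (A : 'M[C]_n) h Z : A^t* = A ->
  (forall (v : 'cV[C]_n) x, A *m v = x%:C *: v -> Z *m v = (h x)%:C *: v) ->
  Z = fc h A.
Proof.
by move=> AE Zh; apply: (eig_ext AE) => v x vx; rewrite (Zh _ _ vx) (fc_eig AE h vx).
Qed.

Lemma fc_id n (A : 'M[C]_n) : A^t* = A -> fc id A = A.
Proof. by move=> AE; apply/esym/fc_unique. Qed.

Lemma fc_cst n (A : 'M[C]_n) c : A^t* = A -> fc (fun=> c) A = (c%:C)%:M.
Proof.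
by move=> AE; apply/esym/(fc_unique AE) => v x _; rewrite mul_scalar_mx.
Qed.

Lemma fcM n (A : 'M[C]_n) g h : A^t* = A ->
  fc g A *m fc h A = fc (fun x => g x * h x) A.
Proof.
move=> AE; apply: fc_unique => // v x vx.
by rewrite -mulmxA (fc_eig AE h vx) -scalemxAr (fc_eig AE g vx) scalerA -rmorphM mulrC.
Qed.

Lemma fcD n (A : 'M[C]_n) g h : A^t* = A ->
  fc g A + fc h A = fc (fun x => g x + h x) A.
Proof.
move=> AE; apply: fc_unique => // v x vx.
by rewrite mulmxDl (fc_eig AE h vx) (fc_eig AE g vx) -scalerDl -rmorphD.
Qed.

Lemma fcZ n (A : 'M[C]_n) c h : A^t* = A ->
  c%:C *: fc h A = fc (fun x => c * h x) A.
Proof.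
move=> AE; apply: fc_unique => // v x vx.
by rewrite -scalemxAl (fc_eig AE h vx) scalerA -rmorphM.
Qed.

Lemma fc_comp n (A : 'M[C]_n) g h : A^t* = A -> fc g (fc h A) = fc (g \o h) A.
Proof.
move=> AE; apply: fc_unique => // v x vx.
exact: (fc_eig (fc_herm _ _) g (fc_eig AE h vx)).
Qed.

Lemma fc_affine n (A : 'M[C]_n) (a b : R) h : A^t* = A ->
  fc h (a%:C *: A + (b%:C)%:M) = fc (fun x => h (a * x + b)) A.
Proof.
move=> AE; have -> : a%:C *: A + (b%:C)%:M = fc (fun x => a * x + b) A.
  by rewrite -fcD// fc_cst// -(fcZ _ id)// fc_id.
exact: fc_comp.
Qed.

Lemma fc_unit n (A : 'M[C]_n) h : A^t* = A -> (forall i, h (lam A i) != 0) ->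
  fc h A \in unitmx /\ invmx (fc h A) = fc (fun x => (h x)^-1) A.
Proof.
move=> AE h0; have e : fc h A *m fc (fun x => (h x)^-1) A = 1%:M.
  rewrite fcM// (@fc_ext _ (fun=> 1)) ?fc_cst// => i.
  by rewrite mulfV.
have [u _] := mulmx1_unit e; split=> //.
by rewrite -[LHS]mulmx1 -e mulKmx.
Qed.

Lemma fc_unitary_conj n (U A : 'M[C]_n) h : U \is unitarymx -> A^t* = A ->
  fc h (U *m A *m U^t*) = U *m fc h A *m U^t*.
Proof.
move=> Uu AE; have UA := herm_conj U AE.
rewrite -[LHS](mulmxtVK _ Uu); congr (_ *m _).
by apply: fc_intertwine => //; rewrite -mulmxA unitaryVmx// mulmx1.
Qed.

Lemma fc_map_conj n (A : 'M[C]_n) h : A^t* = A ->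
  fc h (map_mx Num.conj A) = map_mx Num.conj (fc h A).
Proof.
move=> AE; have AE' : (map_mx Num.conj A)^t* = map_mx Num.conj A.
  by rewrite map_trmx AE.
apply/esym/fc_unique => // v x vx.
have mK p q (M : 'M[C]_(p, q)) : map_mx Num.conj (map_mx Num.conj M) = M.
  by apply/matrixP => i j; rewrite !mxE conjCK.
rewrite -[v in LHS]mK -map_mxM (@fc_eig _ _ AE _ _ x).
  by rewrite map_mxZ mK/= conjC_real.
by apply: (can_inj (mK _ _)); rewrite map_mxM mK vx map_mxZ mK/= conjC_real.
Qed.

Lemma char_poly_fc n (A : 'M[C]_n) h : A^t* = A ->
  char_poly (fc h A) = \prod_i ('X - (h (lam A i))%:C%:P).
Proof. by move=> AE; rewrite fc.unlock char_poly_similar ?eigbasisVK// char_poly_diag. Qed.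

(** A nondecreasing function preserves the order of the eigenvalues. *)
Lemma lam_fc n (A : 'M[C]_n) h : A^t* = A -> {homo h : x y / x <= y} ->
  lam (fc h A) =1 h \o lam A.
Proof.
move=> AE hm; apply: lam_unique => [|i j ij]; first exact: char_poly_fc.
exact/hm/lam_le.
Qed.

Lemma eq_lam n (A B : 'M[C]_n) : char_poly A = char_poly B -> lam A = lam B.
Proof. by move=> AB; apply/funext => i; rewrite lam.unlock /eigenvalues AB. Qed.

Lemma lam_unitary_conj n (U A : 'M[C]_n) : U \is unitarymx ->
  lam (U *m A *m U^t*) = lam A.
Proof. by move=> /unitarymxP Uu; apply/eq_lam/char_poly_similar. Qed.

Lemma eigenvector_lam n (A : 'M[C]_n) (v : 'cV[C]_n) x : A^t* = A ->
  v != 0 -> A *m v = x%:C *: v -> exists i, lam A i = x.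
Proof.
move=> AE v0 vx; have [w0|] := eqVneq (eigbasis A *m v) 0.
  by move: v0; rewrite -[v]mul1mx -(eigbasisVK AE) -mulmxA w0 mulmx0 eqxx.
by move=> /cV0Pn[i wi]; exists i; exact: (eig_coord AE vx wi).
Qed.

(** * Positive definite matrices *)

Lemma Herm_posP n (A : 'M[C]_n) :
  Herm_pos R n A <-> A^t* = A /\ forall i, 0 < lam A i.
Proof.
split=> [[/HermP AE Ap]|[AE Ap]]; split; [exact: AE| |exact/HermP|].
  move=> i; have U0 : col i ((eigbasis A)^t*) != 0.
    apply/eqP => /(congr1 (mulmx (eigbasis A))).
    rewrite -colM eigbasisKV// mulmx0 => /colP/(_ i); rewrite !mxE eqxx.
    by apply/eqP; rewrite oner_eq0.
  have := Ap _ U0; rewrite -mulmxA eigbasis_col// -scalemxAr mxE.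
  have -> : ((col i ((eigbasis A)^t*))^t* *m col i ((eigbasis A)^t*)) ord0 ord0 = 1.
    rewrite [RHS](_ : 1 = (eigbasis A *m (eigbasis A)^t*) i i); last first.
      by rewrite eigbasisKV// mxE eqxx.
    by rewrite !mxE; apply: eq_bigr => k _; rewrite !mxE conjCK.
  by rewrite mulr1 ltcR.
move=> v v0; rewrite {1}(eigbasisE AE) -!mulmxA.
set w := _ *m v; have w0 : w != 0.
  apply: contra_neq v0 => w0.
  by rewrite -[v]mul1mx -(eigbasisVK AE) -mulmxA -/w w0 mulmx0.
rewrite (_ : v^t* *m _ = w^t* *m (diag_mx (\row_i (lam A i)%:C) *m w)); last first.
  by rewrite /w adjmxM mulmxA.
clearbody w; rewrite mul_diag_mx mxE.
under eq_bigr do rewrite !mxE mulrCA -normCKC.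
have /cV0Pn[i wi] := w0; rewrite (bigD1 i)//= ltr_wpDr//.
  by apply: sumr_ge0 => k _; rewrite mulr_ge0// ?exprn_ge0// lecR ltW.
by rewrite mulr_gt0 ?ltcR// exprn_gt0// normr_gt0.
Qed.

(** * Two-variable functional calculus *)

Section TwoVariables.
Variables (m n : nat) (B : 'M[C]_m) (A : 'M[C]_n).
Hypotheses (BE : B^t* = B) (AE : A^t* = A).

Lemma fc2_unique K (X Z : 'M[C]_(m, n)) :
  (forall (u : 'rV[C]_m) (v : 'cV[C]_n) y x,
     u *m B = y%:C *: u -> A *m v = x%:C *: v ->
     u *m Z *m v = (K y x)%:C *: (u *m X *m v)) -> Z = fc2 K B A X.
Proof.
move=> h; apply: (eig_ext2 BE AE) => u v y x uy vx.
by rewrite (h _ _ _ _ uy vx) (fc2_eig K X BE AE uy vx).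
Qed.

Lemma fc2_linear K : linear (fc2 K B A).
Proof.
move=> a X Y; apply/esym/fc2_unique => u v y x uy vx.
rewrite mulmxDr mulmxDl -scalemxAr -scalemxAl !(fc2_eig K _ BE AE uy vx).
by rewrite mulmxDr mulmxDl scalerDr -scalemxAr -scalemxAl !scalerA mulrC.
Qed.

Lemma fc2_comp K K' X :
  fc2 K B A (fc2 K' B A X) = fc2 (fun y x => K y x * K' y x) B A X.
Proof.
apply: fc2_unique => u v y x uy vx.
by rewrite !(fc2_eig _ _ BE AE uy vx) scalerA -rmorphM.
Qed.

Lemma fc2_cst c X : fc2 (fun _ _ => c) B A X = c%:C *: X.
Proof.
by apply/esym/fc2_unique => u v y x _ _; rewrite -scalemxAr -scalemxAl.
Qed.

(** For a divided difference [K] of [f], this solves a Sylvester equation. *)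
Lemma fc2_divdiff K f X :
  (forall y x, K y x * (y - x) = f y - f x) ->
  B *m fc2 K B A X - fc2 K B A X *m A = fc f B *m X - X *m fc f A.
Proof.
move=> Kf; apply: (eig_ext2 BE AE) => u v y x uy vx.
have E1 Z : u *m (B *m Z) *m v = y%:C *: (u *m Z *m v).
  by rewrite (mulmxA u) uy -!scalemxAl.
have E2 Z : u *m (Z *m A) *m v = x%:C *: (u *m Z *m v).
  by rewrite (mulmxA u) -(mulmxA _ A) vx -scalemxAr.
have E3 : u *m (fc f B *m X) *m v = (f y)%:C *: (u *m X *m v).
  by rewrite (mulmxA u) (fc_eigr BE f uy) -!scalemxAl.
have E4 : u *m (X *m fc f A) *m v = (f x)%:C *: (u *m X *m v).
  by rewrite (mulmxA u) -(mulmxA _ (fc f A)) (fc_eig AE f vx) -scalemxAr.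
rewrite !mulmxBr !mulmxBl E1 E2 E3 E4 (fc2_eig _ _ BE AE uy vx) !scalerA -!scalerBl.
by rewrite -!rmorphM -!rmorphB -Kf mulrBr ![_ * K y x]mulrC.
Qed.

End TwoVariables.

(** Hence the increments of [fc f] are linear in those of the matrix, with coefficients
    that are themselves functions of the two matrices: differentiability of [fc f] follows
    from the continuity of [fc2 K]. *)
Lemma fc_increment n (A B : 'M[C]_n) K f : B^t* = B -> A^t* = A ->
  (forall y x, K y x * (y - x) = f y - f x) ->
  fc f B - fc f A = fc2 K B A (B - A).
Proof.
move=> BE AE Kf; apply: (fc2_unique BE AE) => u v y x uy vx.
rewrite !mulmxBr !mulmxBl (fc_eigr BE f uy) -(mulmxA _ (fc f A)) (fc_eig AE f vx).
rewrite uy -(mulmxA _ A) vx -!scalemxAl -!scalemxAr -!scalerBl scalerA.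
by rewrite -!rmorphB -rmorphM Kf.
Qed.

(** As in [fc_intertwine], [S] and [T] preserve eigenvectors; unitary conjugations and
    eigenvectors themselves, seen as intertwiners with matrices of size one, are the
    cases of interest. *)
Lemma fc2_intertwine K m n p q (B : 'M[C]_m) (A : 'M[C]_n) (B' : 'M[C]_p)
    (A' : 'M[C]_q) S T X :
  B^t* = B -> A^t* = A -> B'^t* = B' -> A'^t* = A' ->
  B' *m S = S *m B -> T *m A' = A *m T ->
  fc2 K B' A' (S *m X *m T) = S *m fc2 K B A X *m T.
Proof.
move=> BE AE BE' AE' BS AT; apply/esym/fc2_unique => // u v y x uy vx.
have uy' : u *m S *m B = y%:C *: (u *m S).
  by rewrite -mulmxA -BS mulmxA uy scalemxAl.
have vx' : A *m (T *m v) = x%:C *: (T *m v).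
  by rewrite mulmxA -AT -mulmxA vx scalemxAr.
by rewrite !mulmxA -(mulmxA _ T) (fc2_eig K X BE AE uy' vx') !mulmxA.
Qed.

Lemma fc2_affine K m n (B : 'M[C]_m) (A : 'M[C]_n) (a b : R) X :
  B^t* = B -> A^t* = A ->
  fc2 K (a%:C *: B + (b%:C)%:M) (a%:C *: A + (b%:C)%:M) X
  = fc2 (fun y x => K (a * y + b) (a * x + b)) B A X.
Proof.
move=> BE AE; apply: fc2_unique => // u v y x uy vx.
have Bab : (a%:C *: B + (b%:C)%:M)^t* = a%:C *: B + (b%:C)%:M.
  by apply/hermDscalar/hermZ.
have Aab : (a%:C *: A + (b%:C)%:M)^t* = a%:C *: A + (b%:C)%:M.
  by apply/hermDscalar/hermZ.
apply: fc2_eig => //.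
  rewrite mulmxDr -scalemxAr uy scalerA mul_mx_scalar -scalerDl.
  by rewrite -rmorphM -rmorphD.
rewrite mulmxDl -scalemxAl vx scalerA mul_scalar_mx -scalerDl.
by rewrite -rmorphM -rmorphD.
Qed.

Lemma fc2_map_conj K m n (B : 'M[C]_m) (A : 'M[C]_n) X :
  B^t* = B -> A^t* = A ->
  fc2 K (map_mx Num.conj B) (map_mx Num.conj A) (map_mx Num.conj X)
  = map_mx Num.conj (fc2 K B A X).
Proof.
move=> BE AE; have cE p (M : 'M[C]_p) : M^t* = M ->
    (map_mx Num.conj M)^t* = map_mx Num.conj M.
  by move=> ME; rewrite map_trmx ME.
have mK p q (M : 'M[C]_(p, q)) : map_mx Num.conj (map_mx Num.conj M) = M.
  by apply/matrixP => i j; rewrite !mxE conjCK.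
apply/esym/fc2_unique => [||u v y x uy vx]; [exact: cE|exact: cE|].
rewrite -[u]mK -[v]mK -!map_mxM (@fc2_eig _ _ _ _ _ _ _ _ y x)//.
- by rewrite map_mxZ/= conjC_real.
- by apply: (can_inj (mK _ _)); rewrite map_mxM mK uy map_mxZ mK/= conjC_real.
- by apply: (can_inj (mK _ _)); rewrite map_mxM mK vx map_mxZ mK/= conjC_real.
Qed.

End Adjoint.

(** * Maps of class [C^k] *)

Section ClassC.
Variables (R : realType) (V : normedModType R).

Lemma class_C_ext (W : normedModType R) k (D : set V) (f g : V -> W) :
  open D -> (forall x, D x -> f x = g x) -> class_C k D f -> class_C k D g.
Proof.
move=> oD; elim: k f g => [|k IH] f g fg /=.
  move=> fc x Dx; have fgx : \forall y \near x, f y = g y.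
    by near=> y; apply: fg; near: y; exact: open_nbhs_nbhs.
  suff : g @ x --> g x by [].
  rewrite -fg//; apply: cvg_trans (fc x Dx).
  by apply: near_eq_cvg; move: fgx; apply: filterS => y.
move=> [fd fD]; split=> [x Dx|v].
  have fgx : \forall y \near x, f y = g y.
    by near=> y; apply: fg; near: y; exact: open_nbhs_nbhs.
  have /diff_locallyP[dc fE] := fd _ Dx.
  apply/diff_locallyP.
  have gE : g \o shift x = cst (g x) + 'd f x +o_ 0 id.
    apply/eqaddoP => e e0; have /eqaddoP/(_ e e0) := fE.
    have : \forall h \near 0, f (h + x) = g (h + x).
      by move: fgx; rewrite (near_shift 0)/= subr0.
    by apply: filter_app2; near=> h => /= fgh; rewrite /= !fctE /= fgh fg.
  by rewrite (diff_unique dc gE).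
apply: IH (fD v) => x Dx; apply: near_eq_derive.
by near=> y; apply: fg; near: y; exact: open_nbhs_nbhs.
Unshelve. all: by end_near. Qed.

Lemma class_CS (W : normedModType R) k (D : set V) (f : V -> W) :
  class_C k.+1 D f -> class_C k D f.
Proof.
elim: k f => [|k IH] f [fd fD] => [x Dx|].
  exact/differentiable_continuous/fd.
by split=> // v; apply: IH.
Qed.

Lemma class_C0 (W : normedModType R) k (D : set V) (f : V -> W) :
  class_C k D f -> class_C 0 D f.
Proof. by elim: k => // k IH /class_CS. Qed.

Lemma class_C_cst (W : normedModType R) k (D : set V) (c : W) :
  class_C k D (fun=> c).
Proof.
elim: k c => [|k IH] c; first by move=> x _; exact: cst_continuous.
split=> [x _|v]; first exact: differentiable_cst.
rewrite (_ : (fun x => 'D_v _ x) = fun=> 0) ?funeqE//.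
by move=> x; rewrite derive_cst.
Qed.

Lemma class_C_linear (W : normedModType R) k (D : set V) (f : {linear V -> W}) :
  continuous f -> class_C k D f.
Proof.
move=> fc; case: k => [|k]; first by move=> x _; exact: fc.
split=> [x _|v]; first exact: linear_differentiable.
rewrite (_ : (fun x => 'D_v _ x) = fun=> f v); first exact: class_C_cst.
by apply/funext => x; rewrite deriveE ?(diff_lin _ fc)//; exact: linear_differentiable.
Qed.

Lemma class_CD (W : normedModType R) k (D : set V) (f g : V -> W) : open D ->
  class_C k D f -> class_C k D g -> class_C k D (fun x => f x + g x).
Proof.
move=> oD; elim: k f g => [|k IH] f g.
  by move=> fc gc x Dx; apply: continuousD; [exact: fc|exact: gc].
move=> [fd fD] [gd gD]; split=> [x Dx|v].
  by apply: differentiableD; [exact: fd|exact: gd].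
apply: class_C_ext (IH _ _ (fD v) (gD v)) => // x Dx; rewrite -deriveD//.
  exact/diff_derivable/fd.
exact/diff_derivable/gd.
Qed.

Lemma class_C_sum (W : normedModType R) (I : Type) (r : seq I) k (D : set V)
    (f : I -> V -> W) : open D ->
  (forall i, class_C k D (f i)) -> class_C k D (fun x => \sum_(i <- r) f i x).
Proof.
move=> oD fC; elim: r => [|i r IH].
  by under eq_fun do rewrite big_nil; exact: class_C_cst.
by under eq_fun do rewrite big_cons; exact: class_CD.
Qed.

Lemma class_CM k (D : set V) (f g : V -> R) : open D ->
  class_C k D f -> class_C k D g -> class_C k D (fun x => f x * g x).
Proof.
move=> oD; elim: k f g => [|k IH] f g.
  by move=> fc gc x Dx; apply: continuousM; [exact: fc|exact: gc].
move=> fC gC; have [fd fD] := fC; have [gd gD] := gC; split=> [x Dx|v].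
  by apply: differentiableM; [exact: fd|exact: gd].
apply: (@class_C_ext _ _ _ (fun x => f x * 'D_v g x + g x * 'D_v f x)) => //.
  move=> x Dx; rewrite -[RHS]/('D_v (f * g) x) deriveM//.
    exact/diff_derivable/fd.
  exact/diff_derivable/gd.
apply: class_CD => //.
  exact: (IH _ _ (class_CS fC) (gD v)).
exact: (IH _ _ (class_CS gC) (fD v)).
Qed.

Lemma class_CN k (D : set V) (f : V -> R) : open D ->
  class_C k D f -> class_C k D (fun x => - f x).
Proof.
move=> oD fC; apply: (@class_C_ext _ _ _ (fun x => -1 * f x)) => //.
  by move=> x _; rewrite mulN1r.
by apply: class_CM => //; exact: class_C_cst.
Qed.

Lemma class_CV k (D : set V) (f : V -> R) : open D ->
  (forall x, D x -> f x != 0) -> class_C k D f -> class_C k D (fun x => (f x)^-1).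
Proof.
move=> oD f0; elim: k => [|k IH].
  by move=> fc x Dx; apply: continuousV; [exact: f0|exact: fc].
move=> fC; have [fd fD] := fC; split=> [x Dx|v].
  by apply: differentiableV; [exact: fd|exact: f0].
have VC := IH (class_CS fC).
apply: (@class_C_ext _ _ _ (fun x => - ((f x)^-1 * (f x)^-1 * 'D_v f x))) => //.
  move=> x Dx; rewrite deriveV ?f0//; last exact/diff_derivable/fd.
  by rewrite /GRing.scale/= mulNr expr2 invfM.
apply: class_CN => //; apply: class_CM => //; last exact: (fD v).
exact: class_CM.
Qed.

(** Caratheodory's form of differentiability. *)
Lemma differentiableM_continuous (u g : V -> R) x :
  differentiable u x -> u x = 0 -> {for x, continuous g} ->
  differentiable (fun y => u y * g y) x /\
  forall v, 'D_v (fun y => u y * g y) x = 'D_v u x * g x.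
Proof.
move=> ud u0 gc; set w := fun y => u y * g y.
have dc : continuous (g x \*: 'd u x : V -> R).
  by move=> y; apply: continuousZl_tmp; exact: diff_continuous.
have wE : w \o shift x = cst (w x) + (g x \*: 'd u x) +o_ 0 id.
  apply/eqaddoP => e e0.
  have /eqO_exP[K [K0 uK]] : ('d u x : V -> R) =O_ 0 id by exact: diff_eqO.
  have /diff_locallyP[_ /eqaddoP uo] := ud.
  have K1 : 0 < K + 1 by rewrite addr_gt0.
  have d1 : 0 < e / (2 * (K + 1)) by rewrite divr_gt0// mulr_gt0.
  have G0 : 0 < `|g x| + 1 by rewrite ltr_wpDl.
  have d2 : 0 < Num.min 1 (e / (2 * (`|g x| + 1))).
    by rewrite lt_min ltr01 divr_gt0// mulr_gt0.
  have gn : \forall h \near 0, `|g (h + x) - g x| < e / (2 * (K + 1)).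
    have gx : \forall y \near x, `|g y - g x| < e / (2 * (K + 1)).
      have /cvgrPdist_lt/(_ _ d1) := gc.
      by apply: filterS => y; rewrite distrC.
    by move: gx; rewrite (near_shift 0 x) subr0.
  have := uo _ d2; move: uK gn; apply: filter_app3; near=> h => /= uK gn uo'.
  have {}uo' : `|u (h + x) - 'd u x h| <= Num.min 1 (e / (2 * (`|g x| + 1))) * `|h|.
    by apply: le_trans uo'; rewrite !fctE /= u0 add0r.
  rewrite !fctE /= /w u0 mul0r add0r.
  have ub : `|u (h + x)| <= (K + 1) * `|h|.
    rewrite -(subrK ('d u x h) (u (h + x))) (le_trans (ler_normD _ _))//.
    rewrite mulrDl mul1r addrC lerD// (le_trans uo')// ler_piMl//.
    by rewrite ge_min lexx.
  rewrite (_ : _ - _ = u (h + x) * (g (h + x) - g x)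
      + g x * (u (h + x) - 'd u x h)); last by rewrite /GRing.scale/=; ring.
  rewrite (le_trans (ler_normD _ _))// !normrM (splitr e) mulrDl lerD//.
    apply: (@le_trans _ _ ((K + 1) * `|h| * (e / (2 * (K + 1))))).
      by rewrite ler_pM// ltW.
    by rewrite [leLHS](_ : _ = e / 2 * `|h|)//; field; rewrite gt_eqF.
  apply: (@le_trans _ _ ((`|g x| + 1) * (e / (2 * (`|g x| + 1)) * `|h|))).
    rewrite ler_pM// ?lerDl// (le_trans uo')// ler_wpM2r//.
    by rewrite ge_min lexx orbT.
  by rewrite [leLHS](_ : _ = e / 2 * `|h|)//; field; rewrite gt_eqF.
have wd : differentiable w x.
  by apply/diff_locallyP; rewrite (diff_unique dc wE).
split=> // v; rewrite !deriveE// (diff_unique dc wE).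
by rewrite /= /GRing.scale/= mulrC.
Unshelve. all: by end_near. Qed.

End ClassC.

(** * Complex and matrix valued maps of class [C^k] *)

Section ClassCIncrement.
Variables (R : realType) (V : normedModType R).

Lemma near_eq_differentiable (f g : V -> R) x :
  (\forall y \near x, f y = g y) -> differentiable f x -> differentiable g x.
Proof.
move=> fg /diff_locallyP[dc fE]; apply/diff_locallyP.
have gE : g \o shift x = cst (g x) + 'd f x +o_ 0 id.
  apply/eqaddoP => e e0; have /eqaddoP/(_ e e0) := fE.
  have : \forall h \near 0, f (h + x) = g (h + x).
    by move: fg; rewrite (near_shift 0)/= subr0.
  apply: filter_app2; near=> h => /= fgh.
  by rewrite /= !fctE /= fgh (nbhs_singleton fg).
by rewrite (diff_unique dc gE).
Unshelve. all: by end_near. Qed.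

Lemma differentiable_sum_continuous (I : Type) (r : seq I) (u g : I -> V -> R) x :
  (forall i, differentiable (u i) x) -> (forall i, {for x, continuous (g i)}) ->
  differentiable (fun y => \sum_(i <- r) (u i y - u i x) * g i y) x /\
  forall v, 'D_v (fun y => \sum_(i <- r) (u i y - u i x) * g i y) x
            = \sum_(i <- r) 'D_v (u i) x * g i x.
Proof.
move=> ud gc; elim: r => [|i r [IHd IHD]].
  under eq_fun do rewrite big_nil.
  by split=> [|v]; rewrite ?big_nil ?derive_cst//; exact: differentiable_cst.
under eq_fun do rewrite big_cons.
have u0d : differentiable (fun y => u i y - u i x) x.
  exact/differentiableB.
have [//||d D] := @differentiableM_continuous _ _ _ (g i) x u0d; first exact: subrr.
  exact: gc.
split=> [|v]; first exact: differentiableD.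
rewrite -[LHS]/('D_v ((fun y => (u i y - u i x) * g i y) +
  (fun y => \sum_(i <- r) (u i y - u i x) * g i y)) x).
rewrite deriveD ?big_cons ?IHD ?D; [|exact: diff_derivable..].
congr (_ * _ + _); rewrite -[LHS]/('D_v (u i - cst (u i x)) x) deriveB//.
  by rewrite derive_cst subr0.
exact: diff_derivable.
Qed.

(** Caratheodory's criterion, for all orders: by [differentiableM_continuous] the
    derivative at [x] is read off from the increments. It replaces a composition theorem:
    maps of matrices are treated by exhibiting their increments. *)
Lemma class_C_increment k (D : set V) (f : V -> R) (I : Type) (r : seq I)
    (u : I -> V -> R) (g : I -> V -> V -> R) : open D ->
  (forall i, class_C k.+1 D (u i)) ->
  (forall x i, D x -> {for x, continuous (g i x)}) ->
  (forall x y, D x -> D y -> f y = f x + \sum_(i <- r) (u i y - u i x) * g i x y) ->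
  (forall v, class_C k D (fun x => \sum_(i <- r) 'D_v (u i) x * g i x x)) ->
  class_C k.+1 D f.
Proof.
move=> oD uC gc fE DC.
have key x : D x -> differentiable f x /\
    forall v, 'D_v f x = \sum_(i <- r) 'D_v (u i) x * g i x x.
  move=> Dx; pose F y := f x + \sum_(i <- r) (u i y - u i x) * g i x y.
  have [|//|Sd SD] := @differentiable_sum_continuous _ r u (fun i => g i x) x.
  - by move=> i; have [ud _] := uC i; exact: ud.
  - by move=> i; exact: gc.
  have Ff : \forall y \near x, F y = f y.
    by near=> y; apply/esym/fE => //; near: y; exact: open_nbhs_nbhs.
  have Fd : differentiable F x.
    by apply: (@differentiableD _ _ _ (cst (f x))) => //; exact: differentiable_cst.
  split=> [|v]; first exact: near_eq_differentiable Fd.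
  rewrite -(near_eq_derive _ Ff) -SD.
  rewrite -[LHS]/('D_v (cst (f x) + (fun y => \sum_(i <- r) (u i y - u i x) * g i x y)) x).
  rewrite deriveD ?derive_cst ?add0r//; apply: diff_derivable => //.
split=> [x /key[]//|v].
by apply: class_C_ext (DC v) => // x Dx; have [_ ->] := key _ Dx.
Unshelve. all: by end_near. Qed.

Local Notation C := R[i].

(** Differentiability is over the real numbers, whereas [R[i]] is normed over itself;
    hence the two components. *)
Definition cC k (D : set V) (f : V -> C) :=
  class_C k D (fun x => complex.Re (f x)) /\ class_C k D (fun x => complex.Im (f x)).

Definition dC v (f : V -> C) x : C :=
  'D_v (fun x => complex.Re (f x)) x +i* 'D_v (fun x => complex.Im (f x)) x.

Lemma ReM (z w : C) : complex.Re (z * w) =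
  complex.Re z * complex.Re w - complex.Im z * complex.Im w.
Proof. by case: z w => a b []. Qed.

Lemma ImM (z w : C) : complex.Im (z * w) =
  complex.Re z * complex.Im w + complex.Im z * complex.Re w.
Proof. by case: z w => a b []. Qed.

Lemma ReD (z w : C) : complex.Re (z + w) = complex.Re z + complex.Re w.
Proof. by case: z w => a b []. Qed.

Lemma ImD (z w : C) : complex.Im (z + w) = complex.Im z + complex.Im w.
Proof. by case: z w => a b []. Qed.

Lemma ReN (z : C) : complex.Re (- z) = - complex.Re z.
Proof. by case: z. Qed.

Lemma ImN (z : C) : complex.Im (- z) = - complex.Im z.
Proof. by case: z. Qed.

Lemma Re_sum (I : Type) (r : seq I) (z : I -> C) :
  complex.Re (\sum_(i <- r) z i) = \sum_(i <- r) complex.Re (z i).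
Proof. exact: (big_morph _ ReD erefl). Qed.

Lemma Im_sum (I : Type) (r : seq I) (z : I -> C) :
  complex.Im (\sum_(i <- r) z i) = \sum_(i <- r) complex.Im (z i).
Proof. exact: (big_morph _ ImD erefl). Qed.

Lemma cC_increment k (D : set V) (f : V -> C) (I : finType)
    (u : I -> V -> C) (g : I -> V -> V -> C) : open D ->
  (forall i, cC k.+1 D (u i)) ->
  (forall x i, D x -> cC 0 D (g i x)) ->
  (forall x y, D x -> D y -> f y - f x = \sum_i (u i y - u i x) * g i x y) ->
  (forall v, cC k D (fun x => \sum_i dC v (u i) x * g i x x)) ->
  cC k.+1 D f.
Proof.
move=> oD uC gC fE dCC.
pose u' (p : I * bool) x := if p.2 then complex.Im (u p.1 x) else complex.Re (u p.1 x).
have u'C p : class_C k.+1 D (u' p).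
  by case: p => i []; [exact: (uC i).2|exact: (uC i).1].
have sumE (h : I * bool -> R) : \sum_p h p = \sum_i (h (i, false) + h (i, true)).
  rewrite (eq_bigr (fun p => h (p.1, p.2))) => [|[]//].
  rewrite -(pair_bigA _ (fun i b => h (i, b)))/=; apply: eq_bigr => i _.
  by rewrite big_bool/= addrC.
split.
- pose g' (p : I * bool) x y :=
    if p.2 then - complex.Im (g p.1 x y) else complex.Re (g p.1 x y).
  apply: (@class_C_increment _ _ _ _ (index_enum _) u' g') => //.
  + move=> x [i []] Dx; rewrite /g'/=; last exact: (gC x i Dx).1.
    by apply: continuousN; exact: (gC x i Dx).2.
  + move=> x y Dx Dy; rewrite sumE; apply/eqP; rewrite addrC -subr_eq -ReN -ReD fE//.
    rewrite Re_sum; apply/eqP/eq_bigr => i _.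
    by rewrite ReM ReD ImD ReN ImN /u' /g' /= mulrN.
  + move=> v; apply: class_C_ext (dCC v).1 => // x Dx.
    rewrite sumE Re_sum; apply: eq_bigr => i _.
    by rewrite ReM /dC /u' /g' /= mulrN.
- pose g' (p : I * bool) x y :=
    if p.2 then complex.Re (g p.1 x y) else complex.Im (g p.1 x y).
  apply: (@class_C_increment _ _ _ _ (index_enum _) u' g') => //.
  + by move=> x [i []] Dx; rewrite /g'/=; [exact: (gC x i Dx).1|exact: (gC x i Dx).2].
  + move=> x y Dx Dy; rewrite sumE; apply/eqP; rewrite addrC -subr_eq -ImN -ImD fE//.
    rewrite Im_sum; apply/eqP/eq_bigr => i _.
    by rewrite ImM ReD ImD ReN ImN /u' /g' /=.
  + move=> v; apply: class_C_ext (dCC v).2 => // x Dx.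
    rewrite sumE Im_sum; apply: eq_bigr => i _.
    by rewrite ImM /dC /u' /g' /=.
Qed.

End ClassCIncrement.

Section MatrixClassC.
Variables (R : realType) (V : normedModType R) (k : nat) (D : set V).
Hypothesis oD : open D.
Local Notation C := R[i].
Implicit Types f g : V -> C.

Lemma cC_ext f g : (forall x, D x -> f x = g x) -> cC k D f -> cC k D g.
Proof.
move=> fg [fR fI]; split; first by apply: class_C_ext fR => // x Dx; rewrite fg.
by apply: class_C_ext fI => // x Dx; rewrite fg.
Qed.

Lemma cC_cst (c : C) : cC k D (fun=> c).
Proof. by split; exact: class_C_cst. Qed.

Lemma cCD f g : cC k D f -> cC k D g -> cC k D (fun x => f x + g x).
Proof.
move=> [fR fI] [gR gI]; split.
  by under eq_fun do rewrite ReD; exact: class_CD.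
by under eq_fun do rewrite ImD; exact: class_CD.
Qed.

Lemma cCM f g : cC k D f -> cC k D g -> cC k D (fun x => f x * g x).
Proof.
move=> [fR fI] [gR gI]; split.
  under eq_fun do rewrite ReM; apply: class_CD => //; first exact: class_CM.
  by apply: class_CN => //; exact: class_CM.
by under eq_fun do rewrite ImM; apply: class_CD => //; exact: class_CM.
Qed.

Lemma cCN f : cC k D f -> cC k D (fun x => - f x).
Proof.
move=> [fR fI]; split; first by under eq_fun do rewrite ReN; exact: class_CN.
by under eq_fun do rewrite ImN; exact: class_CN.
Qed.

Lemma cC_conj f : cC k D f -> cC k D (fun x => Num.conj (f x)).
Proof.
move=> [fR fI]; split.
  by rewrite (_ : (fun x => _) = (fun x => complex.Re (f x)))// funeqE => x; case: (f x).
rewrite (_ : (fun x => _) = (fun x => - complex.Im (f x))); first exact: class_CN.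
by rewrite funeqE => x; case: (f x).
Qed.

Lemma cC_real (f : V -> R) : class_C k D f -> cC k D (fun x => (f x)%:C).
Proof. by move=> fC; split=> //; exact: class_C_cst. Qed.

Lemma cC_sum (I : Type) (r : seq I) (f : I -> V -> C) :
  (forall i, cC k D (f i)) -> cC k D (fun x => \sum_(i <- r) f i x).
Proof.
move=> fC; elim: r => [|i r IH].
  by under eq_fun do rewrite big_nil; exact: cC_cst.
by under eq_fun do rewrite big_cons; exact: cCD.
Qed.

Lemma cC_prod (I : Type) (r : seq I) (f : I -> V -> C) :
  (forall i, cC k D (f i)) -> cC k D (fun x => \prod_(i <- r) f i x).
Proof.
move=> fC; elim: r => [|i r IH].
  by under eq_fun do rewrite big_nil; exact: cC_cst.
by under eq_fun do rewrite big_cons; exact: cCM.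
Qed.

Lemma cCV f : (forall x, D x -> f x != 0) -> cC k D f -> cC k D (fun x => (f x)^-1).
Proof.
move=> f0 [fR fI].
pose q x := complex.Re (f x) * complex.Re (f x) + complex.Im (f x) * complex.Im (f x).
have qC : class_C k D q by apply: class_CD => //; exact: class_CM.
have q0 x : D x -> q x != 0.
  move=> /f0; apply: contra_neq => /eqP; rewrite /q -!expr2.
  rewrite paddr_eq0 ?sqr_ge0// !sqrf_eq0; case: (f x) => a b /=.
  by move=> /andP[/eqP -> /eqP ->].
have qVC := class_CV oD q0 qC.
apply: (@cC_ext (fun x => (q x)^-1%:C * Num.conj (f x))).
  move=> x Dx; have := q0 _ Dx; rewrite /q; case: (f x) => a b /= ab0.
  have z0 : (a +i* b : C) != 0.
    apply: contra_neq ab0 => -[-> ->].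
    by rewrite mul0r addr0.
  apply: (mulIf z0); rewrite mulVf// -mulrA; apply/eqP; rewrite eq_complex/=.
  apply/andP; split; apply/eqP.
    by rewrite mul0r subr0 mulNr opprK mulVf.
  by rewrite mul0r addr0 mulNr [b * a]mulrC subrr mulr0.
by apply: cCM; [exact: cC_real|exact: cC_conj].
Qed.

Definition mC k' m n (F : V -> 'M[C]_(m, n)) := forall i j, cC k' D (fun x => F x i j).

Lemma mC_ext m n (F G : V -> 'M[C]_(m, n)) :
  (forall x, D x -> F x = G x) -> mC k F -> mC k G.
Proof. by move=> FG FC i j; apply: cC_ext (FC i j) => x Dx; rewrite FG. Qed.

Lemma mC_cst m n (A : 'M[C]_(m, n)) : mC k (fun=> A).
Proof. by move=> i j; exact: cC_cst. Qed.

Lemma mC_matrix m n (f : 'I_m -> 'I_n -> V -> C) :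
  (forall i j, cC k D (f i j)) -> mC k (fun x => \matrix_(i, j) f i j x).
Proof. by move=> fC i j; under eq_fun do rewrite mxE. Qed.

Lemma mCD m n (F G : V -> 'M[C]_(m, n)) :
  mC k F -> mC k G -> mC k (fun x => F x + G x).
Proof. by move=> FC GC i j; under eq_fun do rewrite mxE; exact: cCD. Qed.

Lemma mCN m n (F : V -> 'M[C]_(m, n)) : mC k F -> mC k (fun x => - F x).
Proof. by move=> FC i j; under eq_fun do rewrite mxE; exact: cCN. Qed.

Lemma mCZ m n f (F : V -> 'M[C]_(m, n)) :
  cC k D f -> mC k F -> mC k (fun x => f x *: F x).
Proof. by move=> fC FC i j; under eq_fun do rewrite mxE; exact: cCM. Qed.

Lemma mCM m n p (F : V -> 'M[C]_(m, n)) (G : V -> 'M[C]_(n, p)) :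
  mC k F -> mC k G -> mC k (fun x => F x *m G x).
Proof.
move=> FC GC i j; under eq_fun do rewrite mxE.
by apply: cC_sum => l; exact: cCM.
Qed.

Lemma mC_scalar n f : cC k D f -> mC k (fun x => (f x)%:M : 'M[C]_n).
Proof.
move=> fC i j; under eq_fun do rewrite mxE.
case: (i == j); first exact: fC.
by under eq_fun do rewrite mulr0n; exact: cC_cst.
Qed.

Lemma mC_adj m n (F : V -> 'M[C]_(m, n)) : mC k F -> mC k (fun x => (F x)^t*).
Proof. by move=> FC i j; under eq_fun do rewrite !mxE; exact: cC_conj. Qed.

Lemma cC_trace n (F : V -> 'M[C]_n) : mC k F -> cC k D (fun x => \tr (F x)).
Proof. by move=> FC; apply: cC_sum => i; exact: FC. Qed.

Lemma cC_det n (F : V -> 'M[C]_n) : mC k F -> cC k D (fun x => \det (F x)).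
Proof.
move=> FC; apply: cC_sum => s; apply: cCM; first exact: cC_cst.
by apply: cC_prod => i; exact: FC.
Qed.

(** Cramer's rule. *)
Lemma mC_inv n (F : V -> 'M[C]_n) : (forall x, D x -> F x \in unitmx) ->
  mC k F -> mC k (fun x => invmx (F x)).
Proof.
move=> Fu FC; apply: (@mC_ext _ _ (fun x => (\det (F x))^-1 *: \adj (F x))).
  by move=> x Dx; rewrite /invmx Fu.
apply: mCZ.
  by apply: cCV; [move=> x /Fu; rewrite unitmxE unitfE|exact: cC_det].
move=> i j; under eq_fun do rewrite mxE.
apply: cCM; first exact: cC_cst.
by apply: cC_det => a b; under eq_fun do rewrite !mxE; exact: FC.
Qed.

Lemma mC_block m1 m2 n1 n2 (F11 : V -> 'M[C]_(m1, n1)) (F12 : V -> 'M[C]_(m1, n2))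
    (F21 : V -> 'M[C]_(m2, n1)) (F22 : V -> 'M[C]_(m2, n2)) :
  mC k F11 -> mC k F12 -> mC k F21 -> mC k F22 ->
  mC k (fun x => block_mx (F11 x) (F12 x) (F21 x) (F22 x)).
Proof.
move=> C11 C12 C21 C22 i j; under eq_fun do rewrite mxE.
case: (fintype.split i) => a; under eq_fun do rewrite mxE;
  case: (fintype.split j) => b.
- exact: C11.
- exact: C12.
- exact: C21.
- exact: C22.
Qed.

Lemma mC_le0 m n (F : V -> 'M[C]_(m, n)) : mC k F -> mC 0 F.
Proof.
by move=> FC i j; have [FR FI] := FC i j; split; [exact: class_C0 FR|exact: class_C0 FI].
Qed.

Lemma mC_derive v m n (F : V -> 'M[C]_(m, n)) : mC k.+1 F ->
  mC k (fun x => \matrix_(i, j) dC v (fun x => F x i j) x).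
Proof.
move=> FC; apply: mC_matrix => i j; have [[_ FR] [_ FI]] := FC i j.
by split; [exact: FR|exact: FI].
Qed.

End MatrixClassC.

(** * The exponential of complex matrices *)

Definition mpow (R : realType) n (M : 'M[R[i]]_n) k := iter k (mulmx M) 1%:M.

HB.lock Definition expmx (R : realType) n (M : 'M[R[i]]_n) : 'M[R[i]]_n :=
  \matrix_(i, j)
    (limn (series (fun k => complex.Re (mpow M k i j) / k`!%:R)) +i*
     limn (series (fun k => complex.Im (mpow M k i j) / k`!%:R))).

(** A first divided difference of the exponential, by [expmx_block], [ddexp_increment]
    and [ddexp_commute]. *)
HB.lock Definition ddexp (R : realType) m n (B : 'M[R[i]]_m) (A : 'M[R[i]]_n)
    (X : 'M[R[i]]_(m, n)) : 'M[R[i]]_(m, n) :=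
  ursubmx (expmx (block_mx B X 0 A)).

Section MatrixExp.
Variable R : realType.
Local Notation C := R[i].

Definition ccvg (z : nat -> C) (l : C) :=
  (fun k => complex.Re (z k)) @ \oo --> complex.Re l /\
  (fun k => complex.Im (z k)) @ \oo --> complex.Im l.

Lemma ccvg_unique z l l' : ccvg z l -> ccvg z l' -> l = l'.
Proof.
move=> [zR zI] [zR' zI']; apply/eqP; rewrite eq_complex.
by rewrite (cvg_unique _ zR zR')// (cvg_unique _ zI zI')// !eqxx.
Qed.

Lemma ccvg_cst l : ccvg (fun=> l) l.
Proof. by split; exact: cvg_cst. Qed.

Lemma ccvgD z w l m : ccvg z l -> ccvg w m -> ccvg (fun k => z k + w k) (l + m).
Proof.
move=> [zR zI] [wR wI]; split.
  by rewrite ReD; under eq_fun do rewrite ReD; exact: cvgD.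
by rewrite ImD; under eq_fun do rewrite ImD; exact: cvgD.
Qed.

Lemma ccvgM z w l m : ccvg z l -> ccvg w m -> ccvg (fun k => z k * w k) (l * m).
Proof.
move=> [zR zI] [wR wI]; split.
  by rewrite ReM; under eq_fun do rewrite ReM; apply: cvgB; exact: cvgM.
by rewrite ImM; under eq_fun do rewrite ImM; apply: cvgD; exact: cvgM.
Qed.

Lemma ccvg_sum (I : Type) (r : seq I) (z : I -> nat -> C) l :
  (forall i, ccvg (z i) (l i)) ->
  ccvg (fun k => \sum_(i <- r) z i k) (\sum_(i <- r) l i).
Proof.
move=> zl; elim: r => [|i r IH].
  by under eq_fun do rewrite big_nil; rewrite big_nil; exact: ccvg_cst.
by under eq_fun do rewrite big_cons; rewrite big_cons; exact: ccvgD.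
Qed.

Lemma mpowS n (M : 'M[C]_n) k : mpow M k.+1 = M *m mpow M k.
Proof. by []. Qed.

Definition entries_le m n (r : R) (M : 'M[C]_(m, n)) :=
  forall i j, `|complex.Re (M i j)| <= r /\ `|complex.Im (M i j)| <= r.

Lemma mpow_le n (M : 'M[C]_n) r k : entries_le r M ->
  entries_le ((2 * n%:R * r) ^+ k) (mpow M k).
Proof.
move=> Mr; elim: k => [|k IH] i j.
  rewrite expr0 mxE; case: (i == j) => /=; rewrite ?mulr1n ?mulr0n ?normr1 normr0;
  by rewrite ?lexx ?ler01.
have e : (2 * n%:R * r) ^+ k.+1 = \sum_(l < n) (r * (2 * n%:R * r) ^+ k *+ 2).
  by rewrite sumr_const card_ord exprS -mulrnA -[RHS]mulr_natl natrM; ring.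
rewrite mxE Re_sum Im_sum e; split; apply: (le_trans (ler_norm_sum _ _ _));
  apply: ler_sum => l _; have [IR II] := IH l j; have [MR MI] := Mr i l.
  rewrite ReM (le_trans (ler_normB _ _))// !normrM mulr2n lerD//; exact: ler_pM.
rewrite ImM (le_trans (ler_normD _ _))// !normrM mulr2n lerD//; exact: ler_pM.
Qed.

Lemma series_exp_le (u : nat -> R) (a : R) : (forall k, `|u k| <= a ^+ k) ->
  cvgn (series (fun k => u k / k`!%:R)) /\
  `|limn (series (fun k => u k / k`!%:R))| <= expR a.
Proof.
move=> ua; have uk k : `|u k / k`!%:R| <= exp_coeff a k.
  by rewrite normrM normfV (ger0_norm (ler0n _ _)) ler_wpM2r// invr_ge0.
have nc : cvgn [normed series (fun k => u k / k`!%:R)].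
  apply: (series_le_cvg _ _ uk); first by move=> k; exact: normr_ge0.
    by move=> k; apply: le_trans (uk k); exact: normr_ge0.
  exact: is_cvg_series_exp_coeff.
split; first exact: normed_cvg.
apply: (le_trans (lim_series_norm nc)).
apply: lim_series_le => //; exact: is_cvg_series_exp_coeff.
Qed.

Definition entries_bound m n (M : 'M[C]_(m, n)) : R :=
  \sum_i \sum_j (`|complex.Re (M i j)| + `|complex.Im (M i j)|).

Lemma entries_le_bound m n (M : 'M[C]_(m, n)) : entries_le (entries_bound M) M.
Proof.
move=> i j; rewrite /entries_bound (bigD1 i)//= (bigD1 j)//=.
set a := \sum_(_ | _) _; set b := \sum_(_ | _) _.
have a0 : 0 <= a by apply: sumr_ge0 => *; rewrite addr_ge0.
have b0 : 0 <= b by apply: sumr_ge0 => *; apply: sumr_ge0 => *; rewrite addr_ge0.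
have := normr_ge0 (complex.Re (M i j)); have := normr_ge0 (complex.Im (M i j)).
by split; lra.
Qed.

Lemma expmx_le n (M : 'M[C]_n) r : entries_le r M ->
  entries_le (expR (2 * n%:R * r)) (expmx M).
Proof.
move=> /mpow_le Mr i j; rewrite expmx.unlock mxE /=; split.
  by apply: (series_exp_le _).2 => k; exact: (Mr k i j).1.
by apply: (series_exp_le _).2 => k; exact: (Mr k i j).2.
Qed.

Definition pexp n (M : 'M[C]_n) N : 'M[C]_n :=
  \sum_(0 <= k < N) (k`!%:R^-1)%:C *: mpow M k.

Lemma pexp_cvg n (M : 'M[C]_n) i j : ccvg (fun N => pexp M N i j) (expmx M i j).
Proof.
have Mr k := @mpow_le n M _ k (entries_le_bound M).
split; rewrite expmx.unlock mxE/=.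
  have -> : (fun N => complex.Re (pexp M N i j)) =
      series (fun k => complex.Re (mpow M k i j) / k`!%:R).
    apply/funext => N; rewrite /series/= /pexp summxE Re_sum.
    by apply: eq_bigr => k _; rewrite mxE ReM /= mul0r subr0 mulrC.
  by apply: (series_exp_le _).1 => k; exact: (Mr k i j).1.
have -> : (fun N => complex.Im (pexp M N i j)) =
    series (fun k => complex.Im (mpow M k i j) / k`!%:R).
  apply/funext => N; rewrite /series/= /pexp summxE Im_sum.
  by apply: eq_bigr => k _; rewrite mxE ImM /= mul0r addr0 mulrC.
by apply: (series_exp_le _).1 => k; exact: (Mr k i j).2.
Qed.

(** All that follows about [expmx] is deduced from this, applied to block matrices. *)
Lemma expmx_intertwine m n (A : 'M[C]_m) (B : 'M[C]_n) (S : 'M[C]_(m, n)) :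
  A *m S = S *m B -> expmx A *m S = S *m expmx B.
Proof.
move=> AS; have pS k : mpow A k *m S = S *m mpow B k.
  elim: k => [|k IH]; first by rewrite mul1mx mulmx1.
  by rewrite /= -mulmxA IH !mulmxA AS.
have PS N : pexp A N *m S = S *m pexp B N.
  rewrite /pexp mulmx_suml mulmx_sumr; apply: eq_bigr => k _.
  by rewrite -scalemxAl pS scalemxAr.
apply/matrixP => i j.
apply: (@ccvg_unique (fun N => (pexp A N *m S) i j)).
  rewrite mxE; under eq_fun do rewrite mxE.
  by apply: ccvg_sum => l; apply: ccvgM; [exact: pexp_cvg|exact: ccvg_cst].
rewrite mxE; under eq_fun do rewrite PS mxE.
by apply: ccvg_sum => l; apply: ccvgM; [exact: ccvg_cst|exact: pexp_cvg].
Qed.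

Lemma expmx_scalar1 (x : R) : expmx (x%:C%:M : 'M[C]_1) = (expR x)%:C%:M.
Proof.
have p k : mpow (x%:C%:M : 'M[C]_1) k = (x ^+ k)%:C%:M.
  elim: k => [|k IH]; first by rewrite expr0.
  rewrite mpowS IH -scalar_mxM exprS.
  by congr (_%:M); rewrite rmorphM.
apply/matrixP => i j; rewrite expmx.unlock !ord1 !mxE eqxx mulr1n.
apply/eqP; rewrite eq_complex; apply/andP; split; apply/eqP => /=.
  rewrite /expR; congr (limn (series _)); apply/funext => k.
  by rewrite p !mxE eqxx mulr1n.
rewrite (_ : (fun k => _) = fun=> 0).
  rewrite (_ : series _ = fun=> 0) ?lim_cst//; apply/funext => N.
  by rewrite /series/= big1.
by apply/funext => k; rewrite p !mxE eqxx mulr1n /= mul0r.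
Qed.

(** * Divided differences of the exponential *)

(** The diagonal blocks come from intertwining with the inclusion of an invariant
    subspace and with the projection to the quotient. *)
Lemma expmx_block m n (B : 'M[C]_m) (A : 'M[C]_n) (X : 'M[C]_(m, n)) :
  expmx (block_mx B X 0 A) = block_mx (expmx B) (ddexp B A X) 0 (expmx A).
Proof.
set M := block_mx B X 0 A; rewrite -[LHS]submxK.
have h1 : M *m col_mx 1%:M 0 = col_mx 1%:M 0 *m B.
  by rewrite mul_block_col !mulmx1 !mulmx0 !addr0 mul_col_mx mul1mx mul0mx.
have h2 : row_mx 0 1%:M *m M = A *m row_mx 0 1%:M.
  by rewrite mul_row_block !mul0mx !mul1mx !add0r mul_mx_row mulmx0 mulmx1.
have := expmx_intertwine (esym h2); have := expmx_intertwine h1.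
rewrite ddexp.unlock -/M -{1 2}[expmx M]submxK.
move: (ulsubmx _) (ursubmx _) (dlsubmx _) (drsubmx _) => a b c d.
rewrite mul_block_col mul_row_block mul_col_mx mul_mx_row.
rewrite !mulmx1 !mulmx0 !mul0mx !mul1mx !addr0 !add0r.
by move=> /eq_col_mx[-> ->] /eq_row_mx[_ ->].
Qed.

Lemma ddexp_intertwine m n p q (B : 'M[C]_m) (A : 'M[C]_n) (B' : 'M[C]_p)
    (A' : 'M[C]_q) P Q X X' : B' *m P = P *m B -> A' *m Q = Q *m A ->
  X' *m Q = P *m X -> ddexp B' A' X' *m Q = P *m ddexp B A X.
Proof.
move=> BP AQ XQ.
have : block_mx B' X' 0 A' *m block_mx P 0 0 Q = block_mx P 0 0 Q *m block_mx B X 0 A.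
  by rewrite !mulmx_block !mulmx0 !mul0mx !addr0 !add0r BP AQ XQ.
move=> /expmx_intertwine; rewrite !expmx_block !mulmx_block => /eq_block_mx[_ + _ _].
by rewrite !mulmx0 !mul0mx !addr0 !add0r.
Qed.

Section DividedDifferences.
Variables (m n : nat) (B : 'M[C]_m) (A : 'M[C]_n).
Implicit Types X Y : 'M[C]_(m, n).

Lemma ddexpD X Y : ddexp B A (X + Y) = ddexp B A X + ddexp B A Y.
Proof.
pose D := ddexp B (block_mx A 0 0 A) (row_mx X Y).
have DE Q Z : block_mx A 0 0 A *m Q = Q *m A -> row_mx X Y *m Q = Z ->
    D *m Q = ddexp B A Z.
  move=> AQ XQ; rewrite (@ddexp_intertwine _ _ _ _ B A _ _ 1%:M Q Z) ?mul1mx//.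
  by rewrite mulmx1.
rewrite -(DE (col_mx 1%:M 1%:M)) -1?(DE (col_mx 1%:M 0) X) -1?(DE (col_mx 0 1%:M) Y);
  rewrite ?mul_block_col ?mul_row_col ?mul_col_mx ?mulmx1 ?mulmx0 ?mul0mx ?mul1mx
    ?addr0 ?add0r //.
by rewrite -mulmxDr add_col_mx addr0 add0r.
Qed.

Lemma ddexpZ c X : ddexp B A (c *: X) = c *: ddexp B A X.
Proof.
have := @ddexp_intertwine _ _ _ _ B A B A c%:M 1%:M X (c *: X).
by rewrite !mulmx1 mul1mx scalar_mxC !mul_scalar_mx => ->.
Qed.

Lemma ddexp0 : ddexp B A 0 = 0.
Proof. by have := ddexpZ 0 0; rewrite !scale0r. Qed.

Lemma ddexp_sum (I : Type) (r : seq I) (F : I -> 'M[C]_(m, n)) :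
  ddexp B A (\sum_(i <- r) F i) = \sum_(i <- r) ddexp B A (F i).
Proof. exact: (big_morph _ ddexpD ddexp0). Qed.

Lemma ddexp_delta X :
  ddexp B A X = \sum_(p : 'I_m * 'I_n) X p.1 p.2 *: ddexp B A (delta_mx p.1 p.2).
Proof.
rewrite {1}[X]matrix_sum_delta pair_bigA ddexp_sum.
by apply: eq_bigr => p _; rewrite ddexpZ.
Qed.

Lemma ddexp_commute X :
  B *m ddexp B A X - ddexp B A X *m A = expmx B *m X - X *m expmx A.
Proof.
have /expmx_intertwine : block_mx B X 0 A *m block_mx B X 0 A =
  block_mx B X 0 A *m block_mx B X 0 A by [].
rewrite expmx_block !mulmx_block => /eq_block_mx[_ + _ _] => e.
by apply: (addIr (ddexp B A X *m A)); rewrite subrK addrAC e addrK.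
Qed.

End DividedDifferences.

(** The vectors [(- v, v)] form a subspace on which the block triangular matrix acts
    as [M]. *)
Lemma ddexp_increment n (M N : 'M[C]_n) : expmx N - expmx M = ddexp N M (N - M).
Proof.
have : block_mx N (N - M) 0 M *m col_mx (- 1%:M) 1%:M = col_mx (- 1%:M) 1%:M *m M.
  rewrite mul_block_col mul_col_mx !mulmxN !mulNmx !mulmx1 !mul1mx.
  by rewrite oppr0 add0r addKr.
move=> /expmx_intertwine; rewrite expmx_block mul_block_col mul_col_mx.
rewrite !mulmxN !mulNmx !mulmx1 !mul1mx => /eq_col_mx[e _].
by rewrite -e addrA subrr add0r.
Qed.

Lemma ddexp_le m n (B : 'M[C]_m) (A : 'M[C]_n) X r :
  entries_le r B -> entries_le r A -> entries_le r X -> 0 <= r ->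
  entries_le (expR (2 * (m + n)%:R * r)) (ddexp B A X).
Proof.
move=> Br Ar Xr r0; have /expmx_le : entries_le r (block_mx B X 0 A).
  move=> i j; rewrite mxE; case: (fintype.split i) => a; rewrite mxE;
    case: (fintype.split j) => b //.
  by rewrite mxE /= normr0.
by move=> h i j; rewrite ddexp.unlock !mxE; exact: h.
Qed.

End MatrixExp.

(** * Smoothness of the exponential *)

Section ExpSmooth.
Variables (R : realType) (V : normedModType R) (D : set V).
Hypothesis oD : open D.
Local Notation C := R[i].

Lemma mC_near_le m n (F : V -> 'M[C]_(m, n)) x : D x -> mC D 0 F ->
  \forall y \near x, entries_le (entries_bound (F x) + 1) (F y).
Proof.
move=> Dx FC.
suff : \forall y \near x, forall p : 'I_m * 'I_n,
    `|complex.Re (F y p.1 p.2)| <= entries_bound (F x) + 1 /\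
    `|complex.Im (F y p.1 p.2)| <= entries_bound (F x) + 1.
  by apply: filterS => y h i j; exact: (h (i, j)).
apply: filter_forall => -[i j] /=; have [FR FI] := FC i j.
have [bR bI] := entries_le_bound (F x) i j.
have := FR _ Dx => /cvgrPdist_lt/(_ _ ltr01).
have := FI _ Dx => /cvgrPdist_lt/(_ _ ltr01).
apply: filterS2 => y yI yR; split.
  rewrite -[X in `|X|](subrK (complex.Re (F x i j))) addrC (le_trans (ler_normD _ _))//.
  by rewrite lerD// distrC ltW.
rewrite -[X in `|X|](subrK (complex.Im (F x i j))) addrC (le_trans (ler_normD _ _))//.
by rewrite lerD// distrC ltW.
Qed.

Lemma cvg_bounded0 (u g : V -> R) (x : V) r : u y @[y --> x] --> (0 : R) ->
  (\forall y \near (x : V), `|g y| <= r) -> u y * g y @[y --> x] --> (0 : R).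
Proof.
move=> u0 gr; apply/cvgrPdist_lt => e e0.
have r0 : 0 < `|r| + 1 by rewrite ltr_wpDl.
have e1 : 0 < e / (`|r| + 1) by rewrite divr_gt0.
move/cvgrPdist_lt : u0 => /(_ _ e1); move: gr; apply: filterS2 => y gy.
rewrite !sub0r !normrN normrM => uy.
rewrite (@le_lt_trans _ _ (`|u y| * (`|r| + 1)))//.
  rewrite ler_wpM2l// (le_trans gy)// (le_trans (ler_norm r))// lerDl//.
by rewrite -ltr_pdivlMr.
Qed.

Lemma cvgD0 (f g : V -> R) (x : V) : f @ x --> (0 : R) -> g @ x --> (0 : R) ->
  f y + g y @[y --> x] --> (0 : R).
Proof. by move=> f0 g0; have h := cvgD f0 g0; rewrite addr0 in h; exact: h. Qed.

Lemma cvgB0 (f g : V -> R) (x : V) : f @ x --> (0 : R) -> g @ x --> (0 : R) ->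
  f y - g y @[y --> x] --> (0 : R).
Proof. by move=> f0 g0; have h := cvgB f0 g0; rewrite subr0 in h; exact: h. Qed.

Lemma cvg_cstD0 (f : V -> R) (x : V) (c : R) : f @ x --> (0 : R) ->
  c + f y @[y --> x] --> c.
Proof. by move=> f0; have h := cvgD (@cvg_cst _ c _ (nbhs x) _) f0; rewrite addr0 in h; exact: h. Qed.

Lemma mC_expmx0 n (M : V -> 'M[C]_n) : mC D 0 M -> mC D 0 (fun x => expmx (M x)).
Proof.
move=> MC i j.
pose g (p : 'I_n * 'I_n) x y := ddexp (M y) (M x) (delta_mx p.1 p.2) i j.
pose u (p : 'I_n * 'I_n) x y := M y p.1 p.2 - M x p.1 p.2.
have fE x y : expmx (M y) i j = expmx (M x) i j + \sum_p u p x y * g p x y.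
  apply/eqP; rewrite addrC -subr_eq; apply/eqP.
  transitivity ((expmx (M y) - expmx (M x)) i j); first by rewrite !mxE.
  rewrite ddexp_increment ddexp_delta summxE; apply: eq_bigr => p _.
  by rewrite !mxE.
have bd x p : D x -> exists r, \forall y \near x,
    `|complex.Re (g p x y)| <= r /\ `|complex.Im (g p x y)| <= r.
  move=> Dx; pose r := entries_bound (M x) + 1.
  have b0 : 0 <= entries_bound (M x).
    by apply: sumr_ge0 => ? _; apply: sumr_ge0 => ? _; rewrite addr_ge0.
  exists (expR (2 * (n + n)%:R * r)).
  have := mC_near_le Dx MC; apply: filterS => y My.
  apply: ddexp_le => //.
  - by move=> a b; have [h1 h2] := entries_le_bound (M x) a b; rewrite /r; split; lra.
  - move=> a b; rewrite mxE; case: (_ && _) => /=;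
      by rewrite ?mulr1n ?mulr0n ?normr1 normr0; split; rewrite /r; lra.
  - by rewrite /r; lra.
have u0 x p : D x -> (fun y => complex.Re (u p x y)) @ x --> (0 : R) /\
    (fun y => complex.Im (u p x y)) @ x --> (0 : R).
  move=> Dx; have [MR MI] := MC p.1 p.2; split.
    by under eq_fun do rewrite ReD ReN; apply/subr_cvg0; exact: MR.
  by under eq_fun do rewrite ImD ImN; apply/subr_cvg0; exact: MI.
have sum0 (h : 'I_n * 'I_n -> V -> R) (x : V) :
    (forall p, h p y @[y --> x] --> (0 : R)) ->
    \sum_p h p y @[y --> x] --> (0 : R).
  move=> h0; elim: (index_enum _) => [|p r IH].
    by under eq_fun do rewrite big_nil; exact: cvg_cst.
  under eq_fun do rewrite big_cons.
  exact: cvgD0.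
split=> x Dx.
  suff : complex.Re (expmx (M y) i j) @[y --> x] --> complex.Re (expmx (M x) i j) by [].
  under eq_fun do rewrite (fE x) ReD Re_sum.
  apply: cvg_cstD0; apply: sum0 => p; have [r gr] := bd x p Dx; have [uR uI] := u0 x p Dx.
  under eq_fun do rewrite ReM.
  apply: cvgB0.
    by apply: (cvg_bounded0 (r := r)) => //; apply: filterS gr => y [].
  by apply: (cvg_bounded0 (r := r)) => //; apply: filterS gr => y [].
suff : complex.Im (expmx (M y) i j) @[y --> x] --> complex.Im (expmx (M x) i j) by [].
under eq_fun do rewrite (fE x) ImD Im_sum.
apply: cvg_cstD0; apply: sum0 => p; have [r gr] := bd x p Dx; have [uR uI] := u0 x p Dx.
under eq_fun do rewrite ImM.
apply: cvgD0.
  by apply: (cvg_bounded0 (r := r)) => //; apply: filterS gr => y [].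
by apply: (cvg_bounded0 (r := r)) => //; apply: filterS gr => y [].
Qed.

Lemma mC_ddexp_of k m n (B : V -> 'M[C]_m) (A : V -> 'M[C]_n) (X : V -> 'M[C]_(m, n)) :
  (forall M : V -> 'M[C]_(m + n), mC D k M -> mC D k (fun x => expmx (M x))) ->
  mC D k B -> mC D k A -> mC D k X -> mC D k (fun x => ddexp (B x) (A x) (X x)).
Proof.
move=> h BC AC XC i j; under eq_fun do rewrite ddexp.unlock !mxE.
by apply: h; apply: mC_block => //; exact: mC_cst.
Qed.

(** The derivative of [expmx] at [M] in the direction [N] is a block of the
    exponential of the block matrix with rows [M N] and [0 M]; smoothness of
    every order follows by induction on the order, for all sizes at once. *)
Lemma mC_expmx k n (M : V -> 'M[C]_n) : mC D k M -> mC D k (fun x => expmx (M x)).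
Proof.
elim: k n M => [|k IH] n M MC; first exact: mC_expmx0.
move=> i j.
apply: (@cC_increment _ _ _ _ _ ('I_n * 'I_n)%type (fun p x => M x p.1 p.2)
  (fun p x y => ddexp (M y) (M x) (delta_mx p.1 p.2) i j)) => //.
- move=> x p Dx; apply: (@mC_ddexp_of _ _ _ M (fun=> M x) (fun=> delta_mx p.1 p.2)).
  + by move=> *; exact: mC_expmx0.
  + exact: mC_le0 MC.
  + exact: mC_cst.
  + exact: mC_cst.
- move=> x y _ _; transitivity ((expmx (M y) - expmx (M x)) i j); first by rewrite !mxE.
  rewrite ddexp_increment ddexp_delta summxE; apply: eq_bigr => p _.
  by rewrite !mxE.
move=> v; pose dM x : 'M[C]_n := \matrix_(a, b) dC v (fun x => M x a b) x.
apply: (@cC_ext _ _ _ _ oD (fun x => ddexp (M x) (M x) (dM x) i j)).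
  move=> x Dx; rewrite ddexp_delta summxE; apply: eq_bigr => p _.
  by rewrite !mxE.
have MC' : mC D k M by move=> a b; have [MR MI] := MC a b; split; exact: class_CS.
apply: mC_ddexp_of => //; first exact: IH.
exact: mC_derive.
Qed.

Lemma mC_ddexp k m n (B : V -> 'M[C]_m) (A : V -> 'M[C]_n) (X : V -> 'M[C]_(m, n)) :
  mC D k B -> mC D k A -> mC D k X -> mC D k (fun x => ddexp (B x) (A x) (X x)).
Proof. by apply: mC_ddexp_of; exact: mC_expmx. Qed.

End ExpSmooth.

(** * Comparison of eigenvalues *)

Section Courant.
Variable R : realType.
Local Notation C := R[i].

Definition qform n (A : 'M[C]_n) (v : 'cV[C]_n) : R := complex.Re ((v^t* *m A *m v) 0 0).

Definition abs2 (z : C) : R := complex.Re z ^+ 2 + complex.Im z ^+ 2.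

Lemma abs2E z : Num.conj z * z = (abs2 z)%:C.
Proof.
by rewrite mulrC -normCK add_Re2_Im2.
Qed.

Lemma abs2_ge0 z : 0 <= abs2 z.
Proof. by rewrite addr_ge0// sqr_ge0. Qed.

Lemma abs2_eq0 z : (abs2 z == 0) = (z == 0).
Proof.
rewrite /abs2 paddr_eq0 ?sqr_ge0// !sqrf_eq0.
by case: z => a b /=; rewrite eq_complex.
Qed.

Definition norm2 n (v : 'cV[C]_n) : R := \sum_i abs2 (v i 0).

Lemma norm2E n (v : 'cV[C]_n) : (v^t* *m v) 0 0 = (norm2 v)%:C.
Proof.
rewrite mxE raddf_sum/=; apply: eq_bigr => i _.
by rewrite !mxE abs2E.
Qed.

Lemma norm2_gt0 n (v : 'cV[C]_n) : v != 0 -> 0 < norm2 v.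
Proof.
move=> v0; rewrite lt0r sumr_ge0 => [|i _]; last exact: abs2_ge0.
rewrite andbT; apply: contra_neq v0 => /eqP.
rewrite psumr_eq0 => [|i _]; last exact: abs2_ge0.
move=> /allP h; apply/colP => i; rewrite mxE; apply/eqP.
by have := h i (mem_index_enum _); rewrite /= abs2_eq0.
Qed.

Lemma norm2_isometry m n (S : 'M[C]_(n, m)) v : S^t* *m S = 1%:M ->
  norm2 (S *m v) = norm2 v.
Proof.
move=> SS; apply: complexI.
by rewrite -!norm2E adjmxM mulmxA -(mulmxA _ _ S) SS mulmx1.
Qed.

Lemma qform_lam n (A : 'M[C]_n) v : A^t* = A ->
  qform A v = \sum_i lam A i * abs2 ((eigbasis A *m v) i 0).
Proof.
move=> AE; apply: complexI; rewrite raddf_sum/= /qform.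
have -> : v^t* *m A *m v = (eigbasis A *m v)^t* *m
    diag_mx (\row_i (lam A i)%:C) *m (eigbasis A *m v).
  by rewrite {1}(eigbasisE AE) adjmxM !mulmxA.
set w := _ *m v; clearbody w.
rewrite -mulmxA mul_diag_mx mxE Re_sum raddf_sum/=; apply: eq_bigr => i _.
rewrite !mxE mulrCA abs2E -rmorphM /=; by [].
Qed.

Lemma norm2_eigbasis n (A : 'M[C]_n) v : A^t* = A ->
  norm2 v = \sum_i abs2 ((eigbasis A *m v) i 0).
Proof. by move=> AE; rewrite -(norm2_isometry v (eigbasisVK AE)). Qed.

Lemma qform_le n (A : 'M[C]_n) v t : A^t* = A ->
  (forall i, (eigbasis A *m v) i 0 != 0 -> lam A i <= t) ->
  qform A v <= t * norm2 v.
Proof.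
move=> AE h; rewrite qform_lam// (norm2_eigbasis v AE) mulr_sumr ler_sum// => i _.
have [->|w0] := eqVneq ((eigbasis A *m v) i 0) 0.
  by rewrite (_ : abs2 0 = 0) ?mulr0// /abs2 /= expr0n addr0.
by rewrite ler_wpM2r ?abs2_ge0// h.
Qed.

Lemma qform_ge n (A : 'M[C]_n) v t : A^t* = A ->
  (forall i, (eigbasis A *m v) i 0 != 0 -> t <= lam A i) ->
  t * norm2 v <= qform A v.
Proof.
move=> AE h; rewrite qform_lam// (norm2_eigbasis v AE) mulr_sumr ler_sum// => i _.
have [->|w0] := eqVneq ((eigbasis A *m v) i 0) 0.
  by rewrite (_ : abs2 0 = 0) ?mulr0// /abs2 /= expr0n addr0.
by rewrite ler_wpM2r ?abs2_ge0// h.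
Qed.

Lemma common_kernel (F : fieldType) a b m (M : 'M[F]_(a, m)) (N : 'M[F]_(b, m)) :
  (\rank M + \rank N < m)%N -> exists2 u : 'cV[F]_m, u != 0 & M *m u = 0 /\ N *m u = 0.
Proof.
move=> h; set K := kermx (col_mx M N)^T.
have : K != 0.
  rewrite -mxrank_eq0 mxrank_ker mxrank_tr -lt0n subn_gt0.
  by apply: leq_ltn_trans h; rewrite -addsmxE mxrank_adds_leqif.
move=> /rowV0Pn[u uK u0]; exists u^T.
  by rewrite -(inj_eq trmx_inj) trmxK trmx0.
move: uK => /sub_kermxP/(congr1 trmx); rewrite trmx_mul trmxK trmx0 mul_col_mx.
by rewrite -[0]vsubmxK => /eq_col_mx[-> ->]; rewrite !linear0.
Qed.

Lemma pid_coord n r (v : 'cV[C]_n) (i : 'I_n) :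
  (pid_mx r : 'M[C]_n) *m v = 0 -> (i < r)%N -> v i 0 = 0.
Proof.
move=> /colP/(_ i); rewrite !mxE (bigD1 i)//= big1 => [|k /negPf ki].
  by rewrite !mxE eqxx => + ir; rewrite ir mul1r addr0.
by rewrite mxE val_eqE eq_sym ki mul0r.
Qed.

Lemma copid_coord n r (v : 'cV[C]_n) (i : 'I_n) :
  copid_mx r *m v = 0 -> (r <= i)%N -> v i 0 = 0.
Proof.
move=> /colP/(_ i); rewrite !mxE (bigD1 i)//= big1 => [|k /negPf ki].
  move=> + ri; rewrite /copid_mx !mxE eqxx ltnNge ri andbF.
  by rewrite mulr0n subr0 mulr1n mul1r addr0.
by rewrite /copid_mx !mxE val_eqE eq_sym ki subr0 mul0r.
Qed.

(** The dimension counts of the Courant-Fischer principle: a vector spanned by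
    the first [i.+1] eigenvectors of [B] whose image is orthogonal to the first
    [j] eigenvectors of [A] exists as soon as [j <= i], and similarly with the
    last eigenvectors. *)
Section Compare.
Variables (m n : nat) (B : 'M[C]_m) (A : 'M[C]_n) (S : 'M[C]_(n, m)) (e : R).
Hypotheses (BE : B^t* = B) (AE : A^t* = A) (SS : S^t* *m S = 1%:M).

Lemma lam_le_image (i : 'I_m) (j : 'I_n) : (j <= i)%N ->
  (forall u, qform A (S *m u) <= qform B u + e * norm2 u) ->
  lam A j <= lam B i + e.
Proof.
move=> ji qAB.
have [|u u0 [uB uA]] := @common_kernel _ _ _ _ (copid_mx i.+1 *m eigbasis B)
    ((pid_mx j : 'M[C]_n) *m eigbasis A *m S).
  apply: (@leq_ltn_trans ((m - i.+1) + j)).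
    apply: leq_add.
      by rewrite (leq_trans (mxrankM_maxl _ _))// rank_copid_mx.
    rewrite (leq_trans (mxrankM_maxl _ _))// (leq_trans (mxrankM_maxl _ _))//.
    by rewrite rank_pid_mx// ltnW.
  by have := ltn_ord i; lia.
have ub : qform B u <= lam B i * norm2 u.
  apply: qform_le => // k; apply: contraNT; rewrite -ltNge => ik.
  apply/eqP/(@copid_coord _ i.+1); first by rewrite mulmxA.
  by rewrite ltnNge; apply: contraTN ik => /(lam_le B); rewrite -leNgt.
have ua : lam A j * norm2 u <= qform A (S *m u).
  rewrite -(norm2_isometry u SS); apply: qform_ge => // k.
  apply: contraNT; rewrite -ltNge => kj.
  apply/eqP/(@pid_coord _ j); first by rewrite !mulmxA.
  by rewrite ltnNge; apply: contraTN kj => /(lam_le A); rewrite -leNgt.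
rewrite -(ler_pM2r (norm2_gt0 u0)) mulrDl.
by rewrite (le_trans ua)// (le_trans (qAB u))// lerD2r.
Qed.

Lemma image_le_lam (i : 'I_m) (j : 'I_n) : (i + n <= m + j)%N ->
  (forall u, qform B u <= qform A (S *m u) + e * norm2 u) ->
  lam B i <= lam A j + e.
Proof.
move=> ij qAB.
have [|u u0 [uB uA]] := @common_kernel _ _ _ _ ((pid_mx i : 'M[C]_m) *m eigbasis B)
    (copid_mx j.+1 *m eigbasis A *m S).
  apply: (@leq_ltn_trans (i + (n - j.+1))).
    apply: leq_add.
      rewrite (leq_trans (mxrankM_maxl _ _))//.
      by rewrite rank_pid_mx// ltnW.
    rewrite (leq_trans (mxrankM_maxl _ _))// (leq_trans (mxrankM_maxl _ _))//.
    by rewrite rank_copid_mx.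
  by have := ltn_ord i; have := ltn_ord j; lia.
have ub : lam B i * norm2 u <= qform B u.
  apply: qform_ge => // k; apply: contraNT; rewrite -ltNge => ik.
  apply/eqP/(@pid_coord _ i); first by rewrite mulmxA.
  by rewrite ltnNge; apply: contraTN ik => /(lam_le B); rewrite -leNgt.
have ua : qform A (S *m u) <= lam A j * norm2 u.
  rewrite -(norm2_isometry u SS); apply: qform_le => // k.
  apply: contraNT; rewrite -ltNge => kj.
  apply/eqP/(@copid_coord _ j.+1); first by rewrite !mulmxA.
  by rewrite ltnNge; apply: contraTN kj => /(lam_le A); rewrite -leNgt.
rewrite -(ler_pM2r (norm2_gt0 u0)) mulrDl.
by rewrite (le_trans ub)// (le_trans (qAB u))// lerD2r.
Qed.

End Compare.

(** Among the equivalent norms, the one whose bounds are read off from the entries. *)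
Definition abs1 m n (X : 'M[C]_(m, n)) : R := \sum_i \sum_j Num.sqrt (abs2 (X i j)).

Lemma sqrt_abs2M z w :
  Num.sqrt (abs2 (z * w)) = Num.sqrt (abs2 z) * Num.sqrt (abs2 w).
Proof.
rewrite -sqrtrM ?abs2_ge0//; congr Num.sqrt.
by case: z w => a b [c d]; rewrite /abs2 /=; ring.
Qed.

Lemma abs2M z w : abs2 (z * w) = abs2 z * abs2 w.
Proof. by rewrite /abs2 ReM ImM; ring. Qed.

Lemma Re_le_sqrt z : `|complex.Re z| <= Num.sqrt (abs2 z).
Proof. by rewrite -sqrtr_sqr ler_wsqrtr// lerDl sqr_ge0. Qed.

Lemma Im_le_sqrt z : `|complex.Im z| <= Num.sqrt (abs2 z).
Proof. by rewrite -sqrtr_sqr ler_wsqrtr// lerDr sqr_ge0. Qed.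

Lemma sqrt_abs2_le z : Num.sqrt (abs2 z) <= `|complex.Re z| + `|complex.Im z|.
Proof.
rewrite -[leRHS]ger0_norm ?addr_ge0// -sqrtr_sqr ler_wsqrtr//.
rewrite sqrrD !real_normK ?num_real// /abs2 -addrA [X in _ <= _ + X]addrC addrA lerDl.
by rewrite mulrn_wge0// mulr_ge0.
Qed.

Lemma sqrt_abs2D z w :
  Num.sqrt (abs2 (z + w)) <= Num.sqrt (abs2 z) + Num.sqrt (abs2 w).
Proof. by have := le_normcD z w; case: z w => a b [c d]. Qed.

Lemma sqrt_abs2_sum (I : Type) (r : seq I) (z : I -> C) :
  Num.sqrt (abs2 (\sum_(i <- r) z i)) <= \sum_(i <- r) Num.sqrt (abs2 (z i)).
Proof.
elim: r => [|i r IH]; last first.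
  by rewrite !big_cons (le_trans (sqrt_abs2D _ _))// lerD2l.
by rewrite !big_nil /abs2 /= expr0n addr0 sqrtr0.
Qed.

Lemma sqrt_norm2_le n (v : 'cV[C]_n) i : Num.sqrt (abs2 (v i 0)) <= Num.sqrt (norm2 v).
Proof.
rewrite ler_wsqrtr// /norm2 (bigD1 i)//= lerDl sumr_ge0// => k _; exact: abs2_ge0.
Qed.

Lemma abs1_ge0 m n (X : 'M[C]_(m, n)) : 0 <= abs1 X.
Proof. by apply: sumr_ge0 => i _; apply: sumr_ge0 => j _; exact: sqrtr_ge0. Qed.

Lemma qform_abs1 n (X : 'M[C]_n) v : `|qform X v| <= abs1 X * norm2 v.
Proof.
rewrite /qform -mulmxA mxE (le_trans (Re_le_sqrt _))// (le_trans (sqrt_abs2_sum _ _))//.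
rewrite /abs1 mulr_suml ler_sum// => i _; rewrite !mxE sqrt_abs2M.
have v0 : 0 <= norm2 v by apply: sumr_ge0 => *; exact: abs2_ge0.
rewrite (@le_trans _ _ (Num.sqrt (norm2 v) * \sum_j Num.sqrt (abs2 (X i j)) * Num.sqrt (norm2 v)))//.
  apply: ler_pM; rewrite ?sqrtr_ge0//.
    rewrite (le_trans _ (sqrt_norm2_le v i))//.
    by case: (v i 0) => a b; rewrite /abs2 /= sqrrN.
  rewrite (le_trans (sqrt_abs2_sum _ _))// ler_sum// => j _.
  by rewrite sqrt_abs2M ler_wpM2l ?sqrtr_ge0// sqrt_norm2_le.
by rewrite -mulr_suml mulrCA -expr2 sqr_sqrtr.
Qed.

(** Weyl's inequality. *)
Lemma lam_lipschitz n (A B : 'M[C]_n) i : A^t* = A -> B^t* = B ->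
  `|lam A i - lam B i| <= abs1 (A - B).
Proof.
move=> AE BE.
have qB u : qform A u - qform B u = qform (A - B) u.
  by rewrite /qform mulmxBr mulmxBl !mxE ReD ReN.
have S1 : (1%:M : 'M[C]_n)^t* *m 1%:M = 1%:M by rewrite adjmx1 mulmx1.
have h u := qform_abs1 (A - B) u.
rewrite ler_norml; apply/andP; split.
  rewrite lerNl opprB lerBlDl.
  apply: (lam_le_image AE BE S1) => // u; rewrite mul1mx.
  by have := h u; rewrite ler_norml -qB => /andP[+ _]; rewrite lerNl opprB lerBlDl.
rewrite lerBlDl; apply: (lam_le_image BE AE S1) => // u; rewrite mul1mx.
by have := h u; rewrite ler_norml -qB => /andP[_]; rewrite lerBlDl.
Qed.

(** Cauchy interlacing. *)
Lemma lam_interlace n (B : 'M[C]_n) (A : 'M[C]_n.+1) (S : 'M[C]_(n.+1, n)) i :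
  A^t* = A -> S^t* *m S = 1%:M -> B = S^t* *m A *m S ->
  lam A (widen_ord (leqnSn n) i) <= lam B i /\ lam B i <= lam A (lift ord0 i).
Proof.
move=> AE SS BS; have BE : B^t* = B by rewrite BS -{2}(trmxCK S) herm_conj// trmxCK.
have q u : qform B u = qform A (S *m u).
  by rewrite /qform BS adjmxM !mulmxA.
split.
  rewrite -[leRHS]addr0; apply: (lam_le_image BE AE SS) => // u.
  by rewrite mul0r addr0 q.
rewrite -[leRHS]addr0; apply: (image_le_lam BE AE SS) => [|u].
  by rewrite lift0; lia.
by rewrite mul0r addr0 q.
Qed.

End Courant.

(** * Smooth functions of Hermitian matrices *)

Section ExpHermitian.
Variable R : realType.
Local Notation C := R[i].

Lemma expmx_herm n (A : 'M[C]_n) : A^t* = A -> expmx A = fc expR A.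
Proof.
move=> AE; apply: fc_unique => // v x vx.
rewrite (@expmx_intertwine _ _ _ A (x%:C%:M : 'M[C]_1) v); last by rewrite mul_mx_scalar.
by rewrite expmx_scalar1 mul_mx_scalar.
Qed.

(** Contrary to [y - x] and [expR y - expR x], it never vanishes; this positivity is what
    makes the construction below smooth where eigenvalues collide. *)
Definition expdd (y x : R) : R :=
  if y == x then expR y else (expR y - expR x) / (y - x).

Lemma expdd_eq y x : expdd y x * (y - x) = expR y - expR x.
Proof.
rewrite /expdd; have [->|yx] := eqVneq y x; first by rewrite !subrr mulr0.
by rewrite divfK// subr_eq0.
Qed.

Lemma expdd_sym y x : expdd y x = expdd x y.
Proof.
rewrite /expdd eq_sym; have [->//|yx] := eqVneq x y.
by rewrite -(opprB x y) -(opprB (expR x)) invrN mulrNN.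
Qed.

(** [expdd y x] is the mean of [expR] between [x] and [y]. *)
Lemma expdd_ge y x m : m <= y -> m <= x -> expR m <= expdd y x.
Proof.
wlog xy : y x / x <= y.
  move=> h my mx; have [/h->//|/ltW yx] := leP x y.
  by rewrite expdd_sym h.
move=> my mx; rewrite /expdd; have [_|yx] := eqVneq y x; first by rewrite ler_expR.
have xy' : 0 < y - x by rewrite subr_gt0 lt_def yx.
apply: (@le_trans _ _ (expR x)); first by rewrite ler_expR.
rewrite ler_pdivlMr// lerBrDr -[X in _ + X]mulr1 -mulrDr.
have -> : expR y = expR x * expR (y - x) by rewrite -expRD addrC subrK.
rewrite ler_wpM2l ?expR_ge0//.
by rewrite addrC expR_ge1Dx.
Qed.

Lemma expdd_gt0 y x : 0 < expdd y x.
Proof.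
apply: (@lt_le_trans _ _ (expR (Num.min y x))); first exact: expR_gt0.
by apply: expdd_ge; rewrite ge_min lexx ?orbT.
Qed.

Lemma expdd_neq0 y x : expdd y x != 0.
Proof. by rewrite gt_eqF// expdd_gt0. Qed.

Lemma expdd_diag x : expdd x x = expR x.
Proof. by rewrite /expdd eqxx. Qed.

Lemma expdd_shift y x u : expdd (y + u) (x + u) = expR u * expdd y x.
Proof.
rewrite /expdd (inj_eq (addIr u)); case: eqP => _; first by rewrite expRD mulrC.
have -> : y + u - (x + u) = y - x by ring.
by rewrite !expRD -mulrBl mulrAC mulrC.
Qed.

Lemma ddexp_scalar1 (y x : R) :
  ddexp (y%:C%:M : 'M[C]_1) (x%:C%:M : 'M[C]_1) 1%:M = (expdd y x)%:C%:M.
Proof.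
pose T y := ddexp (y%:C%:M : 'M[C]_1) (x%:C%:M : 'M[C]_1) 1%:M 0 0.
have TE t : t != x -> T t = (expdd t x)%:C.
  move=> tx; have /matrixP/(_ 0 0) :=
    ddexp_commute (t%:C%:M : 'M[C]_1) (x%:C%:M : 'M[C]_1) 1%:M.
  rewrite !expmx_scalar1 !mul_scalar_mx mul_mx_scalar scalemx1 scale1r !mxE.
  rewrite !eqxx !mulr1n -/(T t) -mulrBl -!rmorphB -expdd_eq rmorphM mulrC.
  by apply: mulIf; rewrite (inj_eq (@complexI _)) subr_eq0.
suff Tx : T x = (expdd x x)%:C.
  apply/matrixP => i j; rewrite !ord1 [RHS]mxE eqxx mulr1n.
  by have [->|/TE//] := eqVneq y x.
have xC : mC (setT : set R) 0 (fun t : R => t%:C%:M : 'M[C]_1).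
  apply: mC_scalar => //; apply: cC_real.
  by move=> t _; exact: cvg_id.
have [TR TI] : cC 0 (setT : set R) T.
  by apply: mC_ddexp => //; [exact: openT|exact: mC_cst|exact: mC_cst].
have near_x (f : R -> R) : {for x, continuous f} -> f (h + x) @[h --> 0^'] --> f x.
  move=> fc; apply: cvg_within_filter.
  have : {for 0, continuous (fun h => f (h + x))}.
    apply: (@continuous_comp _ _ _ (fun h : R => h + x)); last by rewrite add0r.
    by apply: continuousD; [exact: cvg_id|exact: cst_continuous].
  by rewrite /prop_for /continuous_at add0r.
have nx : \forall h \near (0 : R)^', h + x != x.
  near=> h; rewrite -subr_eq0 addrK; near: h.
  exact: nbhs_dnbhs_neq.
apply/eqP; rewrite eq_complex; apply/andP; split; apply/eqP => /=.
  have := near_x _ (TR x I) => /(cvg_unique _); apply => //.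
  rewrite expdd_diag.
  have D1 : (fun h => h^-1 *: ((expR \o shift x) (h *: 1) - expR x)) @ (0:R)^' -->
      'D_1 expR x by exact: derivable_expR.
  rewrite (@derive_val _ _ _ _ _ _ _ (is_derive_expR x)) in D1.
  apply: (cvg_trans _ D1); apply: near_eq_cvg; near=> h.
  have hx : h + x != x by near: h.
  rewrite TE//= /expdd (negPf hx) addrK /GRing.scale/= mulr1.
  by rewrite mulrC.
have := near_x _ (TI x I) => /(cvg_unique _); apply => //.
apply: (@cvg_trans _ ((fun=> 0 : R) @ (0 : R)^')); last exact: cvg_cst.
apply: near_eq_cvg; near=> h.
by rewrite TE//; near: h.
Unshelve. all: by end_near. Qed.

(** Between eigenvectors, intertwining reduces the claim to matrices of size one. *)
Lemma ddexp_herm m n (B : 'M[C]_m) (A : 'M[C]_n) X : B^t* = B -> A^t* = A ->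
  ddexp B A X = fc2 expdd B A X.
Proof.
move=> BE AE; apply: fc2_unique => // u v y x uy vx.
have h1 : ddexp B A X *m v = 1%:M *m ddexp B (x%:C%:M : 'M[C]_1) (X *m v).
  by apply: ddexp_intertwine; rewrite ?mulmx1 ?mul1mx// vx mul_mx_scalar.
have h2 : ddexp (y%:C%:M : 'M[C]_1) (x%:C%:M : 'M[C]_1) (u *m (X *m v)) *m 1%:M
    = u *m ddexp B (x%:C%:M : 'M[C]_1) (X *m v).
  by apply: ddexp_intertwine; rewrite ?mulmx1 ?mul1mx// uy mul_scalar_mx.
rewrite -mulmxA h1 mul1mx -h2 mulmx1 mulmxA.
have -> : u *m X *m v = (u *m X *m v) 0 0 *: 1%:M.
  by rewrite scalemx1; exact: mx11_scalar.
by rewrite ddexpZ ddexp_scalar1 -[X in _ *: X = _]scalemx1 !scalerA mulrC.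
Qed.

End ExpHermitian.

Section HermitianSmooth.
Variables (R : realType) (V : normedModType R) (D : set V).
Hypothesis oD : open D.
Local Notation C := R[i].

Definition hermD n (A : V -> 'M[C]_n) := forall x, D x -> (A x)^t* = A x.

Lemma mC_fc_exp k n (A : V -> 'M[C]_n) : hermD A ->
  mC D k A -> mC D k (fun x => fc expR (A x)).
Proof.
move=> AH AC; apply: (@mC_ext _ _ _ _ oD _ _ (fun x => expmx (A x))).
  by move=> x Dx; rewrite expmx_herm// AH.
exact: mC_expmx.
Qed.

Lemma mC_fc2_expdd k m n (B : V -> 'M[C]_m) (A : V -> 'M[C]_n) X :
  hermD B -> hermD A -> mC D k B -> mC D k A -> mC D k X ->
  mC D k (fun x => fc2 (@expdd R) (B x) (A x) (X x)).
Proof.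
move=> BH AH BC AC XC.
apply: (@mC_ext _ _ _ _ oD _ _ (fun x => ddexp (B x) (A x) (X x))).
  by move=> x Dx; rewrite ddexp_herm// ?AH ?BH.
exact: mC_ddexp.
Qed.

Lemma mul_vec_fc2 K m n (B : 'M[C]_m) (A : 'M[C]_n) X : B^t* = B -> A^t* = A ->
  mxvec X *m lin_mx (fc2 K B A) = mxvec (fc2 K B A X).
Proof.
move=> BE AE.
pose f : {linear 'M[C]_(m, n) -> 'M[C]_(m, n)} := HB.pack (fc2 K B A)
  (GRing.isLinear.Build _ _ _ _ _ (fc2_linear BE AE K)).
exact: (mul_vec_lin f).
Qed.

Lemma mC_lin_fc2 k m n (B : V -> 'M[C]_m) (A : V -> 'M[C]_n) :
  hermD B -> hermD A -> mC D k B -> mC D k A ->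
  mC D k (fun x => lin_mx (fc2 (@expdd R) (B x) (A x)) : 'M[C]_(m * n)).
Proof.
move=> BH AH BC AC i j; under eq_fun do rewrite mxE /=.
case/mxvec_indexP: j => a b; under eq_fun do rewrite mxvecE.
by apply: mC_fc2_expdd => //; exact: mC_cst.
Qed.

(** Dividing by [expdd] is inverting a matrix that depends smoothly on [B] and [A]; smoothness
    thus follows from [mC_inv]. *)
Lemma fc2_inv_expdd m n (B : 'M[C]_m) (A : 'M[C]_n) : B^t* = B -> A^t* = A ->
  lin_mx (fc2 (@expdd R) B A) \in unitmx /\
  forall X, fc2 (fun y x => (expdd y x)^-1) B A X =
    vec_mx (mxvec X *m invmx (lin_mx (fc2 (@expdd R) B A))).
Proof.
move=> BE AE.
have K X : fc2 (@expdd R) B A (fc2 (fun y x => (expdd y x)^-1) B A X) = X.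
  rewrite fc2_comp// (@fc2_ext _ _ (fun _ _ => 1)) ?fc2_cst ?scale1r// => i j.
  by rewrite mulfV// expdd_neq0.
have u : lin_mx (fc2 (@expdd R) B A) \in unitmx.
  have : lin_mx (fc2 (fun y x => (expdd y x)^-1) B A) *m lin_mx (fc2 (@expdd R) B A)
      = 1%:M.
    apply/row_matrixP => i; rewrite !rowE mulmxA mulmx1.
    by rewrite -[delta_mx 0 i]vec_mxK !mul_vec_fc2// K.
  by move=> /mulmx1_unit[].
split=> // X; apply: (can_inj mxvecK); rewrite vec_mxK.
by rewrite -{2}(K X) -(mul_vec_fc2 (@expdd R))// mulmxK.
Qed.

Lemma mC_fc2_expddV k m n (B : V -> 'M[C]_m) (A : V -> 'M[C]_n) X :
  hermD B -> hermD A -> mC D k B -> mC D k A -> mC D k X ->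
  mC D k (fun x => fc2 (fun y x => (expdd y x)^-1) (B x) (A x) (X x)).
Proof.
move=> BH AH BC AC XC.
apply: (@mC_ext _ _ _ _ oD _ _ (fun x =>
  vec_mx (mxvec (X x) *m invmx (lin_mx (fc2 (@expdd R) (B x) (A x)))))).
  by move=> x Dx; have [_ ->] := fc2_inv_expdd (BH x Dx) (AH x Dx).
move=> i j; under eq_fun do rewrite mxE.
apply: mCM => //.
  move=> a; rewrite (ord1 a); case/mxvec_indexP => b c.
  under eq_fun do rewrite mxvecE.
  exact: XC.
apply: mC_inv => //; last exact: mC_lin_fc2.
by move=> x Dx; have [] := fc2_inv_expdd (BH x Dx) (AH x Dx).
Qed.

End HermitianSmooth.

Section LnHermitian.
Variable R : realType.
Local Notation C := R[i].

Lemma unitary_entry n (U : 'M[C]_n) i j : U \is unitarymx ->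
  Num.sqrt (abs2 (U i j)) <= 1.
Proof.
move=> /unitarymxP/matrixP/(_ i i); rewrite !mxE eqxx => h.
rewrite -[leRHS]sqrtr1 ler_wsqrtr//.
have -> : (1 : R) = \sum_k abs2 (U i k).
  apply: complexI; rewrite raddf_sum/= -[LHS]h; apply: eq_bigr => k _.
  by rewrite !mxE mulrC abs2E.
by rewrite (bigD1 j)//= lerDl sumr_ge0// => k _; exact: abs2_ge0.
Qed.

Lemma abs1_entry m n (X : 'M[C]_(m, n)) i j : Num.sqrt (abs2 (X i j)) <= abs1 X.
Proof.
rewrite /abs1 (bigD1 i)//= (bigD1 j)//= -addrA lerDl addr_ge0//.
  by apply: sumr_ge0 => *; exact: sqrtr_ge0.
by apply: sumr_ge0 => *; apply: sumr_ge0 => *; exact: sqrtr_ge0.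
Qed.

Lemma sandwich_entry m n (U : 'M[C]_m) (W : 'M[C]_n) (X : 'M[C]_(m, n)) i j :
  U \is unitarymx -> W \is unitarymx ->
  Num.sqrt (abs2 ((U *m X *m W) i j)) <= abs1 X.
Proof.
move=> Uu Wu; rewrite -mulmxA mxE (le_trans (sqrt_abs2_sum _ _))//.
rewrite /abs1 ler_sum// => a _; rewrite sqrt_abs2M.
rewrite (@le_trans _ _ (1 * Num.sqrt (abs2 ((X *m W) a j))))//.
  by rewrite ler_wpM2r ?sqrtr_ge0// unitary_entry.
rewrite mul1r mxE (le_trans (sqrt_abs2_sum _ _))// ler_sum// => b _.
by rewrite sqrt_abs2M ler_piMr ?sqrtr_ge0// unitary_entry.
Qed.

Lemma fc2_bound K m n (B : 'M[C]_m) (A : 'M[C]_n) X c i j :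
  B^t* = B -> A^t* = A -> (forall a b, `|K (lam B a) (lam A b)| <= c) ->
  Num.sqrt (abs2 (fc2 K B A X i j)) <= (m * n)%:R * c * abs1 X.
Proof.
move=> BE AE Kc; rewrite fc2.unlock.
have UB := eigbasis_unitary BE; have UA := eigbasis_unitary AE.
have UB' : (eigbasis B)^t* \is unitarymx by rewrite trmxC_unitary.
apply: (le_trans (sandwich_entry _ i j UB' UA)).
rewrite /abs1; apply: (@le_trans _ _ (\sum_(a < m) \sum_(b < n) (c * abs1 X))).
  apply: ler_sum => a _; apply: ler_sum => b _; rewrite mxE sqrt_abs2M.
  have c0 : 0 <= c by rewrite (le_trans _ (Kc a b)).
  apply: ler_pM; rewrite ?sqrtr_ge0//.
    by rewrite /abs2 /= expr0n addr0 sqrtr_sqr.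
  by rewrite sandwich_entry ?trmxC_unitary.
rewrite !sumr_const !card_ord -mulrnA mulnC.
by rewrite -[X in X <= _]mulr_natl mulrA.
Qed.

Lemma expdd_ln_le (y x m : R) : 0 < m -> m <= y -> m <= x ->
  `|(expdd (ln y) (ln x))^-1| <= m^-1.
Proof.
move=> m0 my mx; have y0 := lt_le_trans m0 my; have x0 := lt_le_trans m0 mx.
have e0 := expdd_gt0 (ln y) (ln x).
rewrite ger0_norm; last by rewrite invr_ge0 ltW.
rewrite lef_pV2 ?posrE//.
by rewrite -{1}(lnK m0) expdd_ge// ler_ln.
Qed.

Definition pos n (P : 'M[C]_n) := P^t* = P /\ forall i, 0 < lam P i.

Lemma fc_expK n (P : 'M[C]_n) : pos P -> fc expR (fc (@ln R) P) = P.
Proof.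
move=> [PE P0]; rewrite fc_comp// -[RHS]fc_id//; apply: fc_ext => i /=.
by rewrite lnK// posrE.
Qed.

Lemma fc_lnK n (A : 'M[C]_n) : A^t* = A -> fc (@ln R) (fc expR A) = A.
Proof.
move=> AE; rewrite fc_comp// -[RHS]fc_id//; apply: fc_ext => i /=.
by rewrite expRK.
Qed.

(** This is [fc_increment] for the exponential, solved for the increment of the
    logarithm. *)
Lemma ln_increment n (P Q : 'M[C]_n) : pos P -> pos Q ->
  fc (@ln R) Q - fc (@ln R) P =
  fc2 (fun y x => (expdd y x)^-1) (fc (@ln R) Q) (fc (@ln R) P) (Q - P).
Proof.
move=> pP pQ; have LP := fc_herm P (@ln R); have LQ := fc_herm Q (@ln R).
rewrite -{3}(fc_expK pQ) -{3}(fc_expK pP).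
rewrite (fc_increment LQ LP (@expdd_eq R)).
rewrite fc2_comp ?fc_herm// (@fc2_ext _ _ (fun _ _ => 1)) ?fc2_cst ?fc_herm ?scale1r//.
by move=> i j; rewrite mulVf// expdd_neq0.
Qed.

Lemma ln_bound n (P Q : 'M[C]_n) m i j : 0 < m -> pos P -> pos Q ->
  (forall i, m <= lam P i) -> (forall i, m <= lam Q i) ->
  Num.sqrt (abs2 ((fc (@ln R) Q - fc (@ln R) P) i j))
    <= (n * n)%:R * m^-1 * abs1 (Q - P).
Proof.
move=> m0 pP pQ mP mQ; rewrite ln_increment//.
have L (M : 'M[C]_n) : pos M -> forall i, lam (fc (@ln R) M) i = ln (lam M i).
  move=> [ME M0] k.
  suff h : lam (fc (@ln R) M) =1 fun i => ln (lam M i) by exact: h.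
  apply: lam_unique => [|a b ab]; first exact: char_poly_fc.
  by rewrite ler_ln ?posrE// lam_le.
apply: fc2_bound; rewrite ?fc_herm// => a b.
rewrite !L//; exact: expdd_ln_le.
Qed.

End LnHermitian.

Section LnSmooth.
Variables (R : realType) (V : normedModType R) (D : set V).
Hypothesis oD : open D.
Local Notation C := R[i].

Lemma abs1_continuous m n (F : V -> 'M[C]_(m, n)) x e : mC D 0 F -> D x -> 0 < e ->
  \forall y \near x, abs1 (F y - F x) < e.
Proof.
move=> FC Dx e0.
suff : abs1 (F y - F x) @[y --> x] --> (0 : R).
  move/cvgrPdist_lt => /(_ _ e0); apply: filterS => y.
  by rewrite sub0r normrN ger0_norm// abs1_ge0.
have sum0 (I : Type) (r : seq I) (h : I -> V -> R) :
    (forall p, h p y @[y --> x] --> (0 : R)) ->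
    \sum_(p <- r) h p y @[y --> x] --> (0 : R).
  move=> h0; elim: r => [|p r IH].
    by under eq_fun do rewrite big_nil; exact: cvg_cst.
  by under eq_fun do rewrite big_cons; exact: cvgD0.
apply: (sum0) => i; apply: (sum0) => j; have [FR FI] := FC i j.
have R0 : `|complex.Re (F y i j) - complex.Re (F x i j)| @[y --> x] --> (0 : R).
  rewrite -(@normr0 _ R); apply: cvg_norm; apply/subr_cvg0; exact: FR.
have I0 : `|complex.Im (F y i j) - complex.Im (F x i j)| @[y --> x] --> (0 : R).
  rewrite -(@normr0 _ R); apply: cvg_norm; apply/subr_cvg0; exact: FI.
apply: (@squeeze_cvgr _ _ _ _ (fun=> 0 : R) (fun y =>
  `|complex.Re (F y i j) - complex.Re (F x i j)| +
  `|complex.Im (F y i j) - complex.Im (F x i j)|)).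
- apply: nearW => y; rewrite sqrtr_ge0 !mxE.
  by rewrite (le_trans (sqrt_abs2_le _))// ReD ImD ReN ImN.
- exact: cvg_cst.
- exact: cvgD0.
Qed.

Lemma mC0_of_abs1 m n (F : V -> 'M[C]_(m, n)) :
  (forall x i j e, D x -> 0 < e ->
    \forall y \near x, Num.sqrt (abs2 ((F y - F x) i j)) < e) -> mC D 0 F.
Proof.
move=> FC i j; split=> x Dx.
  suff : complex.Re (F y i j) @[y --> x] --> complex.Re (F x i j) by [].
  apply/cvgrPdist_lt => e e0; have := FC x i j e Dx e0; apply: filterS => y.
  apply: le_lt_trans; rewrite distrC -ReN -ReD.
  by rewrite !mxE; exact: Re_le_sqrt.
suff : complex.Im (F y i j) @[y --> x] --> complex.Im (F x i j) by [].
apply/cvgrPdist_lt => e e0; have := FC x i j e Dx e0; apply: filterS => y.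
apply: le_lt_trans; rewrite distrC -ImN -ImD.
by rewrite !mxE; exact: Im_le_sqrt.
Qed.

Lemma lam_near n (P : V -> 'M[C]_n) x e : hermD D P -> mC D 0 P -> D x -> 0 < e ->
  \forall y \near x, forall i, `|lam (P y) i - lam (P x) i| < e.
Proof.
move=> PH PC Dx e0; have Dn : \forall y \near x, D y by exact: open_nbhs_nbhs.
have := abs1_continuous PC Dx e0; move: Dn; apply: filterS2 => y Dy h i.
by apply: le_lt_trans h; apply: lam_lipschitz; exact: PH.
Qed.

Lemma mC_fc_ln0 n (P : V -> 'M[C]_n) : (forall x, D x -> pos (P x)) ->
  mC D 0 P -> mC D 0 (fun x => fc (@ln R) (P x)).
Proof.
move=> pP PC; apply: mC0_of_abs1 => x i j e Dx e0.
have PH : hermD D P by move=> y /pP[].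
pose m := \big[Num.min/1]_i lam (P x) i.
have m0 : 0 < m by apply: lt_bigmin => // k _; exact: (pP x Dx).2.
have mP k : m <= lam (P x) k by exact: bigmin_le_cond.
have m2 : 0 < m / 2 by rewrite divr_gt0.
pose c : R := (n * n)%:R * (m / 2)^-1 + 1.
have c0 : 0 < c by rewrite ltr_wpDl// mulr_ge0// invr_ge0 ltW.
have ec : 0 < e / c by rewrite divr_gt0.
have Dn : \forall y \near x, D y by exact: open_nbhs_nbhs.
have := abs1_continuous PC Dx ec; have := lam_near PH PC Dx m2; move: Dn.
apply: filterS3 => y Dy ly ay.
apply: (@le_lt_trans _ _ ((n * n)%:R * (m / 2)^-1 * abs1 (P y - P x))).
  apply: ln_bound => //; [exact: pP|exact: pP|move=> k|move=> k].
    by have := mP k; lra.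
  by have := mP k; have := ly k; rewrite ltr_norml => /andP[]; lra.
apply: (@le_lt_trans _ _ (c * abs1 (P y - P x))).
  by rewrite ler_wpM2r ?abs1_ge0// /c lerDl.
by rewrite mulrC -ltr_pdivlMr.
Qed.

Lemma fc2_delta K m n (B : 'M[C]_m) (A : 'M[C]_n) X : B^t* = B -> A^t* = A ->
  fc2 K B A X = \sum_(p : 'I_m * 'I_n) X p.1 p.2 *: fc2 K B A (delta_mx p.1 p.2).
Proof.
move=> BE AE.
pose f : {linear 'M[C]_(m, n) -> 'M[C]_(m, n)} := HB.pack (fc2 K B A)
  (GRing.isLinear.Build _ _ _ _ _ (fc2_linear BE AE K)).
rewrite {1}[X]matrix_sum_delta pair_bigA -[LHS]/(f _) linear_sum.
by apply: eq_bigr => p _; rewrite linearZ.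
Qed.

(** The derivative is again a smooth expression in the logarithm itself
    ([mC_fc2_expddV]), so that the induction on the order closes. *)
Lemma mC_fc_ln k n (P : V -> 'M[C]_n) : (forall x, D x -> pos (P x)) ->
  mC D k P -> mC D k (fun x => fc (@ln R) (P x)).
Proof.
move=> pP; elim: k => [|k IH] PC; first exact: mC_fc_ln0.
have LH : hermD D (fun x => fc (@ln R) (P x)) by move=> x _; exact: fc_herm.
move=> i j.
apply: (@cC_increment _ _ _ _ _ ('I_n * 'I_n)%type (fun p x => P x p.1 p.2)
  (fun p x y => fc2 (fun y x => (expdd y x)^-1) (fc (@ln R) (P y)) (fc (@ln R) (P x))
                 (delta_mx p.1 p.2) i j)) => //.
- move=> x p Dx; apply: (@mC_fc2_expddV _ _ _ oD 0 _ _ (fun y => fc (@ln R) (P y))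
    (fun=> fc (@ln R) (P x)) (fun=> delta_mx p.1 p.2)) => //.
  + by move=> y _; exact: fc_herm.
  + by apply: mC_fc_ln0 => //; exact: mC_le0 PC.
  + exact: mC_cst.
  + exact: mC_cst.
- move=> x y Dx Dy.
  transitivity ((fc (@ln R) (P y) - fc (@ln R) (P x)) i j); first by rewrite !mxE.
  rewrite (ln_increment (pP _ Dx) (pP _ Dy)) fc2_delta ?fc_herm// summxE; apply: eq_bigr => p _.
  by rewrite !mxE.
have PC' : mC D k P by move=> a b; have [h1 h2] := PC a b; split; exact: class_CS.
move=> v; pose dP x : 'M[C]_n := \matrix_(a, b) dC v (fun x => P x a b) x.
apply: (@cC_ext _ _ _ _ oD (fun x => fc2 (fun y x => (expdd y x)^-1)
  (fc (@ln R) (P x)) (fc (@ln R) (P x)) (dP x) i j)).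
  move=> x Dx; rewrite fc2_delta ?fc_herm// summxE; apply: eq_bigr => p _.
  by rewrite !mxE.
apply: mC_fc2_expddV => //; [exact: IH|exact: IH|].
exact: mC_derive.
Qed.

End LnSmooth.

(** * Sums of functions over the spectrum of a second matrix *)

Section PartialTrace.
Variable R : realType.
Local Notation C := R[i].

Lemma fc_diagonalized n (U A : 'M[C]_n) (d : 'I_n -> R) h : U \is unitarymx ->
  A = U^t* *m diag_mx (\row_i (d i)%:C) *m U ->
  fc h A = U^t* *m diag_mx (\row_i (h (d i))%:C) *m U /\
  forall i, exists j, lam A i = d j.
Proof.
move=> Uu AE.
have AH : A^t* = A by rewrite AE !adjmxM trmxCK adjmx_diag mulmxA.
have UV := unitaryVmx Uu; have VU : U *m U^t* = 1%:M by apply/unitarymxP.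
split.
  apply/esym/fc_unique => // v x; rewrite {1}AE => vx.
  rewrite -[in RHS](mul1mx v) -UV -!mulmxA scalemxAr; congr (_ *m _).
  have /colP wx := congr1 (mulmx U) vx.
  apply/colP => i; have := wx i; rewrite !mulmxA VU mul1mx -!mulmxA -scalemxAr.
  move: (U *m v) => w; rewrite !mul_diag_mx !mxE.
  have [->|w0] := eqVneq (w i 0) 0; first by rewrite !mulr0.
  by move=> /(mulIf w0)/complexI ->.
move=> i.
have : perm_eq (eigenvalues A) [seq d j | j : 'I_n].
  apply: char_poly_eigenvalues; rewrite {1}AE char_poly_similar//.
  by rewrite char_poly_diag big_map big_enum.
move=> /perm_mem/(_ (lam A i)); rewrite eigenvaluesE map_f ?mem_enum//.
by move=> /esym/mapP[j _ ->]; exists j.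
Qed.

Definition sandmx m n (P : 'M[C]_m) (Q : 'M[C]_n) : 'M[C]_(m * n) :=
  lin_mx (mulmxr Q \o mulmx P).

Lemma sandmxE m n (P : 'M[C]_m) (Q : 'M[C]_n) i j a b :
  sandmx P Q (mxvec_index i j) (mxvec_index a b) = P a i * Q j b.
Proof.
rewrite /sandmx mxE /= mxvecE vec_mx_delta.
rewrite mxE (bigD1 j)//= big1 => [|k /negPf kj].
  rewrite mxE (bigD1 i)//= big1 => [|k /negPf ki].
    by rewrite !mxE !eqxx mulr1 !addr0.
  by rewrite !mxE ki mulr0.
rewrite mxE big1 ?mul0r// => l _.
by rewrite !mxE kj andbF mulr0.
Qed.

Lemma sandmx_inv m n (P P' : 'M[C]_m) (Q Q' : 'M[C]_n) :
  P' *m P = 1%:M -> Q *m Q' = 1%:M -> sandmx P Q *m sandmx P' Q' = 1%:M.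
Proof.
move=> PP QQ; apply/row_matrixP => i; rewrite !rowE mulmxA mulmx1.
rewrite -[delta_mx 0 i]vec_mxK /sandmx !mul_vec_lin /=.
by congr mxvec; rewrite !mulmxA PP mul1mx -mulmxA QQ mulmx1.
Qed.

Lemma sandmx_adj m n (P : 'M[C]_m) (Q : 'M[C]_n) :
  (sandmx P Q)^t* = sandmx (P^t*) (Q^t*).
Proof.
apply/matrixP; move=> p q; case/mxvec_indexP: p => i j; case/mxvec_indexP: q => a b.
rewrite (mxE map_mx_key) (mxE trmx_key) !sandmxE rmorphM/=.
by congr (_ * _); rewrite !mxE.
Qed.

Lemma sum_mxvec m n (F : 'I_(m * n) -> C) :
  \sum_p F p = \sum_i \sum_j F (mxvec_index i j).
Proof.
rewrite (reindex _ (curry_mxvec_bij _ _))/= pair_bigA.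
by apply: eq_bigr => -[].
Qed.

(** The partial trace over the second tensor factor; the indices [b] and [a] are exchanged
    because [lin_mx] acts on rows. *)
Definition ptrace m n (M : 'M[C]_(m * n)) : 'M[C]_m :=
  \matrix_(b, a) \sum_c M (mxvec_index a c) (mxvec_index b c).

Lemma ptrace_sandmx m n (U : 'M[C]_m) (W : 'M[C]_n) (K : 'I_m -> 'I_n -> R) :
  W \is unitarymx ->
  ptrace ((sandmx (U^t*) W)^t* *m diag_mx (mxvec (\matrix_(i, j) (K i j)%:C))
    *m sandmx (U^t*) W)
  = U^t* *m diag_mx (\row_i (\sum_j K i j)%:C) *m U.
Proof.
move=> Wu; apply/matrixP => b a; rewrite [LHS]mxE mul_mx_diag [RHS]mxE.
transitivity (\sum_i \sum_j (U^t*) b i * (K i j)%:C * U i a *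
    (\sum_c W j c * (W j c)^*)).
  rewrite (eq_bigr (fun c => \sum_i \sum_j (U^t*) b i * (K i j)%:C * U i a *
    (W j c * (W j c)^*))); last first.
    move=> c _; rewrite mxE sum_mxvec; apply: eq_bigr => i _; apply: eq_bigr => j _.
    rewrite [X in X * _](mxE) mxvecE [X in _ * X * _]mxE sandmx_adj !sandmxE trmxCK.
    by rewrite [(W^t*) _ _]mxE [(W^T) _ _]mxE; ring.
  rewrite exchange_big; apply: eq_bigr => i _; rewrite exchange_big.
  by apply: eq_bigr => j _; rewrite mulr_sumr.
apply: eq_bigr => i _; rewrite mul_mx_diag [X in _ = X * _]mxE.
rewrite [X in _ = _ * X * _]mxE.
rewrite (eq_bigr (fun j => (U^t*) b i * U i a * (K i j)%:C)) => [|j _].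
  by rewrite -mulr_sumr raddf_sum/=; ring.
have -> : \sum_c W j c * (W j c)^* = 1.
  transitivity ((W *m W^t*) j j); last by rewrite (unitarymxP Wu) mxE eqxx.
  by rewrite mxE; apply: eq_bigr => c _; rewrite !mxE.
by rewrite mulr1; ring.
Qed.

(** [fc2] is diagonal in the matrix units of the two eigenbases. *)
Lemma lin_fc2E K m n (B : 'M[C]_m) (A : 'M[C]_n) : B^t* = B -> A^t* = A ->
  let W := sandmx ((eigbasis B)^t*) (eigbasis A) in
  W \is unitarymx /\
  lin_mx (fc2 K B A) = W^t* *m
    diag_mx (mxvec (\matrix_(i, j) (K (lam B i) (lam A j))%:C)) *m W.
Proof.
move=> BE AE W.
have Wu : W \is unitarymx.
  apply/unitarymxP; rewrite sandmx_adj trmxCK.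
  by apply: sandmx_inv; rewrite eigbasisKV.
split=> //; rewrite -[LHS]mul1mx -(unitaryVmx Wu) -!mulmxA; congr (_ *m _).
apply/row_matrixP => p; rewrite row_mul; case/mxvec_indexP: p => i j.
have -> : row (mxvec_index i j) W =
    mxvec ((eigbasis B)^t* *m delta_mx i j *m eigbasis A).
  by rewrite rowE -mxvec_delta /W /sandmx mul_vec_lin.
rewrite mul_vec_fc2// row_mul row_diag_mx mxvecE mxE -scalemxAl.
rewrite -mxvec_delta /W /sandmx mul_vec_lin -linearZ /=; congr mxvec.
rewrite fc2.unlock.
have -> : eigbasis B *m ((eigbasis B)^t* *m delta_mx i j *m eigbasis A)
    *m (eigbasis A)^t* = delta_mx i j.
  by rewrite !mulmxA eigbasisKV// mul1mx -mulmxA eigbasisKV// mulmx1.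
rewrite (_ : \matrix_(_, _) _ = (K (lam B i) (lam A j))%:C *: delta_mx i j).
  by rewrite -scalemxAr -scalemxAl.
apply/matrixP => a b; rewrite !mxE.
by case: eqP => [->|_]; case: eqP => [->|_]; rewrite /= ?mulr0.
Qed.

(** The secular equations of [A] and of its exponential differ by exponentials of such
    sums; see [bfac] and [lsum_exp]. *)
Definition lsum n (A : 'M[C]_n) (s : R) : R := \sum_j ln (expdd s (lam A j)).

Lemma lin_expdd_pos m n (B : 'M[C]_m) (A : 'M[C]_n) : B^t* = B -> A^t* = A ->
  pos (lin_mx (fc2 (@expdd R) B A)).
Proof.
move=> BE AE; have [Wu TE] := lin_fc2E (@expdd R) BE AE.
pose d p : R := complex.Re (mxvec (\matrix_(i, j) (expdd (lam B i) (lam A j))%:C) 0 p).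
have dE : mxvec (\matrix_(i, j) (expdd (lam B i) (lam A j))%:C) = \row_p (d p)%:C.
  by apply/rowP => p; rewrite [RHS]mxE /d; case/mxvec_indexP: p => i j; rewrite mxvecE mxE.
rewrite dE in TE; split; first by rewrite TE !adjmxM trmxCK adjmx_diag mulmxA.
have [_ h] := fc_diagonalized id Wu TE; move=> p; have [q ->] := h p.
by rewrite /d; case/mxvec_indexP: q => i j; rewrite mxvecE mxE expdd_gt0.
Qed.

(** The logarithm turns the product over the spectrum of [A] into a partial
    trace; this is how symmetric functions of the eigenvalues of [A], applied
    to [B], are seen to be smooth in [(A, B)]. *)
Lemma ptrace_ln m n (B : 'M[C]_m) (A : 'M[C]_n) : B^t* = B -> A^t* = A ->
  ptrace (fc (@ln R) (lin_mx (fc2 (@expdd R) B A))) = fc (lsum A) B.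
Proof.
move=> BE AE; have [Wu TE] := lin_fc2E (@expdd R) BE AE.
pose d p : R := complex.Re (mxvec (\matrix_(i, j) (expdd (lam B i) (lam A j))%:C) 0 p).
have dE : mxvec (\matrix_(i, j) (expdd (lam B i) (lam A j))%:C) = \row_p (d p)%:C.
  by apply/rowP => p; rewrite [RHS]mxE /d; case/mxvec_indexP: p => i j; rewrite mxvecE mxE.
rewrite dE in TE; have [-> _] := fc_diagonalized (@ln R) Wu TE.
have -> : \row_p (ln (d p))%:C =
    mxvec (\matrix_(i, j) (ln (expdd (lam B i) (lam A j)))%:C).
  by apply/rowP => p; rewrite [LHS]mxE /d; case/mxvec_indexP: p => i j; rewrite !mxvecE !mxE.
by rewrite ptrace_sandmx ?eigbasis_unitary// fc.unlock.
Qed.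

Lemma lsum_exp n (A : 'M[C]_n) s : expR (lsum A s) = \prod_j expdd s (lam A j).
Proof.
rewrite /lsum (big_morph expR (@expRD R) (@expR0 R)).
by apply: eq_bigr => j _; rewrite lnK// posrE expdd_gt0.
Qed.

End PartialTrace.

Lemma mC_fc_lsum (R : realType) (V : normedModType R) (D : set V) k m n
    (B : V -> 'M[R[i]]_m) (A : V -> 'M[R[i]]_n) : open D ->
  hermD D B -> hermD D A -> mC D k B -> mC D k A ->
  mC D k (fun x => fc (lsum (A x)) (B x)).
Proof.
move=> oD BH AH BC AC.
apply: (@mC_ext _ _ _ _ oD _ _ (fun x =>
  ptrace (fc (@ln R) (lin_mx (fc2 (@expdd R) (B x) (A x)))))).
  by move=> x Dx; rewrite ptrace_ln ?BH ?AH.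
move=> b a; under eq_fun do rewrite mxE; apply: cC_sum => // c.
apply: mC_fc_ln => // [x Dx|]; first by apply: lin_expdd_pos; [exact: BH|exact: AH].
exact: mC_lin_fc2.
Qed.

(** * The secular equation of a bordered Hermitian matrix *)

(** Blocks are expressed by the projection [proj] to the first coordinates and the last
    basis vector [elast]: no cast between [n.+1] and [n + 1] is then needed. *)
HB.lock Definition proj (R : realType) n : 'M[R[i]]_(n, n.+1) :=
  \matrix_(i, j) (j == widen_ord (leqnSn n) i)%:R.
HB.lock Definition elast (R : realType) n : 'cV[R[i]]_n.+1 := delta_mx ord_max 0.
Arguments proj {R} n.
Arguments elast {R} n.

Section BorderBasis.
Variable R : realType.
Local Notation C := R[i].

Lemma eig_mul_entry n p (A : 'M[C]_n) (Z : 'M[C]_(n, p)) i j : A^t* = A ->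
  (eigbasis A *m (A *m Z)) i j = (lam A i)%:C * (eigbasis A *m Z) i j.
Proof.
move=> AE; rewrite mulmxA.
have -> : eigbasis A *m A = diag_mx (\row_i (lam A i)%:C) *m eigbasis A.
  by rewrite {2}(eigbasisE AE) !mulmxA eigbasisKV// mul1mx.
by rewrite -mulmxA mul_diag_mx mxE [X in X * _]mxE.
Qed.

Lemma widen_inj n : injective (widen_ord (leqnSn n)).
Proof. by move=> i j /(congr1 val)/= /val_inj. Qed.

Lemma projE n i j : (proj n : 'M[C]_(n, n.+1)) i j = (j == widen_ord (leqnSn n) i)%:R.
Proof. by rewrite proj.unlock mxE. Qed.

Lemma elastE n i j : (elast n : 'cV[C]_n.+1) i j = (i == ord_max)%:R.
Proof. by rewrite elast.unlock ord1 mxE andbT. Qed.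

Local Notation bordE := (projE, elastE, mxE).

Lemma proj_mul n p (A : 'M[C]_(n.+1, p)) i j :
  (proj n *m A) i j = A (widen_ord (leqnSn n) i) j.
Proof.
rewrite bordE (bigD1 (widen_ord (leqnSn n) i))//= bordE eqxx mul1r big1 ?addr0// => k ki.
by rewrite bordE (negPf ki) mul0r.
Qed.

Lemma mul_projC n p (A : 'M[C]_(p, n.+1)) i j :
  (A *m (proj n)^t*) i j = A i (widen_ord (leqnSn n) j).
Proof.
rewrite bordE (bigD1 (widen_ord (leqnSn n) j))//= !bordE eqxx rmorph1 mulr1.
rewrite big1 ?addr0// => k ki.
by rewrite !bordE (negPf ki) rmorph0 mulr0.
Qed.

Lemma projKV n : proj n *m (proj n)^t* = 1%:M :> 'M[C]_n.
Proof.
by apply/matrixP => i j; rewrite proj_mul !bordE rmorph_nat (inj_eq (@widen_inj _)).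
Qed.

Lemma proj_elast n : proj n *m elast n = 0 :> 'cV[C]_n.
Proof.
apply/matrixP => i j; rewrite proj_mul !bordE.
suff /negPf-> : widen_ord (leqnSn n) i != ord_max by [].
by rewrite -val_eqE /= neq_ltn ltn_ord.
Qed.

Lemma elastC n : (elast n)^t* *m elast n = 1%:M :> 'M[C]_1.
Proof.
apply/matrixP => i j; rewrite !ord1 bordE (bigD1 ord_max)//= big1 => [|k /negPf k0].
  by rewrite !bordE !eqxx rmorph1 mulr1 addr0.
by rewrite !bordE k0 mulr0.
Qed.

Lemma elast_projC n : (elast n)^t* *m (proj n)^t* = 0 :> 'rV[C]_n.
Proof. by rewrite -adjmxM proj_elast trmx0 map_mx0. Qed.

Lemma proj_split n : (proj n)^t* *m proj n + elast n *m (elast n)^t* = 1%:M :> 'M[C]_n.+1.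
Proof.
apply/matrixP => i j; rewrite bordE.
have -> : (elast n *m (elast n)^t* : 'M[C]_n.+1) i j = ((i == ord_max) && (j == ord_max))%:R.
  rewrite bordE big_ord1 !bordE rmorph_nat -natrM mulnb.
  by [].
have [/eqP ->|ilt] := boolP (i == ord_max).
  rewrite bordE big1 ?add0r => [|k _]; first by rewrite bordE eq_sym.
  rewrite !bordE (_ : (ord_max == _) = false) ?rmorph0 ?mul0r//.
  by apply/negbTE; rewrite -val_eqE /= neq_ltn ltn_ord orbT.
have ilt' : (i < n)%N.
  by have := ltn_ord i; rewrite ltnS leq_eqVlt -(val_eqE i ord_max)/= in ilt * ; rewrite (negPf ilt).
have iE : i = widen_ord (leqnSn n) (Ordinal ilt') by apply: val_inj.
rewrite addr0 bordE (bigD1 (Ordinal ilt'))//= !bordE -iE eqxx rmorph1 mul1r eq_sym.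
rewrite big1 ?addr0// => k ki; rewrite !bordE (_ : (i == _) = false) ?rmorph0 ?mul0r//.
by apply/negbTE; rewrite {1}iE (inj_eq (@widen_inj _)) eq_sym.
Qed.

End BorderBasis.

HB.lock Definition top (R : realType) n (A : 'M[R[i]]_n.+1) : 'M[R[i]]_n :=
  proj n *m A *m (proj n)^t*.
HB.lock Definition border (R : realType) n (A : 'M[R[i]]_n.+1) : 'cV[R[i]]_n :=
  proj n *m A *m elast n.

Section Border.
Variable R : realType.
Local Notation C := R[i].

Lemma topE n (A : 'M[C]_n.+1) : top A = corner (leqnSn n) A.
Proof. by apply/matrixP => i j; rewrite top.unlock mul_projC proj_mul mxE. Qed.

Lemma top_herm n (A : 'M[C]_n.+1) : A^t* = A -> (top A)^t* = top A.
Proof. by rewrite top.unlock; exact: herm_conj. Qed.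

Lemma proj_mulA n (A : 'M[C]_n.+1) :
  proj n *m A = top A *m proj n + border A *m (elast n)^t*.
Proof.
by rewrite -[LHS]mulmx1 -(proj_split R n) mulmxDr top.unlock border.unlock !mulmxA.
Qed.

Lemma corner_entry n (A : 'M[C]_n.+1) : A^t* = A ->
  (elast n)^t* *m A *m elast n = (\tr A - \tr (top A))%:M.
Proof.
move=> AE; rewrite [LHS]mx11_scalar; congr _%:M.
have e : \tr A = \tr (top A) + \tr ((elast n)^t* *m A *m elast n).
  rewrite top.unlock -[in RHS]mulmxA mxtrace_mulC -[in X in _ + X]mulmxA.
  rewrite [X in _ + X]mxtrace_mulC -raddfD/= -!mulmxA -mulmxDr proj_split mulmx1.
  by [].
by rewrite e addrC addKr /mxtrace big_ord1.
Qed.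

Lemma elast_mulA n (A : 'M[C]_n.+1) : A^t* = A ->
  (elast n)^t* *m A =
  (border A)^t* *m proj n + (\tr A - \tr (top A)) *: (elast n)^t*.
Proof.
move=> AE; rewrite -[LHS]mulmx1 -(proj_split R n) mulmxDr !mulmxA.
by rewrite corner_entry// mul_scalar_mx border.unlock !adjmxM AE mulmxA.
Qed.

Lemma poly_eq0_eval (p : {poly C}) : (forall s, p.[s] = 0) -> p = 0.
Proof.
move=> p0; pose rs : seq C := [seq k%:R | k <- iota 0 (size p)].
apply: (@roots_geq_poly_eq0 _ _ rs).
- by apply/allP => x _; apply/eqP.
- by rewrite map_inj_uniq ?iota_uniq// => i j /eqP; rewrite eqr_nat => /eqP.
- by rewrite size_map size_iota.
Qed.

(** Cramer's rule: the last column [w] of the adjugate of [s - A] satisfies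
    [(s - A) w = det (s - A) e], and its first coordinates are found in the eigenbasis of
    the corner. *)
Lemma secular_poly n (A : 'M[C]_n.+1) : A^t* = A ->
  char_poly A = ('X - (\tr A - \tr (top A))%:P) * \prod_i ('X - (lam (top A) i)%:C%:P)
  - \sum_i (abs2 ((eigbasis (top A) *m border A) i 0))%:C%:P *
      \prod_(k | k != i) ('X - (lam (top A) k)%:C%:P).
Proof.
move=> AE; set B := top A; set U := eigbasis B; set beta := U *m border A.
have BE : B^t* = B by exact: top_herm.
set c := \tr A - \tr B; apply/eqP; rewrite -subr_eq0.
set q := _ * _ - _; set Pi := \prod_i ('X - (lam B i)%:C%:P).
have Pi0 : Pi != 0 by apply/prodf_neq0 => i _; rewrite polyXsubC_eq0.
(* the first coordinates of w have the denominators s - y_i, cleared by Pi *)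
suff : Pi * (char_poly A - q) = 0 by move=> /eqP; rewrite mulf_eq0 (negPf Pi0).
apply: poly_eq0_eval => s; rewrite hornerM hornerD hornerN.
pose M : 'M[C]_n.+1 := s%:M - A; pose w := \adj M *m elast n.
have evM m (Z : 'M[C]_m) : (char_poly Z).[s] = \det (s%:M - Z).
  rewrite /char_poly -horner_evalE -det_map_mx; congr (\det _).
  by apply/matrixP => i j; rewrite !mxE /= horner_evalE !hornerE hornerMn hornerX.
have Mw : M *m w = (char_poly A).[s] *: elast n.
  by rewrite /w mulmxA mul_mx_adj mul_scalar_mx evM.
(* the last cofactor is the characteristic polynomial of the corner *)
have wl : (elast n)^t* *m w = (Pi.[s])%:M.
  rewrite [LHS]mx11_scalar; congr _%:M; rewrite /Pi -char_poly_lam// evM.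
  rewrite (_ : (elast n)^t* = delta_mx 0 ord_max); last first.
    by apply/matrixP => i j; rewrite elast.unlock !mxE rmorph_nat andbC.
  rewrite -rowE mxE /w elast.unlock -colE !mxE.
  rewrite /cofactor addnn -signr_odd odd_double expr0 mul1r; congr (\det _).
  apply/matrixP => i j; rewrite /B topE !mxE.
  have wd (k : 'I_n) : lift ord_max k = widen_ord (leqnSn n) k.
    by apply: val_inj; rewrite /= /bump leqNgt ltn_ord.
  by rewrite !wd (inj_eq (@widen_inj _)).
have wl0 : ((elast n)^t* *m w) 0 0 = Pi.[s] by rewrite wl mxE eqxx mulr1n.
clearbody w.
have comp i : (s - (lam B i)%:C) * (U *m (proj n *m w)) i 0 = beta i 0 * Pi.[s].
  have : proj n *m (M *m w) = 0 by rewrite Mw -scalemxAr proj_elast scaler0.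
  rewrite mulmxBl mul_scalar_mx mulmxBr -scalemxAr mulmxA proj_mulA mulmxDl.
  rewrite -!mulmxA wl -/B mul_mx_scalar => /(congr1 (mulmx U))/colP/(_ i).
  rewrite mulmx0 mulmxBr mulmxDr -!scalemxAr -/beta [RHS]mxE.
  rewrite [LHS]mxE [X in X + _ = _]mxE [X in _ + X = _]mxE [X in _ - X = _]mxE.
  rewrite eig_mul_entry// [X in _ - (_ + X) = _]mxE.
  by move=> /subr0_eq; rewrite mulrBl => ->; rewrite addrAC subrr add0r mulrC.
have tot : (char_poly A).[s] = (s - c) * Pi.[s] -
    \sum_i (beta i 0)^* * (U *m (proj n *m w)) i 0.
  have : ((elast n)^t* *m (M *m w)) 0 0 = (char_poly A).[s].
    by rewrite Mw -scalemxAr elastC mxE mxE eqxx mulr1.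
  rewrite mulmxBl mul_scalar_mx mulmxBr -scalemxAr (mulmxA _ A w) elast_mulA//.
  rewrite -/B -/c.
  rewrite mulmxDl -scalemxAl => <-.
  rewrite [LHS]mxE [X in X + _ = _]mxE [X in _ + X = _]mxE [X in _ - X = _]mxE.
  rewrite [X in _ - (_ + X) = _]mxE wl0.
  have -> : (border A)^t* *m proj n *m w = beta^t* *m (U *m (proj n *m w)).
    by rewrite /beta adjmxM !mulmxA (mulmx_adjK _ (eigbasis_unitary BE)).
  have -> : (beta^t* *m (U *m (proj n *m w))) 0 0 =
      \sum_i (beta i 0)^* * (U *m (proj n *m w)) i 0.
    by rewrite mxE; apply: eq_bigr => i _; rewrite !mxE.
  by ring.
pose P i := (\prod_(k | k != i) ('X - (lam B k)%:C%:P)).[s].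
have qE : q.[s] = (s - c) * Pi.[s] - \sum_i (abs2 (beta i 0))%:C * P i.
  rewrite /q hornerD hornerN hornerM !hornerE -/Pi horner_sum; congr (_ - _).
  by apply: eq_bigr => i _; rewrite hornerM hornerC.
have PE i : Pi.[s] = (s - (lam B i)%:C) * P i.
  by rewrite /Pi (bigD1 i)//= hornerM !hornerE.
rewrite tot qE.
set S1 := \sum_i _; set S2 := \sum_i _.
have -> : Pi.[s] * ((s - c) * Pi.[s] - S1 + - ((s - c) * Pi.[s] - S2)) =
  Pi.[s] * S2 - Pi.[s] * S1 by ring.
apply/eqP; rewrite subr_eq0; apply/eqP; rewrite /S1 /S2 !mulr_sumr.
apply: eq_bigr => i _; rewrite mulrCA [in RHS](PE i) -abs2E.
transitivity ((beta i 0)^* * P i * (beta i 0 * Pi.[s])); first by ring.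
by rewrite -comp; ring.
Qed.

(** The secular polynomial at an eigenvalue of the corner. *)
Lemma secular_eq n (A : 'M[C]_n.+1) i : A^t* = A ->
  \prod_j (lam (top A) i - lam A j) =
  - abs2 ((eigbasis (top A) *m border A) i 0) *
    \prod_(k | k != i) (lam (top A) i - lam (top A) k).
Proof.
move=> AE; apply: complexI; set y := lam (top A).
have := congr1 (horner^~ (y i)%:C) (secular_poly AE).
rewrite char_poly_lam// horner_prod hornerD hornerN hornerM horner_sum -/y.
have -> : (\prod_k ('X - (y k)%:C%:P)).[(y i)%:C] = 0.
  by rewrite horner_prod (bigD1 i)//= hornerXsubC subrr mul0r.
rewrite mulr0 add0r (bigD1 i)//= [X in _ + X]big1 ?addr0 => [|k ki]; last first.
  rewrite hornerM horner_prod (bigD1 i) 1?eq_sym//= hornerXsubC subrr mul0r.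
  by rewrite mulr0.
rewrite hornerM hornerC horner_prod rmorphM rmorphN !rmorph_prod/= mulNr.
under eq_bigr do rewrite hornerXsubC -rmorphB.
by under [in X in _ = - (_ * X) -> _]eq_bigr do rewrite hornerXsubC -rmorphB.
Qed.

(** Lagrange interpolation: a monic polynomial of degree [n.+1] is determined
    by the sum of its roots and its values at [n] points. *)
Lemma lagrange_monic (F : fieldType) n (y : 'I_n -> F) (x : 'I_n.+1 -> F) :
  injective y ->
  \prod_j ('X - (x j)%:P) =
  ('X - (\sum_j x j - \sum_i y i)%:P) * \prod_i ('X - (y i)%:P) +
  \sum_i ((\prod_j (y i - x j)) / \prod_(k | k != i) (y i - y k))%:P *
     \prod_(k | k != i) ('X - (y k)%:P).
Proof.
move=> yI; pose c := \sum_j x j - \sum_i y i; rewrite -/c.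
have prodE m (z : 'I_m -> F) : \prod_i ('X - (z i)%:P) =
    \prod_(a <- [seq z i | i : 'I_m]) ('X - a%:P).
  by rewrite big_map big_enum.
have sz m (z : 'I_m -> F) : size (\prod_i ('X - (z i)%:P)) = m.+1.
  by rewrite prodE size_prod_XsubC size_map size_enum_ord.
have lead m (z : 'I_m -> F) : (\prod_i ('X - (z i)%:P))`_m = 1.
  have := monic_prod_XsubC (index_enum 'I_m) xpredT z.
  by move=> /monicP; rewrite /lead_coef sz.
have next m (z : 'I_m.+1 -> F) : (\prod_i ('X - (z i)%:P))`_m = - \sum_i z i.
  have := @coefPn_prod_XsubC F [seq z i | i : 'I_m.+1].
  by rewrite size_map size_enum_ord /= -prodE big_map big_enum => ->.
(* a - b - d has degree less than n and vanishes at the n points y_i *)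
set a := \prod_j _; set b := ('X - _) * _; set d := \sum_i _.
(* b is monic with the same sum of roots as a *)
have bE : b = \prod_(j < n.+1) ('X - (oapp y c (unlift ord0 j))%:P).
  rewrite big_ord_recl unlift_none /b; congr (_ * _).
  by apply: eq_bigr => k _; rewrite liftK.
have ab : (size (a - b)%R <= n)%N.
  apply/leq_sizeP => k; rewrite leq_eqVlt => /predU1P[<-|].
    rewrite coefB bE !next; have -> : \sum_j oapp y c (unlift ord0 j) = \sum_j x j.
      rewrite big_ord_recl unlift_none /= (eq_bigr y) => [|i _]; last by rewrite liftK.
      by rewrite /c subrK.
    by rewrite subrr.
  rewrite leq_eqVlt => /predU1P[<-|nk]; first by rewrite coefB bE !lead subrr.
  by rewrite coefB bE !nth_default ?subrr// sz.
have dn : (size d <= n)%N.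
  apply: (leq_trans (size_sum _ _ _)); apply/bigmax_leqP => i _.
  rewrite mul_polyC (leq_trans (size_scale_leq _ _))//.
  have := sz _ y; rewrite (bigD1 i)//= size_monicM ?monicXsubC//.
    by rewrite size_XsubC add2n /= => -[->].
  by apply/prodf_neq0 => k _; rewrite polyXsubC_eq0.
apply/eqP; rewrite -subr_eq0; apply/eqP; set p := (a - _).
have ps : (size p <= n)%N.
  rewrite /p opprD addrA (leq_trans (size_polyD _ _))// geq_max ab.
  by rewrite size_polyN.
apply: (@roots_geq_poly_eq0 _ _ [seq y i | i : 'I_n]).
- apply/allP => _ /mapP[i _ ->]; apply/eqP.
  have dE : d.[y i] = \prod_j (y i - x j).
    rewrite /d horner_sum (bigD1 i)//= [X in _ + X]big1 ?addr0 => [|k ki]; last first.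
      rewrite hornerM.
      have -> : (\prod_(l | l != k) ('X - (y l)%:P)).[y i] =
          (y i - y i) * \prod_(l | (l != k) && (l != i)) (y i - y l).
        rewrite horner_prod (bigD1 i) 1?eq_sym//= hornerXsubC; congr (_ * _).
        by apply: eq_bigr => l _; rewrite hornerXsubC.
      by rewrite subrr mul0r mulr0.
    rewrite hornerM hornerC horner_prod.
    under [X in _ / _ * X]eq_bigr do rewrite hornerXsubC.
    rewrite divfK//; apply/prodf_neq0 => k ki.
    by rewrite subr_eq0 (inj_eq yI) eq_sym.
  have bi : b.[y i] = 0.
    rewrite /b hornerM [X in _ * X]horner_prod (bigD1 i)//=.
    by rewrite (hornerXsubC (y i) (y i)) subrr mul0r mulr0.
  have aE : a.[y i] = \prod_j (y i - x j).
    by rewrite /a horner_prod; apply: eq_bigr => j _; rewrite hornerXsubC.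
  by rewrite /p hornerD hornerN hornerD dE bi aE add0r subrr.
- by rewrite map_inj_uniq ?enum_uniq.
- by rewrite size_map size_enum_ord.
Qed.

End Border.

HB.lock Definition bordered (R : realType) n (B : 'M[R[i]]_n) (b : 'cV[R[i]]_n) (c : R[i]) :
    'M[R[i]]_n.+1 :=
  (proj n)^t* *m B *m proj n + (proj n)^t* *m b *m (elast n)^t*
  + elast n *m b^t* *m proj n + c *: (elast n *m (elast n)^t*).

(** The block diagonal matrix [diag(Z, w)]. *)
HB.lock Definition blk (R : realType) n (Z : 'M[R[i]]_n) (w : R[i]) : 'M[R[i]]_n.+1 :=
  (proj n)^t* *m Z *m proj n + w *: (elast n *m (elast n)^t*).

Section Bordered.
Variable R : realType.
Local Notation C := R[i].

Lemma border_ext n p (M N : 'M[C]_(n.+1, p)) :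
  proj n *m M = proj n *m N -> (elast n)^t* *m M = (elast n)^t* *m N -> M = N.
Proof.
move=> h1 h2; rewrite -[M]mul1mx -[N]mul1mx -(proj_split R n) !mulmxDl.
by rewrite -!(mulmxA _ (proj n)) -!(mulmxA _ ((elast n)^t*)) h1 h2.
Qed.

Lemma proj_bordered n (B : 'M[C]_n) b c :
  proj n *m bordered B b c = B *m proj n + b *m (elast n)^t*.
Proof.
rewrite bordered.unlock !mulmxDr -scalemxAr !mulmxA projKV !mul1mx proj_elast !mul0mx.
by rewrite scaler0 !addr0.
Qed.

Lemma elast_bordered n (B : 'M[C]_n) b c :
  (elast n)^t* *m bordered B b c = b^t* *m proj n + c *: (elast n)^t*.
Proof.
rewrite bordered.unlock !mulmxDr -scalemxAr !mulmxA elast_projC !mul0mx elastC !mul1mx.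
by rewrite !add0r.
Qed.

Lemma top_bordered n (B : 'M[C]_n) b c : top (bordered B b c) = B.
Proof.
rewrite top.unlock proj_bordered mulmxDl -!mulmxA projKV mulmx1.
by rewrite elast_projC mulmx0 addr0.
Qed.

Lemma border_bordered n (B : 'M[C]_n) b c : border (bordered B b c) = b.
Proof.
by rewrite border.unlock proj_bordered mulmxDl -!mulmxA proj_elast elastC mulmx1 mulmx0 add0r.
Qed.

Lemma tr_bordered n (B : 'M[C]_n) b c : \tr (bordered B b c) = \tr B + c.
Proof.
rewrite bordered.unlock !linearD linearZ /=.
rewrite -!(mulmxA ((proj n)^t*)) -!(mulmxA (elast n)).
rewrite !(mxtrace_mulC ((proj n)^t*)) !(mxtrace_mulC (elast n)).
rewrite -!mulmxA projKV mulmx1 elast_projC proj_elast !mulmx0 mxtrace0.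
by rewrite elastC mxtrace1 mxtrace0 mulr1 !addr0.
Qed.

Lemma adjmx_sum4 n (X Y Z W : 'M[C]_n) c : X^t* = X -> Y^t* = Z -> Z^t* = Y -> W^t* = W ->
  Num.conj c = c -> (X + Y + Z + c *: W)^t* = X + Y + Z + c *: W.
Proof.
by move=> XE YE ZE WE cE; rewrite !adjmxD adjmxZ cE XE YE ZE WE (addrAC X).
Qed.

Lemma bordered_herm n (B : 'M[C]_n) b c : B^t* = B -> Num.conj c = c ->
  (bordered B b c)^t* = bordered B b c.
Proof.
move=> BE cE; rewrite bordered.unlock.
have E1 : ((proj n)^t* *m B *m proj n)^t* = (proj n)^t* *m B *m proj n.
  by rewrite adjmxM adjmxM trmxCK BE mulmxA.
have E2 : ((proj n)^t* *m b *m (elast n)^t*)^t* = elast n *m b^t* *m proj n.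
  by rewrite adjmxM adjmxM !trmxCK mulmxA.
have E3 : (elast n *m b^t* *m proj n)^t* = (proj n)^t* *m b *m (elast n)^t*.
  by rewrite -E2 trmxCK.
have E4 : (elast n *m (elast n)^t*)^t* = elast n *m (elast n)^t* :> 'M[C]_n.+1.
  by rewrite adjmxM trmxCK.
exact: (adjmx_sum4 E1 E2 E3 E4 cE).
Qed.

Lemma borderedK n (A : 'M[C]_n.+1) : A^t* = A ->
  bordered (top A) (border A) (\tr A - \tr (top A)) = A.
Proof.
move=> AE; apply: border_ext.
  by rewrite proj_bordered proj_mulA.
by rewrite elast_bordered elast_mulA.
Qed.

Lemma herm_tr n (A : 'M[C]_n) : A^t* = A -> Num.conj (\tr A) = \tr A.
Proof.
move=> AE; rewrite -{2}AE /mxtrace rmorph_sum /=.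
by apply: eq_bigr => i _; rewrite !mxE.
Qed.

Lemma proj_blk n (Z : 'M[C]_n) w : proj n *m blk Z w = Z *m proj n.
Proof.
rewrite blk.unlock mulmxDr -scalemxAr !mulmxA projKV mul1mx proj_elast !mul0mx.
by rewrite scaler0 addr0.
Qed.

Lemma elast_blk n (Z : 'M[C]_n) w : (elast n)^t* *m blk Z w = w *: (elast n)^t*.
Proof.
rewrite blk.unlock mulmxDr -scalemxAr !mulmxA elast_projC !mul0mx elastC mul1mx.
by rewrite add0r.
Qed.

Lemma blkM n (Z Y : 'M[C]_n) w v : blk Z w *m blk Y v = blk (Z *m Y) (w * v).
Proof.
apply: border_ext; rewrite mulmxA.
  by rewrite !proj_blk -mulmxA proj_blk mulmxA.
by rewrite !elast_blk -scalemxAl elast_blk scalerA.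
Qed.

Lemma blk1 n : blk 1%:M 1 = 1%:M :> 'M[C]_n.+1.
Proof. by rewrite blk.unlock mulmx1 scale1r proj_split. Qed.

Lemma blk_adj n (Z : 'M[C]_n) w : (blk Z w)^t* = blk (Z^t*) (Num.conj w).
Proof. by rewrite blk.unlock adjmxD adjmxZ !adjmxM !trmxCK mulmxA. Qed.

Lemma blk_conj n (Z : 'M[C]_n) w (A : 'M[C]_n.+1) :
  top (blk Z w *m A *m (blk Z w)^t*) = Z *m top A *m Z^t* /\
  border (blk Z w *m A *m (blk Z w)^t*) = Num.conj w *: (Z *m border A).
Proof.
have h1 : (blk Z w)^t* *m (proj n)^t* = (proj n)^t* *m Z^t*.
  by rewrite -adjmxM proj_blk adjmxM.
have h2 : (blk Z w)^t* *m elast n = Num.conj w *: elast n.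
  by rewrite -{1}[elast n]trmxCK -adjmxM elast_blk adjmxZ trmxCK.
rewrite top.unlock border.unlock !mulmxA proj_blk -!mulmxA h1 h2.
by rewrite -!scalemxAr !mulmxA.
Qed.

Lemma blk_unitary n (Z : 'M[C]_n) w : Z \is unitarymx -> `|w| = 1 -> blk Z w \is unitarymx.
Proof.
move=> Zu w1; apply/unitarymxP; rewrite blk_adj blkM (unitarymxP Zu) -normCK w1 expr1n.
exact: blk1.
Qed.

Lemma blk_bordered n (Z B : 'M[C]_n) w b c : `|w| = 1 ->
  blk Z w *m bordered B b c *m (blk Z w)^t* =
  bordered (Z *m B *m Z^t*) (Num.conj w *: (Z *m b)) c.
Proof.
move=> w1; rewrite blk_adj; apply: border_ext; rewrite !mulmxA.
  rewrite proj_blk -!mulmxA (mulmxA (proj n)) proj_bordered mulmxDl -!mulmxA.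
  rewrite proj_blk elast_blk proj_bordered -!scalemxAr mulmxDr !mulmxA.
  by rewrite -scalemxAr -scalemxAl mulmxA.
rewrite elast_blk -!scalemxAl elast_bordered mulmxDl -!mulmxA proj_blk -!scalemxAl elast_blk.
rewrite elast_bordered scalerDr adjmxZ conjCK adjmxM -!scalemxAl !scalerA !mulmxA.
congr (_ + _ *: _).
by rewrite mulrAC mulrC -normCK w1 expr1n mulr1.
Qed.

End Bordered.

(** * The inductive step *)

(** At an eigenvalue of the corner, its square relates the secular equation of [A] to that of
    the exponentials: see [bfac_sq_diag] and [exp_secular]. *)
Definition bfac (R : realType) m n (A : 'M[R[i]]_m) (B : 'M[R[i]]_n) (s : R) : R :=
  expR ((lsum A s + s - lsum B s) / 2).

(** The solution of the Sylvester equation [sylv_eq]. *)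
HB.lock Definition sylv (R : realType) n (A : 'M[R[i]]_n.+1) : 'M[R[i]]_(n, n.+1) :=
  fc2 (fun y x => (expdd y x)^-1) (top A) A (proj n).

HB.lock Definition wfac (R : realType) n (A : 'M[R[i]]_n.+1) : 'M[R[i]]_n :=
  fc (bfac A (top A)) (top A).

(** The conjugate of [fc expR A] to be constructed: its corner is the exponential of the
    corner of [A], and [wfac] makes its spectrum that of [fc expR A]. *)
Definition twist (R : realType) n (A : 'M[R[i]]_n.+1) : 'M[R[i]]_n.+1 :=
  bordered (fc expR (top A)) (wfac A *m border A) (\tr (fc expR A) - \tr (fc expR (top A))).

(** It intertwines [fc expR A] and [twist A] ([pretwist_intertwine]), but is not unitary. *)
HB.lock Definition pretwist (R : realType) n (A : 'M[R[i]]_n.+1) : 'M[R[i]]_n.+1 :=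
  (proj n)^t* *m wfac A *m sylv A + elast n *m (elast n)^t*.

Section Step.
Variable R : realType.
Local Notation C := R[i].

Lemma bfac_gt0 m n (A : 'M[C]_m) (B : 'M[C]_n) s : 0 < bfac A B s.
Proof. exact: expR_gt0. Qed.

Lemma bfac_sq m n (A : 'M[C]_m) (B : 'M[C]_n) s :
  bfac A B s ^+ 2 * \prod_k expdd s (lam B k) = (\prod_j expdd s (lam A j)) * expR s.
Proof.
rewrite -!lsum_exp /bfac expr2 -!expRD; congr expR; lra.
Qed.

(** The factor [expR s] in [bfac_sq] is [expdd s s], the missing term of the product. *)
Lemma bfac_sq_diag m n (A : 'M[C]_m) (B : 'M[C]_n) i :
  bfac A B (lam B i) ^+ 2 * \prod_(k | k != i) expdd (lam B i) (lam B k) =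
  \prod_j expdd (lam B i) (lam A j).
Proof.
have := bfac_sq A B (lam B i); rewrite (bigD1 i)//= expdd_diag mulrCA [RHS]mulrC.
by move/(mulfI (lt0r_neq0 (expR_gt0 _))).
Qed.

Lemma fc_bfac_unit m n (A : 'M[C]_m) (B : 'M[C]_n) : B^t* = B -> fc (bfac A B) B \in unitmx.
Proof. by move=> BE; apply: (fc_unit BE _).1 => i; rewrite lt0r_neq0// bfac_gt0. Qed.

Lemma bfac_eq m m' n n' (A : 'M[C]_m) (A' : 'M[C]_m') (B : 'M[C]_n) (B' : 'M[C]_n') s :
  lsum A s = lsum A' s -> lsum B s = lsum B' s -> bfac A B s = bfac A' B' s.
Proof. by rewrite /bfac => -> ->. Qed.

Lemma lsum_lam n (A A' : 'M[C]_n) s : lam A = lam A' -> lsum A s = lsum A' s.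
Proof. by rewrite /lsum => ->. Qed.

Definition strictly_interlaced n (A : 'M[C]_n.+1) := forall i,
  lam A (widen_ord (leqnSn n) i) < lam (top A) i /\
  lam (top A) i < lam A (lift ord0 i).

Section Interlaced.
Variables (n : nat) (A : 'M[C]_n.+1).
Hypothesis Ai : strictly_interlaced A.

Lemma interlaced_neq i j : lam (top A) i != lam A j.
Proof.
have [h1 h2] := Ai i; case: (leqP j i) => ji.
  rewrite gt_eqF// (le_lt_trans _ h1)// lam_le//.
by rewrite lt_eqF// (lt_le_trans h2)// lam_le.
Qed.

Lemma interlaced_lt (i k : 'I_n) : (i < k)%N -> lam (top A) i < lam (top A) k.
Proof.
move=> ik; have [_ h1] := Ai i; have [h2 _] := Ai k.
by rewrite (lt_le_trans h1)// (le_trans _ (ltW h2))// lam_le.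
Qed.

Lemma interlaced_inj : injective (lam (top A)).
Proof.
move=> i k ik; apply/val_inj/eqP; case: ltngtP => // /interlaced_lt.
  by rewrite ik ltxx.
by rewrite ik ltxx.
Qed.

End Interlaced.

Lemma sylv_fc2 n (A : 'M[C]_n.+1) : A^t* = A -> fc2 (@expdd R) (top A) A (sylv A) = proj n.
Proof.
move=> AE; have BE := top_herm AE.
rewrite sylv.unlock fc2_comp// (@fc2_ext _ _ (fun _ _ => 1)) ?fc2_cst ?scale1r// => i j.
by rewrite mulfV// expdd_neq0.
Qed.

Lemma sylv_eq n (A : 'M[C]_n.+1) : A^t* = A ->
  sylv A *m fc expR A = fc expR (top A) *m sylv A + border A *m (elast n)^t*.
Proof.
move=> AE; have BE := top_herm AE.
have := fc2_divdiff BE AE (sylv A) (@expdd_eq R).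
rewrite sylv_fc2// proj_mulA opprD addrA subrr add0r => /eqP.
rewrite eq_sym subr_eq addrC => /eqP ->.
by rewrite subrK.
Qed.

Lemma proj_pretwist n (A : 'M[C]_n.+1) : proj n *m pretwist A = wfac A *m sylv A.
Proof.
by rewrite pretwist.unlock mulmxDr !mulmxA projKV mul1mx proj_elast mul0mx addr0.
Qed.

Lemma elast_pretwist n (A : 'M[C]_n.+1) : (elast n)^t* *m pretwist A = (elast n)^t*.
Proof.
by rewrite pretwist.unlock mulmxDr !mulmxA elast_projC !mul0mx add0r elastC mul1mx.
Qed.

Lemma fc_trace n (A : 'M[C]_n) h : A^t* = A -> \tr (fc h A) = (\sum_i h (lam A i))%:C.
Proof.
move=> AE; rewrite fc.unlock mxtrace_mulC mulmxA eigbasisKV// mul1mx mxtrace_diag.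
by rewrite raddf_sum; apply: eq_bigr => i _; rewrite mxE.
Qed.

Lemma eig_row_fc n (A : 'M[C]_n) h p (Z : 'M[C]_(n, p)) i j : A^t* = A ->
  (eigbasis A *m (fc h A *m Z)) i j = (h (lam A i))%:C * (eigbasis A *m Z) i j.
Proof.
move=> AE; rewrite mulmxA fc.unlock !mulmxA eigbasisKV// mul1mx -mulmxA.
by rewrite mul_diag_mx mxE [X in X * _]mxE.
Qed.

(** The right hand side is that of the secular equation with [wfac] applied to the border. *)
Lemma exp_secular n (A : 'M[C]_n.+1) i : A^t* = A ->
  \prod_j (expR (lam (top A) i) - expR (lam A j)) =
  - (bfac A (top A) (lam (top A) i) ^+ 2 *
     abs2 ((eigbasis (top A) *m border A) i 0)) *
    \prod_(k | k != i) (expR (lam (top A) i) - expR (lam (top A) k)).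
Proof.
move=> AE; set y := lam (top A); set f := bfac _ _ _.
have fE := bfac_sq_diag A (top A) i; rewrite -/y -/f in fE.
transitivity ((\prod_j expdd (y i) (lam A j)) * \prod_j (y i - lam A j)).
  by rewrite -big_split /=; apply: eq_bigr => j _; rewrite expdd_eq.
rewrite -fE secular_eq// -/y.
rewrite [in RHS](eq_bigr (fun k => expdd (y i) (y k) * (y i - y k))) => [|k _]; last first.
  by rewrite expdd_eq.
by rewrite big_split/=; ring.
Qed.

(** Interpolation of [exp_secular] at an eigenvalue of [A]: the eigenvector equation for
    the last row of [twist A]. *)
Lemma exp_interpolation n (A : 'M[C]_n.+1) j : A^t* = A -> strictly_interlaced A ->
  expR (lam A j) - (\sum_l expR (lam A l) - \sum_i expR (lam (top A) i)) =
  \sum_i bfac A (top A) (lam (top A) i) ^+ 2 *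
     abs2 ((eigbasis (top A) *m border A) i 0) /
     (expR (lam A j) - expR (lam (top A) i)).
Proof.
move=> AE Ai; set y := fun i => expR (lam (top A) i); set x := fun l => expR (lam A l).
pose c := \sum_l x l - \sum_i y i; pose r i := bfac A (top A) (lam (top A) i) ^+ 2 *
     abs2 ((eigbasis (top A) *m border A) i 0).
have yI : injective y by move=> a b /expR_inj; exact: interlaced_inj.
have xy i : x j - y i != 0.
  by rewrite subr_eq0 eq_sym (inj_eq (@expR_inj R)) interlaced_neq.
have := congr1 (horner^~ (x j)) (lagrange_monic x yI).
rewrite hornerD hornerM horner_sum !hornerXsubC -/c.
have -> : (\prod_j ('X - (x j)%:P)).[x j] = 0.
  by rewrite horner_prod (bigD1 j)//= (hornerXsubC (x j) (x j)) subrr mul0r.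
set P := (\prod_i ('X - (y i)%:P)).[x j].
have P0 : P != 0.
  rewrite /P horner_prod; apply/prodf_neq0 => i _.
  by rewrite hornerXsubC.
have termE i : (((\prod_j (y i - x j)) / \prod_(k | k != i) (y i - y k))%:P *
     \prod_(k | k != i) ('X - (y k)%:P)).[x j] = - (r i / (x j - y i)) * P.
  rewrite hornerM hornerC {1}/y {1}/x exp_secular// -/(r i) -/y.
  have q0 : \prod_(k | k != i) (y i - y k) != 0.
    by apply/prodf_neq0 => k ki; rewrite subr_eq0 (inj_eq yI) eq_sym.
  have -> : P = (x j - y i) * (\prod_(k | k != i) ('X - (y k)%:P)).[x j].
    by rewrite /P !horner_prod (bigD1 i)//= hornerXsubC.
  rewrite -[X in X / _ * _]/(- r i * \prod_(k | k != i) (y i - y k)) mulfK//.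
  rewrite !mulNr; congr (- _); rewrite mulrA divfK//.
under eq_bigr do rewrite termE.
rewrite -mulr_suml -mulrDl => /esym/eqP; rewrite mulf_eq0 (negPf P0) orbF.
by rewrite sumrN subr_eq0 => /eqP.
Qed.

Lemma sylv_comp n (A : 'M[C]_n.+1) (v : 'cV[C]_n.+1) x i : A^t* = A ->
  A *m v = x%:C *: v ->
  (expR x - expR (lam (top A) i))%:C * (eigbasis (top A) *m (sylv A *m v)) i 0 =
  (eigbasis (top A) *m border A) i 0 * ((elast n)^t* *m v) 0 0.
Proof.
move=> AE vx; have BE := top_herm AE.
have := congr1 (mulmx^~ v) (sylv_eq AE).
rewrite -mulmxA (fc_eig AE expR vx) -scalemxAr mulmxDl -!mulmxA.
move=> /(congr1 (mulmx (eigbasis (top A))))/colP/(_ i).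
rewrite mulmxDr -scalemxAr [LHS]mxE [RHS]mxE eig_row_fc// => e.
rewrite rmorphB mulrBl e addrAC subrr add0r mulmxA mxE big_ord1.
by [].
Qed.

(** On an eigenvector of [A], with the components of [sylv A] given by [sylv_comp], this
    is [exp_interpolation]. *)
Lemma twist_last_row n (A : 'M[C]_n.+1) : A^t* = A -> strictly_interlaced A ->
  (wfac A *m border A)^t* *m (wfac A *m sylv A)
   + (\tr (fc expR A) - \tr (fc expR (top A))) *: (elast n)^t* =
  (elast n)^t* *m fc expR A.
Proof.
move=> AE Ai; have BE := top_herm AE; apply: (eig_ext AE) => v x vx.
have [->|v0] := eqVneq v 0; first by rewrite !mulmx0.
have [j xj] := eigenvector_lam AE v0 vx.
rewrite mulmxDl -scalemxAl -[in RHS]mulmxA (fc_eig AE expR vx) -scalemxAr.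
set vl := (elast n)^t* *m v; apply/matrixP => a b; rewrite !ord1 [RHS]mxE [LHS]mxE [X in _ + X = _]mxE.
rewrite !fc_trace// -rmorphB.
have -> : (expR x)%:C * vl 0 0 = ((expR (lam A j) -
     (\sum_l expR (lam A l) - \sum_i expR (lam (top A) i)))%:C
   + (\sum_l expR (lam A l) - \sum_i expR (lam (top A) i))%:C) * vl 0 0.
  by rewrite -rmorphD subrK xj.
rewrite mulrDl; congr (_ + _); rewrite exp_interpolation//.
have -> : (wfac A *m border A)^t* *m (wfac A *m sylv A) *m v =
   (eigbasis (top A) *m (wfac A *m border A))^t* *m
   (eigbasis (top A) *m (wfac A *m (sylv A *m v))).
  rewrite [in RHS]adjmxM -[RHS]mulmxA (mulmxA ((eigbasis _)^t*)) eigbasisVK//.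
  by rewrite mul1mx !mulmxA.
rewrite mxE raddf_sum mulr_suml; apply: eq_bigr => i _.
rewrite [X in X * _](_ : _ = Num.conj ((eigbasis (top A) *m (wfac A *m border A)) i 0)); last first.
  by rewrite !mxE.
rewrite wfac.unlock !eig_row_fc// xj.
have d0 : (expR x - expR (lam (top A) i))%:C != 0.
  rewrite (inj_eq (@complexI _)) subr_eq0 eq_sym (inj_eq (@expR_inj R)) -xj.
  exact: interlaced_neq.
have := sylv_comp i AE vx; rewrite -/vl => h.
apply: (mulfI d0); rewrite rmorphM/= conjC_real.
set be := (eigbasis (top A) *m border A) i 0 in h *.
set f := bfac _ _ _; set s := (_ *m (sylv A *m v)) i 0 in h *.
transitivity (f%:C ^+ 2 * Num.conj be * ((expR x - expR (lam (top A) i))%:C * s)); first by ring.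
rewrite h rmorphM rmorphM/= -abs2E fmorphV rmorphXn/=.
rewrite [RHS](_ : _ = f%:C ^+ 2 * (Num.conj be * be) * vl 0 0 *
  ((expR x - expR (lam (top A) i))%:C / (expR x - expR (lam (top A) i))%:C)); last by ring.
by rewrite divff//; ring.
Qed.

(** The first rows are the Sylvester equation, the last row is [twist_last_row]. *)
Lemma pretwist_intertwine_strict n (A : 'M[C]_n.+1) :
  A^t* = A -> strictly_interlaced A ->
  pretwist A *m fc expR A = twist A *m pretwist A.
Proof.
move=> AE Ai; have BE := top_herm AE.
have E1 : proj n *m (pretwist A *m fc expR A) = proj n *m (twist A *m pretwist A).
  rewrite !mulmxA proj_pretwist proj_bordered mulmxDl -!mulmxA proj_pretwist.
  rewrite elast_pretwist sylv_eq// mulmxDr; congr (_ + _).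
  rewrite !mulmxA wfac.unlock !fcM//; congr (_ *m _).
  by apply: fc_ext => i; rewrite mulrC.
have E2 : (elast n)^t* *m (pretwist A *m fc expR A) =
    (elast n)^t* *m (twist A *m pretwist A).
  rewrite !mulmxA elast_pretwist elast_bordered mulmxDl -mulmxA proj_pretwist.
  by rewrite -scalemxAl elast_pretwist twist_last_row.
exact: border_ext.
Qed.

End Step.

(** * Generic Hermitian matrices are dense *)

Section Density.
Variable R : realType.
Local Notation C := R[i].

Lemma lam_injP n (A : 'M[C]_n.+1) : strictly_interlaced A -> injective (lam A).
Proof.
have lt (i j : 'I_n.+1) : strictly_interlaced A -> (i < j)%N -> lam A i < lam A j.
  move=> Ai ij; have i_n : (i < n)%N by rewrite (leq_trans ij)// -ltnS.
  have [h1 h2] := Ai (Ordinal i_n); rewrite (_ : i = widen_ord (leqnSn n) (Ordinal i_n)).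
    by rewrite (lt_le_trans (lt_trans h1 h2))// lam_le.
  exact: val_inj.
move=> Ai i j ij; apply/val_inj/eqP; case: ltngtP => // /(lt _ _ Ai).
  by rewrite ij ltxx.
by rewrite ij ltxx.
Qed.

(** The condition that defines Herm_0, by induction on the size; see [Herm0P]. *)
Fixpoint interlaced_chain n : 'M[C]_n -> Prop :=
  if n is n.+1 then fun A => strictly_interlaced A /\ interlaced_chain (top A)
  else fun=> True.

Lemma chain_inj n (A : 'M[C]_n) : interlaced_chain A -> injective (lam A).
Proof. by case: n A => [|n] A; [move=> _ [] | case=> /lam_injP]. Qed.

(** Weak interlacing always holds, and by the secular equation an eigenvalue of the corner
    is one of [A] exactly when a coordinate of the border vanishes. *)
Lemma strictP n (A : 'M[C]_n.+1) : A^t* = A -> injective (lam (top A)) ->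
  (strictly_interlaced A <-> forall i, (eigbasis (top A) *m border A) i 0 != 0).
Proof.
move=> AE Bi; split=> [Ai i|b0 i].
  have := secular_eq i AE => /eqP; apply: contraTN => /eqP ->.
  have -> : abs2 (0 : C) = 0 by apply/eqP; rewrite abs2_eq0.
  rewrite oppr0 mul0r; apply/prodf_neq0 => j _.
  by rewrite subr_eq0 interlaced_neq.
have ne j : lam (top A) i != lam A j.
  have : \prod_j (lam (top A) i - lam A j) != 0.
    rewrite secular_eq// mulf_neq0// ?oppr_eq0 ?abs2_eq0//; apply/prodf_neq0 => k ki.
    by rewrite subr_eq0 (inj_eq Bi) eq_sym.
  by move/prodf_neq0 => /(_ j isT); rewrite subr_eq0.
have [||h1 h2] := lam_interlace (B := top A) (S := (proj n)^t*) i AE.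
- by rewrite trmxCK projKV.
- by rewrite trmxCK top.unlock.
by rewrite !lt_neqAle h1 h2 ne eq_sym ne.
Qed.

Lemma abs1D m n (X Y : 'M[C]_(m, n)) : abs1 (X + Y) <= abs1 X + abs1 Y.
Proof.
rewrite -big_split; apply: ler_sum => i _; rewrite -big_split; apply: ler_sum => j _.
by rewrite mxE sqrt_abs2D.
Qed.

Lemma abs1Z m n (t : R) (X : 'M[C]_(m, n)) : abs1 (t%:C *: X) = `|t| * abs1 X.
Proof.
rewrite mulr_sumr; apply: eq_bigr => i _; rewrite mulr_sumr; apply: eq_bigr => j _.
by rewrite mxE sqrt_abs2M {1}/abs2 /= expr0n addr0 sqrtr_sqr.
Qed.

Lemma abs1_adj m n (X : 'M[C]_(m, n)) : abs1 (X^t*) = abs1 X.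
Proof.
rewrite /abs1 exchange_big; apply: eq_bigr => i _; apply: eq_bigr => j _.
by rewrite !mxE; case: (X i j) => a b; rewrite /abs2 /= sqrrN.
Qed.

Lemma abs1_projC n p (X : 'M[C]_(n, p)) : abs1 ((proj n)^t* *m X) = abs1 X.
Proof.
rewrite /abs1 big_ord_recr /= [X in _ + X]big1 ?addr0 => [|j _].
  apply: eq_bigr => i _; apply: eq_bigr => j _; rewrite -proj_mul mulmxA projKV.
  by rewrite mul1mx.
rewrite mxE big1 => [|k _].
  by apply/eqP; rewrite sqrtr_eq0 /abs2 /= expr0n /= addr0.
rewrite !mxE projE (_ : ord_max == _ = false) ?conjC0 ?mul0r//.
by apply/negbTE; rewrite -val_eqE /= gtn_eqF.
Qed.

Lemma abs1_elast n p (X : 'M[C]_(1, p)) : abs1 (elast n *m X) = abs1 X.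
Proof.
rewrite /abs1 big_ord_recr /= big_ord1 big1 ?add0r => [|i _].
  by apply: eq_bigr => j _; rewrite mxE big_ord1 elastE eqxx mul1r.
apply: big1 => j _; rewrite mxE big_ord1 elastE (_ : _ == ord_max = false) ?mul0r.
  by apply/eqP; rewrite sqrtr_eq0 /abs2 /= expr0n /= addr0.
by apply/negbTE; rewrite -val_eqE /= ltn_eqF.
Qed.

Lemma abs1_bordered n (B B' : 'M[C]_n) b b' c :
  abs1 (bordered B b c - bordered B' b' c) <= abs1 (B - B') + (abs1 (b - b') + abs1 (b - b')).
Proof.
have -> : bordered B b c - bordered B' b' c = bordered (B - B') (b - b') 0.
  apply: border_ext; rewrite mulmxBr.
    by rewrite !proj_bordered !mulmxBl opprD addrACA.
  by rewrite !elast_bordered adjmxB mulmxBl scale0r opprD addrACA subrr addr0.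
rewrite bordered.unlock scale0r addr0 -!mulmxA -addrA.
have adjP p q r (X : 'M[C]_(p, q)) (Y : 'M[C]_(q, r)) : abs1 (X *m Y) = abs1 (Y^t* *m X^t*).
  by rewrite -adjmxM abs1_adj.
rewrite (le_trans (abs1D _ _))// lerD// ?abs1_projC.
  by rewrite adjP abs1_projC abs1_adj.
rewrite (le_trans (abs1D _ _))// lerD//.
  by rewrite abs1_projC adjP trmxCK abs1_elast abs1_adj.
by rewrite abs1_elast adjP trmxCK abs1_projC.
Qed.

Lemma avoid_values (s : seq R) (e : R) : 0 < e ->
  exists2 d, 0 < d <= e & forall t, 0 < t < d -> t \notin s.
Proof.
move=> e0; elim: s => [|a s [d /andP[d0 de] IH]]; first by exists e; rewrite ?e0 ?lexx.
have [a0|a0] := leP a 0.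
  exists d; rewrite ?d0// => t /andP[t0 td]; rewrite inE negb_or IH ?t0// andbT.
  by rewrite gt_eqF// (le_lt_trans a0).
exists (Num.min d a); first by rewrite lt_min d0 a0 ge_min de.
move=> t; rewrite lt_min => /and3P[t0 td ta]; rewrite inE negb_or IH ?t0// andbT.
by rewrite lt_eqF.
Qed.

(** Perturb the corner by induction, then the border, so that it has no zero
    coordinate in the eigenbasis of the corner. *)
Lemma chain_dense n (A : 'M[C]_n) e : A^t* = A -> 0 < e ->
  exists A', [/\ A'^t* = A', interlaced_chain A' & abs1 (A' - A) < e].
Proof.
elim: n => [|n IH] in A e *.
  by move=> AE e0; exists A; split=> //; rewrite subrr /abs1 big_ord0.
move=> AE e0; have e20 : 0 < e / 2 by rewrite divr_gt0.
have [B [BE Bi Be]] := IH (top A) (e / 2) (top_herm AE) e20.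
(* all the coordinates of w in the eigenbasis of B are 1 *)
pose w := (eigbasis B)^t* *m const_mx 1 : 'cV[C]_n.
have K0 : 0 < abs1 w + abs1 w + 1 by rewrite ltr_wpDl ?addr_ge0 ?abs1_ge0.
set K := abs1 w + abs1 w + 1 in K0.
have e3 : 0 < e / 2 / K by rewrite divr_gt0.
have [d /andP[d0 de] ds] :=
  avoid_values [seq - complex.Re ((eigbasis B *m border A) i 0) | i : 'I_n] e3.
pose t := d / 2; have t0 : 0 < t by rewrite divr_gt0.
have td : t < d by rewrite /t; lra.
have cE : Num.conj (\tr A - \tr (top A)) = \tr A - \tr (top A).
  by rewrite rmorphB /= !herm_tr// top_herm.
exists (bordered B (border A + t%:C *: w) (\tr A - \tr (top A))).
split; first exact: bordered_herm.
  split; last by rewrite top_bordered.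
  apply/strictP; rewrite ?top_bordered; [exact: bordered_herm|exact: chain_inj|].
  move=> i; rewrite border_bordered mulmxDr -scalemxAr /w mulmxA eigbasisKV// mul1mx.
  rewrite mxE [X in _ + X]mxE [X in _ * X]mxE mulr1.
  have /negP h := ds t (introT andP (conj t0 td)); apply/eqP => /(congr1 (@complex.Re R)); rewrite ReD /= => /eqP.
  rewrite addrC addr_eq0 => /eqP h'; apply: h; apply/mapP; exists i.
    by rewrite mem_enum.
  by rewrite h'; congr (- complex.Re _); rewrite mxE.
rewrite -[X in _ - X](borderedK AE); apply: le_lt_trans (abs1_bordered _ _ _ _ _) _.
rewrite addrAC subrr add0r abs1Z gtr0_norm// -mulrDr.
have : t * (abs1 w + abs1 w) < e / 2.
  have : t * K < e / 2 by rewrite -ltr_pdivlMr// (lt_le_trans td).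
  apply: le_lt_trans; rewrite ler_pM2l// /K; lra.
move: Be; lra.
Qed.

End Density.

(** * The polar factor of the intertwiner *)

Lemma fcB (R : realType) n (A : 'M[R[i]]_n) g h : A^t* = A ->
  fc g A - fc h A = fc (fun x => g x - h x) A.
Proof.
move=> AE; rewrite -scaleN1r (_ : -1 = (-1)%:C); last by rewrite rmorphN1.
by rewrite fcZ// fcD//; apply: fc_ext => i; rewrite mulN1r.
Qed.

Section StepSmooth.
Variables (R : realType) (V : normedModType R) (D : set V) (k : nat).
Hypothesis oD : open D.
Local Notation C := R[i].

Lemma mC_top n (A : V -> 'M[C]_n.+1) : mC D k A -> mC D k (fun x => top (A x)).
Proof.
move=> Ak; rewrite top.unlock; apply: mCM => //; last exact: mC_cst.
by apply: mCM => //; exact: mC_cst.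
Qed.

Lemma mC_border n (A : V -> 'M[C]_n.+1) : mC D k A -> mC D k (fun x => border (A x)).
Proof.
move=> Ak; rewrite border.unlock; apply: mCM => //; last exact: mC_cst.
by apply: mCM => //; exact: mC_cst.
Qed.

Lemma mC_bordered n (B : V -> 'M[C]_n) b c : mC D k B -> mC D k b -> cC k D c ->
  mC D k (fun x => bordered (B x) (b x) (c x)).
Proof.
move=> Bk bk ck; rewrite bordered.unlock; apply: mCD => //; last first.
  by apply: mCZ => //; exact: mC_cst.
apply: mCD => //; last by do 2 (apply: mCM => //; try exact: mC_cst); exact: mC_adj.
by apply: mCD => //; do 2 (apply: mCM => //; try exact: mC_cst).
Qed.

Lemma mC_blk n (B : V -> 'M[C]_n) w : mC D k B -> mC D k (fun x => blk (B x) w).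
Proof.
move=> Bk; rewrite blk.unlock; apply: mCD => //; last exact: mC_cst.
by do 2 (apply: mCM => //; try exact: mC_cst).
Qed.

Lemma hermD_top n (A : V -> 'M[C]_n.+1) : hermD D A -> hermD D (fun x => top (A x)).
Proof. by move=> Ah x Dx; rewrite top_herm// Ah. Qed.

Lemma mC_fc_bfac m n (B : V -> 'M[C]_m) (A : V -> 'M[C]_n) : hermD D B -> hermD D A ->
  mC D k B -> mC D k A -> mC D k (fun x => fc (bfac (A x) (B x)) (B x)).
Proof.
move=> Bh Ah Bk Ak.
pose H x := (2^-1)%:C *: (fc (lsum (A x)) (B x) + B x - fc (lsum (B x)) (B x)).
have HE x : D x -> H x = fc (fun s => 2^-1 * (lsum (A x) s + s - lsum (B x) s)) (B x).
  move=> Dx; rewrite /H -[X in _ + X - _]fc_id ?Bh// fcD ?Bh//.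
  by rewrite fcB ?Bh// fcZ ?Bh.
apply: (mC_ext oD (F := fun x => fc expR (H x))).
  move=> x Dx; rewrite HE// fc_comp ?Bh//; apply: fc_ext => i.
  by rewrite /= /bfac mulrC.
apply: mC_fc_exp => //; first by move=> x Dx; rewrite HE// fc_herm// Bh.
apply: mCZ => //; first exact: cC_cst.
apply: mCD => //; last by apply: mCN => //; exact: mC_fc_lsum.
by apply: mCD => //; exact: mC_fc_lsum.
Qed.

Section Family.
Variables (n : nat) (A : V -> 'M[C]_n.+1).
Hypotheses (Ah : hermD D A) (Ak : mC D k A).

Lemma mC_wfac : mC D k (fun x => wfac (A x)).
Proof.
rewrite wfac.unlock.
by apply: mC_fc_bfac => //; [exact: hermD_top|exact: mC_top].
Qed.

Lemma mC_pretwist : mC D k (fun x => pretwist (A x)).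
Proof.
rewrite pretwist.unlock; apply: mCD => //; last exact: mC_cst.
apply: mCM => //; first by apply: mCM => //; [exact: mC_cst|exact: mC_wfac].
rewrite sylv.unlock; apply: mC_fc2_expddV => //; [exact: hermD_top|exact: mC_top|exact: mC_cst].
Qed.

Lemma mC_twist : mC D k (fun x => twist (A x)).
Proof.
have Bh := hermD_top Ah; have Bk := mC_top Ak.
have wk : mC D k (fun x => wfac (A x) *m border (A x)).
  by apply: mCM => //; [exact: mC_wfac|exact: mC_border].
apply: mC_bordered => //; first exact: mC_fc_exp.
by apply: cCD => //; [|apply: cCN => //]; apply: cC_trace => //; exact: mC_fc_exp.
Qed.

End Family.

End StepSmooth.

Section HermCoordinates.
Variables (R : realType) (n : nat).
Local Notation C := R[i].

Definition entry (i j : 'I_n) (X : 'M[R]_n) : R := X i j.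

Lemma entry_linear i j : linear (entry i j).
Proof. by move=> a X Y; rewrite /entry !mxE. Qed.
HB.instance Definition _ i j :=
  GRing.isLinear.Build R 'M[R]_n R _ (entry i j) (entry_linear i j).

Lemma class_C_entry k D i j : class_C k D (entry i j).
Proof. by apply: class_C_linear => X; exact: coord_continuous. Qed.

Lemma mC_hmat k D : open D -> mC D k (@hmat R n).
Proof.
move=> oD; apply: mC_matrix => i j; split=> /=.
  apply: class_CM => //; last exact: class_C_cst.
  by apply: class_CD => //; exact: class_C_entry.
apply: class_CM => //; last exact: class_C_cst.
by apply: class_CD => //; [|apply: class_CN => //]; exact: class_C_entry.
Qed.

Lemma hmat_herm X : (@hmat R n X)^t* = hmat X.
Proof. by apply/HermP; exact: hmat_Herm. Qed.

Lemma hcoord_ball (A : 'M[C]_n) X e : A^t* = A -> abs1 (A - hmat X) < e ->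
  ball X (e + e) (hcoord A).
Proof.
move=> AE Ae.
have e0 : 0 < e by rewrite (le_lt_trans _ Ae)// abs1_ge0.
have h i j : `|X i j - hcoord A i j| < e + e.
  rewrite distrC -{1}(hmatK X) /hcoord !mxE opprD addrACA.
  have := Re_le_sqrt ((A - hmat X) i j); have := Im_le_sqrt ((A - hmat X) i j).
  have := abs1_entry (A - hmat X) i j.
  rewrite mxE ReD ImD [(- hmat X) i j]mxE ReN ImN [hmat X i j]mxE /=.
  set a := _ - _; set b := _ - _ => h1 h2 h3.
  rewrite (le_lt_trans (ler_normD _ _))//; lra.
by split=> [|i j]; [rewrite addr_gt0|exact: h].
Qed.

(** By [chain_dense]. In this way identities proved for strictly interlaced spectra extend
    to all Hermitian matrices. *)
Lemma vanish_generic (D : set 'M[R]_n) (f : 'M[R]_n -> R) : open D -> class_C 0 D f ->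
  (forall X, D X -> interlaced_chain (hmat X) -> f X = 0) -> forall X, D X -> f X = 0.
Proof.
move=> oD fc fz X DX; apply/eqP; apply: contraT => fX.
have fX0 : 0 < `|f X| by rewrite normr_gt0.
have : \forall Y \near X, D Y /\ f Y != 0.
  near=> Y; split; first by near: Y; exact: open_nbhs_nbhs.
  have : `|f X - f Y| < `|f X|.
    by near: Y; move/cvgr_dist_lt: (fc _ DX); apply.
  by apply: contraTneq => ->; rewrite subr0 ltxx.
case/nbhs_ballP => e /= e0 He.
have e20 : 0 < e / 2 by rewrite divr_gt0.
have [A [AE Ai Ae]] := chain_dense (hmat_herm X) e20.
have := hcoord_ball AE Ae; rewrite -splitr => /He[DA]; rewrite fz ?eqxx//.
by rewrite hcoordK//; exact/HermP.
Unshelve. all: by end_near. Qed.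

Lemma mx_eq_generic m p (D : set 'M[R]_n) (F G : 'M[R]_n -> 'M[C]_(m, p)) : open D ->
  mC D 0 F -> mC D 0 G ->
  (forall X, D X -> interlaced_chain (hmat X) -> F X = G X) ->
  forall X, D X -> F X = G X.
Proof.
move=> oD Fc Gc FG X DX; apply/matrixP => i j; apply/eqP; rewrite -subr_eq0; apply/eqP.
have FGc : cC 0 D (fun X => F X i j - G X i j) by apply: cCD => //; exact: cCN.
have := vanish_generic oD FGc.1 _ DX; have := vanish_generic oD FGc.2 _ DX.
case: (_ - _) => a b /= -> => [->|Y DY Yi] => [//|Y DY Yi|]; by rewrite FG// subrr.
Qed.

End HermCoordinates.

Section Polar.
Variable R : realType.
Local Notation C := R[i].

Lemma pretwist_intertwine n (A : 'M[C]_n.+1) : A^t* = A ->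
  pretwist A *m fc expR A = twist A *m pretwist A.
Proof.
move=> AE; rewrite -(hcoordK (proj2 (HermP _) AE)); move: (hcoord A) (I : [set: 'M[R]_n.+1] (hcoord A)).
have hh D : hermD D (@hmat R n.+1) by move=> X _; exact: hmat_herm.
have oT := @openT 'M[R]_n.+1.
apply: mx_eq_generic => //.
- apply: mCM => //; first by apply: mC_pretwist => //; exact: mC_hmat.
  by apply: mC_fc_exp => //; exact: mC_hmat.
- by apply: mCM => //; [apply: mC_twist|apply: mC_pretwist] => //; exact: mC_hmat.
- by move=> X _ [Xi _]; apply: pretwist_intertwine_strict => //; exact: hmat_herm.
Qed.

(** [v] intertwines [A] with the matrix [x] of size one. *)
Lemma fc2_eigr K m n (B : 'M[C]_m) (A : 'M[C]_n) X (v : 'cV[C]_n) x :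
  B^t* = B -> A^t* = A -> A *m v = x%:C *: v -> X *m v = 0 -> fc2 K B A X *m v = 0.
Proof.
move=> BE AE vx Xv; rewrite -[fc2 _ _ _ _]mul1mx.
rewrite -(fc2_intertwine K (A' := x%:C%:M) (B' := B) X BE AE BE); last 3 first.
- by rewrite adjmx_scalar conjC_real.
- by rewrite mulmx1 mul1mx.
- by rewrite mul_mx_scalar vx.
rewrite mul1mx Xv fc2.unlock mulmx0 mul0mx [X in _ *m X *m _](_ : _ = 0) ?mulmx0 ?mul0mx//.
by apply/matrixP => i j; rewrite !mxE mulr0.
Qed.

Lemma twist_herm n (A : 'M[C]_n.+1) : A^t* = A -> (twist A)^t* = twist A.
Proof.
move=> AE; apply: bordered_herm; first by rewrite fc_herm// top_herm.
by rewrite rmorphB /= !herm_tr// fc_herm// top_herm.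
Qed.

(** The kernel of [pretwist A] is invariant under [fc expR A], so that it contains
    an eigenvector of [A] unless it is zero. *)
Lemma pretwist_inj n (A : 'M[C]_n.+1) (u : 'cV[C]_n.+1) : A^t* = A ->
  pretwist A *m u = 0 -> u = 0.
Proof.
move=> AE u0; have BE := top_herm AE.
rewrite -[u]mul1mx -(eigbasisVK AE) -mulmxA.
suff -> : eigbasis A *m u = 0 by rewrite mulmx0.
apply/matrixP => i j; rewrite ord1 {j} [RHS]mxE; apply/eqP; apply: contraT => ui.
(* v is the component of u in an eigenspace of A *)
pose x := lam A i; pose h s : R := (s == expR x)%:R.
pose v := fc h (fc expR A) *m u.
have v0 : pretwist A *m v = 0.
  have FE : (fc expR A)^t* = fc expR A by rewrite fc_herm.
  have := fc_intertwine h (twist_herm AE) FE (esym (pretwist_intertwine AE)).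
  by move/(congr1 (mulmx^~ u)); rewrite -!mulmxA u0 mulmx0 => <-.
have vE : v = fc (h \o expR) A *m u by rewrite /v fc_comp.
have vx : A *m v = x%:C *: v.
  rewrite vE -{1}(fc_id AE) mulmxA fcM// scalemxAl fcZ//; congr (_ *m _).
  apply: fc_ext => j; rewrite /= /h (inj_eq (@expR_inj R)).
  by case: eqP => [->//|_]; rewrite !mulr0.
have vi : (eigbasis A *m v) i 0 != 0.
  by rewrite vE eig_row_fc// /= /h eqxx mul1r.
have e0 : (elast n)^t* *m v = 0 by rewrite -(elast_pretwist A) -mulmxA v0 mulmx0.
have p0 : proj n *m v = 0.
  have wu : wfac A \in unitmx by rewrite wfac.unlock fc_bfac_unit.
  have s0 : sylv A *m v = 0.
    rewrite -(mulKmx wu (sylv A *m v)) [X in _ *m X]mulmxA -proj_pretwist.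
    by rewrite -mulmxA v0 !mulmx0.
  by rewrite -(sylv_fc2 AE); exact: (fc2_eigr _ BE AE vx s0).
have : v = 0 by apply: border_ext; rewrite ?p0 ?e0 mulmx0.
by move=> v00; rewrite v00 mulmx0 mxE eqxx in vi.
Qed.

Lemma pos_gram n (P : 'M[C]_n) : (forall u : 'cV_n, P *m u = 0 -> u = 0) ->
  pos (P^t* *m P).
Proof.
move=> Pi; apply/Herm_posP; split.
  by apply/HermP; rewrite adjmxM trmxCK.
move=> v v0; rewrite mulmxA -mulmxA -adjmxM norm2E ltcR norm2_gt0//.
by apply: contraNneq v0 => /Pi ->.
Qed.

Lemma pretwist_gram_pos n (A : 'M[C]_n.+1) : A^t* = A ->
  pos ((pretwist A)^t* *m pretwist A).
Proof. by move=> AE; apply: pos_gram => u; exact: pretwist_inj. Qed.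

End Polar.

Definition rsqrt (R : realType) (s : R) := expR (- 2^-1 * ln s).

(** The unitary factor of the polar decomposition of [pretwist A]. *)
HB.lock Definition polar (R : realType) n (A : 'M[R[i]]_n.+1) : 'M[R[i]]_n.+1 :=
  pretwist A *m fc (@rsqrt R) ((pretwist A)^t* *m pretwist A).

Section PolarFactor.
Variable R : realType.
Local Notation C := R[i].

Lemma rsqrt_sq (s : R) : 0 < s -> rsqrt s * (s * rsqrt s) = 1.
Proof.
move=> s0; rewrite mulrCA /rsqrt -expRD -{1}(lnK s0) -expRD -[RHS]expR0; congr expR; lra.
Qed.

Lemma polar_unitary n (A : 'M[C]_n.+1) : A^t* = A -> polar A \is unitarymx.
Proof.
move=> AE; have Wp := pretwist_gram_pos AE; apply: unitarymxI; rewrite polar.unlock.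
set W := _ *m pretwist A in Wp *; have WE := Wp.1.
rewrite adjmxM fc_herm// mulmxA -(mulmxA (fc _ _)) -/W -mulmxA -{2}(fc_id WE).
rewrite !fcM// -(@fc_cst R _ W 1 WE); apply: fc_ext => i.
by rewrite rsqrt_sq//; exact: Wp.2.
Qed.

(** The Gram matrix of [pretwist A] commutes with [fc expR A], hence so does its inverse
    square root. *)
Lemma polar_intertwine n (A : 'M[C]_n.+1) : A^t* = A ->
  polar A *m fc expR A = twist A *m polar A.
Proof.
move=> AE; rewrite polar.unlock; set W := _ *m pretwist A.
have WE : W^t* = W by rewrite adjmxM trmxCK.
have WM : W *m fc expR A = fc expR A *m W.
  rewrite -mulmxA pretwist_intertwine// mulmxA.
  have := congr1 (fun M : 'M[C]_n.+1 => M^t*) (pretwist_intertwine AE).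
  by rewrite /= !adjmxM fc_herm// twist_herm// => <-; rewrite mulmxA.
rewrite -mulmxA (fc_intertwine _ WE WE WM) mulmxA pretwist_intertwine//.
by rewrite mulmxA.
Qed.

Lemma mC_polar (V : normedModType R) (D : set V) k n (A : V -> 'M[C]_n.+1) : open D ->
  hermD D A -> mC D k A -> mC D k (fun x => polar (A x)).
Proof.
move=> oD Ah Ak; have Pk := mC_pretwist oD Ah Ak.
have Wk : mC D k (fun x => (pretwist (A x))^t* *m pretwist (A x)).
  by apply: mCM => //; exact: mC_adj.
have Wp x : D x -> pos ((pretwist (A x))^t* *m pretwist (A x)).
  by move=> Dx; apply: pretwist_gram_pos; exact: Ah.
have Lh x : D x -> ((- 2^-1)%:C *: fc (@ln R) ((pretwist (A x))^t* *m pretwist (A x)))^t*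
   = (- 2^-1)%:C *: fc (@ln R) ((pretwist (A x))^t* *m pretwist (A x)).
  by move=> Dx; rewrite hermZ// fc_herm//; case: (Wp _ Dx).
rewrite polar.unlock; apply: mCM => //.
apply: (mC_ext oD (F := fun x => fc expR ((- 2^-1)%:C *:
   fc (@ln R) ((pretwist (A x))^t* *m pretwist (A x))))).
  move=> x Dx; have WE := (Wp x Dx).1; rewrite fcZ// fc_comp//.
apply: mC_fc_exp => //.
by apply: mCZ => //; [exact: cC_cst|exact: mC_fc_ln].
Qed.

End PolarFactor.

(** * The map and its inverse *)

(** The product of the polar factors of all the corners. *)
Fixpoint psi (R : realType) n : 'M[R[i]]_n -> 'M[R[i]]_n :=
  if n is n.+1 then fun A => blk (psi (top A)) 1 *m polar A else fun=> 1%:M.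

(** The map of the theorem. *)
HB.lock Definition gzexp (R : realType) n (A : 'M[R[i]]_n) : 'M[R[i]]_n :=
  psi A *m fc expR A *m (psi A)^t*.

(** The inverse of [gzexp]: [L] has the spectrum of the preimage, which together with the
    corner [B] of the preimage determines the factor by which the border was multiplied. *)
Fixpoint gzlog (R : realType) n : 'M[R[i]]_n -> 'M[R[i]]_n :=
  if n is n.+1 then fun P =>
    let B := gzlog (top P) in let L := fc (@ln R) P in
    bordered B (invmx (fc (bfac L B) B) *m ((psi B)^t* *m border P)) (\tr L - \tr B)
  else id.

Section Gzexp.
Variable R : realType.
Local Notation C := R[i].

Lemma psi_unitary n (A : 'M[C]_n) : A^t* = A -> psi A \is unitarymx.
Proof.
elim: n A => [|n IH] A AE.
  by apply/unitarymxP; apply/matrixP => -[].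
apply: mul_unitarymx; last exact: polar_unitary.
by rewrite blk_unitary ?normr1// IH// top_herm.
Qed.

Lemma psiKV n (A : 'M[C]_n) : A^t* = A -> psi A *m (psi A)^t* = 1%:M.
Proof. by move/psi_unitary/unitarymxP. Qed.

Lemma psiVK n (A : 'M[C]_n) : A^t* = A -> (psi A)^t* *m psi A = 1%:M.
Proof. by move/psi_unitary/unitaryVmx. Qed.

Lemma gzexp_herm n (A : 'M[C]_n) : A^t* = A -> (gzexp A)^t* = gzexp A.
Proof. by move=> AE; rewrite gzexp.unlock herm_conj// fc_herm. Qed.

Lemma lam_gzexp n (A : 'M[C]_n) : A^t* = A -> lam (gzexp A) =1 expR \o lam A.
Proof.
move=> AE i; rewrite gzexp.unlock lam_unitary_conj ?psi_unitary// lam_fc//.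
by move=> x y xy; rewrite ler_expR.
Qed.

Lemma gzexp_pos n (A : 'M[C]_n) : A^t* = A -> pos (gzexp A).
Proof.
by move=> AE; split=> [|i]; [exact: gzexp_herm|rewrite lam_gzexp//= expR_gt0].
Qed.

Lemma tr_gzexp n (A : 'M[C]_n) : A^t* = A -> \tr (gzexp A) = \tr (fc expR A).
Proof.
by move=> AE; rewrite gzexp.unlock mxtrace_mulC mulmxA psiVK// mul1mx.
Qed.

Lemma gzexpS n (A : 'M[C]_n.+1) : A^t* = A -> gzexp A =
  bordered (gzexp (top A)) (psi (top A) *m (wfac A *m border A))
    (\tr (fc expR A) - \tr (fc expR (top A))).
Proof.
move=> AE; have tE : polar A *m fc expR A *m (polar A)^t* = twist A.
  by rewrite polar_intertwine// -mulmxA (unitarymxP (polar_unitary AE)) mulmx1.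
have -> : gzexp A = blk (psi (top A)) 1 *m (polar A *m fc expR A *m (polar A)^t*) *m
    (blk (psi (top A)) 1)^t* by rewrite gzexp.unlock /= adjmxM !mulmxA.
rewrite tE gzexp.unlock.
by rewrite blk_bordered ?normr1// rmorph1 scale1r.
Qed.

Lemma top_gzexp n (A : 'M[C]_n.+1) : A^t* = A -> top (gzexp A) = gzexp (top A).
Proof. by move=> AE; rewrite gzexpS// top_bordered. Qed.

Lemma border_gzexp n (A : 'M[C]_n.+1) : A^t* = A ->
  border (gzexp A) = psi (top A) *m (wfac A *m border A).
Proof. by move=> AE; rewrite gzexpS// border_bordered. Qed.

Lemma herm_ext n (A B : 'M[C]_n.+1) : A^t* = A -> B^t* = B ->
  top A = top B -> border A = border B -> \tr A = \tr B -> A = B.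
Proof. by move=> AE BE tE bE trE; rewrite -(borderedK AE) -(borderedK BE) tE bE trE. Qed.

Lemma lam_psi_conj n (A X : 'M[C]_n) : A^t* = A -> lam (psi A *m X *m (psi A)^t*) = lam X.
Proof. by move=> AE; rewrite lam_unitary_conj// psi_unitary. Qed.

Lemma gzlogK n (A : 'M[C]_n) : A^t* = A -> gzlog (gzexp A) = A.
Proof.
elim: n A => [|n IH] A AE.
  by apply/matrixP => -[].
have BE := top_herm AE; rewrite /= top_gzexp// IH// border_gzexp//.
have LE : fc (@ln R) (gzexp A) = psi A *m A *m (psi A)^t*.
  by rewrite gzexp.unlock fc_unitary_conj ?psi_unitary ?fc_herm// fc_lnK.
rewrite (mulmxA ((psi _)^t*)) psiVK// mul1mx.
have -> : fc (bfac (fc (@ln R) (gzexp A)) (top A)) (top A) = wfac A.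
  rewrite wfac.unlock; apply: fc_ext => i; apply: bfac_eq => //.
  by apply: eq_bigr => j _; rewrite LE lam_psi_conj.
rewrite mulKmx; last by rewrite wfac.unlock fc_bfac_unit.
by rewrite LE mxtrace_mulC mulmxA psiVK// mul1mx borderedK.
Qed.

Lemma pos_top n (P : 'M[C]_n.+1) : pos P -> pos (top P).
Proof.
case=> PE P0; split=> [|i]; first exact: top_herm.
have [||h _] := lam_interlace (B := top P) (S := (proj n)^t*) i PE.
- by rewrite trmxCK projKV.
- by rewrite trmxCK top.unlock.
exact: lt_le_trans h.
Qed.

Lemma gzlog_herm n (P : 'M[C]_n) : pos P -> (gzlog P)^t* = gzlog P.
Proof.
elim: n P => [|n IH] P Pp; first by case: Pp.
have BE := IH _ (pos_top Pp); apply: bordered_herm => //.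
by rewrite rmorphB /= !herm_tr// fc_herm//; case: Pp.
Qed.

(** The squared modulus of a coordinate does not depend on the eigenbasis when
    the spectrum is simple: it is a matrix entry of a spectral projection. *)
Lemma abs2_eigbasis n (B : 'M[C]_n) (b : 'cV[C]_n) h i : B^t* = B ->
  (forall j, h (lam B j) = (j == i)%:R) ->
  (b^t* *m fc h B *m b) 0 0 = (abs2 ((eigbasis B *m b) i 0))%:C.
Proof.
move=> BE hi; rewrite fc.unlock !mulmxA -mulmxA -{1}[eigbasis B]trmxCK -adjmxM.
rewrite trmxCK mul_mx_diag mxE (bigD1 i)//= big1 => [|j ji].
  by rewrite addr0 -abs2E !mxE hi eqxx mulr1.
by rewrite !mxE hi (negPf ji) mulr0 mul0r.
Qed.

(** The characteristic polynomial of [gzlog P] is given by [secular_poly], that of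
    [fc ln P] by interpolation at the eigenvalues of the corner; they agree by the secular
    equation of a conjugate of [P]. *)
Lemma lam_gzlog n (P : 'M[C]_n.+1) : pos P -> injective (lam (top P)) ->
  gzexp (gzlog (top P)) = top P -> lam (gzlog P) = lam (fc (@ln R) P).
Proof.
move=> Pp Pi tE; have Bp := pos_top Pp; set L := fc _ P; set B := gzlog (top P) in tE.
have BE : B^t* = B by exact: gzlog_herm.
have LE : L^t* = L by rewrite fc_herm//; case: Pp.
pose b' := (psi B)^t* *m border P.
have ey i : lam (top P) i = expR (lam B i) by rewrite -tE lam_gzexp.
have yI : injective (lam B) by move=> i j ij; apply: Pi; rewrite !ey ij.
have yCI : injective (fun i => (lam B i)%:C) by move=> i j /complexI/yI.
apply: eq_lam; rewrite secular_poly ?gzlog_herm// char_poly_lam//.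
rewrite (lagrange_monic _ yCI) /= -/L -/B -/b' top_bordered border_bordered tr_bordered.
rewrite addrCA subrr addr0.
have trL : \tr L = \sum_j (lam L j)%:C by rewrite -{1}(fc_id LE) fc_trace// raddf_sum.
have trB : \tr B = \sum_j (lam B j)%:C by rewrite -{1}(fc_id BE) fc_trace// raddf_sum.
congr (_ + _); first by rewrite trL trB.
rewrite -sumrN; apply: eq_bigr => i _.
rewrite -mulNr -rmorphN; congr (_%:P * _).
have q0 : \prod_(k | k != i) (lam B i - lam B k) != 0.
  by apply/prodf_neq0 => k ki; rewrite subr_eq0 (inj_eq yI) eq_sym.
transitivity ((\prod_j (lam B i - lam L j) / \prod_(k | k != i) (lam B i - lam B k))%:C);
  last first.
  rewrite rmorphM fmorphV !rmorph_prod; congr (_ / _);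
  by apply: eq_bigr => j _; rewrite rmorphB.
rewrite -rmorphN; congr (_%:C).
pose f := bfac L B (lam B i).
have f0 : f ^+ 2 != 0 by rewrite expf_neq0// lt0r_neq0// bfac_gt0.
have bE : f ^+ 2 * abs2 ((eigbasis B *m (invmx (fc (bfac L B) B) *m b')) i 0) =
    abs2 ((eigbasis B *m b') i 0).
  rewrite -[in RHS](mulKVmx (fc_bfac_unit L BE) b') eig_row_fc// -/f.
  set z := (_ *m _) i 0; rewrite /abs2 ReM ImM /=; ring.
pose P' := blk ((psi B)^t*) 1 *m P *m (blk ((psi B)^t*) 1)^t*.
have Wu : blk ((psi B)^t*) 1 \is unitarymx.
  apply: blk_unitary; last exact: normr1.
  by apply/unitarymxP; rewrite trmxCK psiVK.
have PE : P^t* = P by case: Pp.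
(* P' is similar to P, and its corner is exp B *)
have P'E : P'^t* = P' by rewrite herm_conj.
have [tP' bP'] := blk_conj ((psi B)^t*) 1 P.
have {}tP' : top P' = fc expR B.
  rewrite /P' tP' -tE gzexp.unlock trmxCK !mulmxA psiVK// mul1mx -mulmxA psiVK//.
  by rewrite mulmx1.
have {}bP' : border P' = b' by rewrite /P' bP' rmorph1 scale1r.
have lE : lam (fc expR B) =1 expR \o lam B.
  by apply: lam_fc => // x y; rewrite ler_expR.
have lP' j : lam P' j = expR (lam L j).
  rewrite lam_unitary_conj// -[in LHS](fc_expK Pp) lam_fc//.
  by move=> x y; rewrite ler_expR.
have := secular_eq i P'E; rewrite tP' bP' lE /=.
have -> : abs2 ((eigbasis (fc expR B) *m b') i 0) = abs2 ((eigbasis B *m b') i 0).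
  apply/complexI; pose h s : R := (s == expR (lam B i))%:R.
  have hE j : h (expR (lam B j)) = (j == i)%:R.
    by rewrite /h (inj_eq (@expR_inj R)) (inj_eq yI).
  have FE : (fc expR B)^t* = fc expR B by exact: fc_herm.
  have h1 := abs2_eigbasis (h := h \o expR) b' BE hE.
  have h2 : forall j, h (lam (fc expR B) j) = (j == i)%:R by move=> j; rewrite lE /= hE.
  by rewrite -(abs2_eigbasis b' FE h2) -h1 fc_comp.
rewrite -bE (eq_bigr (fun j => expdd (lam B i) (lam L j) * (lam B i - lam L j)));
  last by move=> j _; rewrite lP' expdd_eq.
rewrite [in RHS](eq_bigr (fun k => expdd (lam B i) (lam B k) * (lam B i - lam B k)));
  last by move=> k _; rewrite lE /= expdd_eq.
rewrite !big_split /= -(bfac_sq_diag L B i) -/f.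
set E := (\prod_(k | _) expdd _ _); set a := abs2 _.
have E0 : E != 0 by apply/prodf_neq0 => k _; exact: expdd_neq0.
move=> h; apply: (mulIf q0); rewrite divfK//; apply: (mulfI (mulf_neq0 f0 E0)).
by rewrite h; ring.
Qed.

End Gzexp.

Section Smoothness.
Variables (R : realType) (V : normedModType R) (D : set V) (k : nat).
Hypothesis oD : open D.
Local Notation C := R[i].

Lemma mC_psi n (A : V -> 'M[C]_n) : hermD D A -> mC D k A -> mC D k (fun x => psi (A x)).
Proof.
elim: n A => [|n IH] A Ah Ak; first exact: mC_cst.
apply: mCM => //; last exact: mC_polar.
by apply: mC_blk => //; apply: IH; [exact: hermD_top|exact: mC_top].
Qed.

Lemma mC_gzexp n (A : V -> 'M[C]_n) : hermD D A -> mC D k A -> mC D k (fun x => gzexp (A x)).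
Proof.
move=> Ah Ak; rewrite gzexp.unlock; apply: mCM => //; last first.
  by apply: mC_adj => //; exact: mC_psi.
by apply: mCM => //; [exact: mC_psi|exact: mC_fc_exp].
Qed.

Lemma mC_gzlog n (P : V -> 'M[C]_n) : (forall x, D x -> pos (P x)) -> mC D k P ->
  mC D k (fun x => gzlog (P x)).
Proof.
elim: n P => [|n IH] P Pp Pk //.
have Bp x : D x -> pos (top (P x)) by move=> Dx; apply: pos_top; exact: Pp.
have Bk := IH _ Bp (mC_top oD Pk).
have Lk := mC_fc_ln oD Pp Pk.
have Bh : hermD D (fun x => gzlog (top (P x))).
  by move=> x Dx; apply: gzlog_herm; exact: Bp.
have Lh : hermD D (fun x => fc (@ln R) (P x)).
  by move=> x Dx; apply: fc_herm; case: (Pp x Dx).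
apply: mC_bordered => //; last first.
  by apply: cCD => //; [|apply: cCN => //]; exact: cC_trace.
apply: mCM => //.
  by apply: mC_inv => //; [move=> x Dx; apply: fc_bfac_unit; exact: Bh|exact: mC_fc_bfac].
apply: mCM => //; first by apply: mC_adj => //; exact: mC_psi.
exact: mC_border.
Qed.

End Smoothness.

Section Inverse.
Variable R : realType.
Local Notation C := R[i].

Lemma pos_open n : open [set X : 'M[R]_n | pos (hmat X)].
Proof.
have hh : hermD setT (@hmat R n) by move=> X _; exact: hmat_herm.
rewrite openE => X [_ X0]; rewrite /interior /=.
have h i := lam_near openT hh (mC_hmat 0 openT) (I : setT X) (X0 i).
have {}h : \forall Y \near X, forall i j, `|lam (hmat Y) j - lam (hmat X) j| < lam (hmat X) i.
  exact: (@filter_forall _ _ (fun i Y => forall j, _ < lam (hmat X) i) _ _ h).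
apply: filterS h => Y hY; split=> [|i]; first exact: hmat_herm.
by have := hY i i; rewrite ltr_norml ltrBrDl subrr => /andP[].
Qed.

(** Once the spectrum of [gzlog P] is known, corner, border and trace of the two sides agree;
    by density, the corner may be assumed to have a simple spectrum. *)
Lemma gzexpK n (P : 'M[C]_n) : pos P -> gzexp (gzlog P) = P.
Proof.
elim: n P => [|n IH] P Pp; first by apply/matrixP => -[].
have PE : P^t* = P by case: Pp.
rewrite -(hcoordK (proj2 (HermP _) PE)).
have : [set X | pos (hmat X)] (hcoord P) by rewrite /= hcoordK//; exact/HermP.
move: (hcoord P); apply: mx_eq_generic; first exact: pos_open.
- have oD := @pos_open n.+1; apply: mC_gzexp => //.
    by move=> X Xp; exact: gzlog_herm.
  by apply: mC_gzlog => //; exact: mC_hmat.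
- by apply: mC_hmat; exact: pos_open.
move=> {Pp PE} X /= Xp [_ Xi]; move: (hmat X) Xp Xi => {}P Xp Xi.
have PE : P^t* = P by case: Xp.
have Bp := pos_top Xp; have tE := IH _ Bp.
have lE := lam_gzlog Xp (chain_inj Xi) tE.
have AE := gzlog_herm Xp; have BE := gzlog_herm Bp.
have LE : (fc (@ln R) P)^t* = fc (@ln R) P by rewrite fc_herm.
apply: herm_ext => //; first exact: gzexp_herm.
- by rewrite top_gzexp//= top_bordered.
- rewrite border_gzexp//= top_bordered border_bordered.
  rewrite (_ : wfac _ = fc (bfac (fc (@ln R) P) (gzlog (top P))) (gzlog (top P))).
    by rewrite mulKVmx ?fc_bfac_unit// mulmxA psiKV// mul1mx.
  rewrite wfac.unlock /= top_bordered; apply: fc_ext => i; apply: bfac_eq => //.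
  by rewrite /lsum -lE.
- change (\tr (gzexp (gzlog P)) = \tr P).
  rewrite tr_gzexp// -[in RHS](fc_expK Xp) !fc_trace//; congr (_%:C).
  by apply: eq_bigr => i _; rewrite lE.
Qed.

End Inverse.

(** * Symmetries *)

Section Symmetries.
Variable R : realType.
Local Notation C := R[i].

Lemma fc2_unitary_conj K m n (W B : 'M[C]_m) (U A : 'M[C]_n) X :
  W \is unitarymx -> U \is unitarymx -> B^t* = B -> A^t* = A ->
  fc2 K (W *m B *m W^t*) (U *m A *m U^t*) (W *m X *m U^t*) = W *m fc2 K B A X *m U^t*.
Proof.
move=> Wu Uu BE AE; apply: fc2_intertwine => //; try exact: herm_conj.
  by rewrite -mulmxA unitaryVmx// mulmx1.
by rewrite !mulmxA unitaryVmx// mul1mx.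
Qed.

Lemma unitary_conjM n (W X Y : 'M[C]_n) : W \is unitarymx ->
  (W *m X *m W^t*) *m (W *m Y *m W^t*) = W *m (X *m Y) *m W^t*.
Proof. by move=> Wu; rewrite !mulmxA (mulmx_adjK _ Wu). Qed.

Lemma unitary_conj_adj n (W X : 'M[C]_n) : (W *m X *m W^t*)^t* = W *m X^t* *m W^t*.
Proof. by rewrite adjmxM adjmxM trmxCK mulmxA. Qed.

Lemma unitary_conjK n (W A : 'M[C]_n) : W \is unitarymx ->
  W^t* *m (W *m A *m W^t*) *m W = A.
Proof. by move=> Wu; rewrite !mulmxA unitaryVmx// mul1mx (mulmx_adjK _ Wu). Qed.

Section BlockConjugation.
Variables (n : nat) (Z : 'M[C]_n) (w : C) (A : 'M[C]_n.+1).
Hypotheses (Zu : Z \is unitarymx) (w1 : `|w| = 1) (AE : A^t* = A).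
Local Notation W := (blk Z w).

(** Functions of one or two matrices commute with unitary conjugation, and [proj] intertwines
    [blk Z w] with [Z]. *)
Lemma pretwist_blk : pretwist (W *m A *m W^t*) = W *m pretwist A *m W^t*.
Proof.
have Wu : W \is unitarymx by exact: blk_unitary.
have BE := top_herm AE; have [tE bE] := blk_conj Z w A.
have sE : sylv (W *m A *m W^t*) = Z *m sylv A *m W^t*.
  rewrite sylv.unlock tE -fc2_unitary_conj//; congr fc2.
  by rewrite -(proj_blk Z w) -mulmxA (unitarymxP Wu) mulmx1.
have wE : wfac (W *m A *m W^t*) = Z *m wfac A *m Z^t*.
  rewrite wfac.unlock tE fc_unitary_conj// (fc_ext (h := bfac A (top A)))// => i.
  by apply: bfac_eq; apply: lsum_lam; exact: lam_unitary_conj.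
apply: border_ext; rewrite !mulmxA.
  rewrite proj_pretwist sE wE proj_blk -(mulmxA Z (proj n)) proj_pretwist.
  by rewrite !mulmxA (mulmx_adjK _ Zu).
rewrite elast_pretwist elast_blk -scalemxAl elast_pretwist -scalemxAl blk_adj elast_blk.
by rewrite scalerA -normCK w1 expr1n scale1r.
Qed.

Lemma polar_blk : polar (W *m A *m W^t*) = W *m polar A *m W^t*.
Proof.
have Wu : W \is unitarymx by exact: blk_unitary.
have WE : ((pretwist A)^t* *m pretwist A)^t* = (pretwist A)^t* *m pretwist A.
  by rewrite adjmxM trmxCK.
rewrite polar.unlock pretwist_blk unitary_conj_adj unitary_conjM//.
by rewrite fc_unitary_conj// unitary_conjM.
Qed.

(** [Z'] is what [Z] becomes under [psi] at the level of the corner; this propagates to the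
    whole matrix. *)
Lemma psi_blk Z' : psi (Z *m top A *m Z^t*) = Z' *m psi (top A) *m Z^t* ->
  psi (W *m A *m W^t*) = blk Z' w *m psi A *m W^t*.
Proof.
move=> pE; have [tE _] := blk_conj Z w A.
rewrite /= tE polar_blk pE !mulmxA !blkM mul1r mulr1.
by rewrite (mulmx_adjK _ Zu).
Qed.

End BlockConjugation.

Lemma gzexp_conj n (U U' A : 'M[C]_n) : U \is unitarymx -> A^t* = A ->
  psi (U *m A *m U^t*) = U' *m psi A *m U^t* ->
  gzexp (U *m A *m U^t*) = U' *m gzexp A *m U'^t*.
Proof.
move=> Uu AE pE; rewrite gzexp.unlock pE fc_unitary_conj//.
have -> : (U' *m psi A *m U^t*)^t* = U *m ((psi A)^t* *m U'^t*).
  by rewrite adjmxM adjmxM trmxCK.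
by rewrite !mulmxA (mulmx_adjK _ Uu) (mulmx_adjK _ Uu).
Qed.

Lemma top_map_conj n (A : 'M[C]_n.+1) : top (map_mx Num.conj A) = map_mx Num.conj (top A).
Proof. by rewrite !topE /corner map_mxsub. Qed.

Lemma proj_real n : map_mx Num.conj (proj n) = proj n :> 'M[C]_(n, n.+1).
Proof. by apply/matrixP => i j; rewrite mxE projE rmorph_nat. Qed.

Lemma elast_real n : map_mx Num.conj (elast n) = elast n :> 'cV[C]_n.+1.
Proof. by apply/matrixP => i j; rewrite mxE elastE rmorph_nat. Qed.

Lemma adj_map_conj m n (A : 'M[C]_(m, n)) : (map_mx Num.conj A)^t* = map_mx Num.conj (A^t*).
Proof. by apply/matrixP => i j; rewrite !mxE. Qed.

Lemma lam_map_conj n (A : 'M[C]_n) : A^t* = A -> lam (map_mx Num.conj A) = lam A.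
Proof.
move=> AE; apply: eq_lam; have -> : map_mx Num.conj A = A^T by rewrite -{2}AE; apply/matrixP => i j; rewrite !mxE.
rewrite /char_poly -[RHS]det_tr; congr (\det _); apply/matrixP => i j.
by rewrite !mxE eq_sym.
Qed.

Lemma pretwist_map_conj n (A : 'M[C]_n.+1) : A^t* = A ->
  pretwist (map_mx Num.conj A) = map_mx Num.conj (pretwist A).
Proof.
move=> AE; have BE := top_herm AE; rewrite pretwist.unlock sylv.unlock wfac.unlock.
rewrite top_map_conj -{2}(proj_real n) fc2_map_conj// fc_map_conj//.
rewrite map_mxD !map_mxM -!adj_map_conj proj_real elast_real.
have -> // : fc (bfac (map_mx Num.conj A) (map_mx Num.conj (top A))) (top A) =
   fc (bfac A (top A)) (top A).
by apply: fc_ext => i; apply: bfac_eq; apply: lsum_lam; exact: lam_map_conj.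
Qed.

Lemma polar_map_conj n (A : 'M[C]_n.+1) : A^t* = A ->
  polar (map_mx Num.conj A) = map_mx Num.conj (polar A).
Proof.
move=> AE; rewrite polar.unlock pretwist_map_conj// adj_map_conj -map_mxM fc_map_conj.
  by rewrite map_mxM.
by rewrite adjmxM trmxCK.
Qed.

Lemma psi_map_conj n (A : 'M[C]_n) : A^t* = A ->
  psi (map_mx Num.conj A) = map_mx Num.conj (psi A).
Proof.
elim: n A => [|n IH] A AE; first by apply/matrixP => -[].
rewrite /= top_map_conj IH ?top_herm// polar_map_conj// map_mxM; congr (_ *m _).
rewrite blk.unlock map_mxD map_mxZ !map_mxM -!adj_map_conj proj_real elast_real.
by rewrite rmorph1.
Qed.

Lemma gzexp_map_conj n (A : 'M[C]_n) : A^t* = A ->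
  gzexp (map_mx Num.conj A) = map_mx Num.conj (gzexp A).
Proof.
move=> AE; rewrite gzexp.unlock psi_map_conj// fc_map_conj// adj_map_conj.
by rewrite !map_mxM.
Qed.

Lemma shift_fc n (A : 'M[C]_n) (u : R) : A^t* = A -> A + u%:C%:M = fc (fun x => x + u) A.
Proof. by move=> AE; rewrite -{1}(fc_id AE) -(fc_cst u AE) fcD. Qed.

Lemma lam_shift n (A : 'M[C]_n) (u : R) i : A^t* = A -> lam (A + u%:C%:M) i = lam A i + u.
Proof.
move=> AE; rewrite shift_fc// lam_fc// => x y xy.
by rewrite lerD2r.
Qed.

Lemma fc_shift n (A : 'M[C]_n) (u : R) h : A^t* = A ->
  fc h (A + u%:C%:M) = fc (fun x => h (x + u)) A.
Proof. by move=> AE; rewrite shift_fc// fc_comp. Qed.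

Lemma top_shift n (A : 'M[C]_n.+1) (u : R) : top (A + u%:C%:M) = top A + u%:C%:M.
Proof.
by rewrite top.unlock mulmxDr mulmxDl mul_mx_scalar -scalemxAl projKV scalemx1.
Qed.

Lemma lsum_shift n (A : 'M[C]_n) (u s : R) : A^t* = A ->
  lsum (A + u%:C%:M) (s + u) = lsum A s + n%:R * u.
Proof.
move=> AE; rewrite /lsum; under eq_bigr => j _.
  rewrite lam_shift// expdd_shift lnM ?posrE ?expR_gt0 ?expdd_gt0// expRK.
  over.
by rewrite big_split /= sumr_const card_ord addrC mulr_natl.
Qed.

Lemma fc2_shift K m n (B : 'M[C]_m) (A : 'M[C]_n) (u : R) X : B^t* = B -> A^t* = A ->
  fc2 K (B + u%:C%:M) (A + u%:C%:M) X = fc2 (fun y x => K (y + u) (x + u)) B A X.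
Proof.
move=> BE AE; rewrite -[B in LHS]scale1r -[A in LHS]scale1r (_ : 1 = 1%:C)//.
by rewrite fc2_affine//; apply: fc2_ext => i j; rewrite !mul1r.
Qed.

(** [wfac] gains the factor [expR u] that [sylv] loses. *)
Lemma pretwist_shift n (A : 'M[C]_n.+1) (u : R) : A^t* = A ->
  pretwist (A + u%:C%:M) = pretwist A.
Proof.
move=> AE; have BE := top_herm AE; rewrite pretwist.unlock; congr (_ + _).
have -> : wfac (A + u%:C%:M) = (expR u)%:C *: wfac A.
  rewrite wfac.unlock top_shift fc_shift// fcZ//; apply: fc_ext => i.
  by rewrite /bfac !lsum_shift// -expRD -natr1; congr expR; lra.
have -> : sylv (A + u%:C%:M) = (expR (- u))%:C *: sylv A.
  rewrite sylv.unlock top_shift fc2_shift// -(fc2_cst BE AE) fc2_comp//.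
  by apply: fc2_ext => i j; rewrite expdd_shift invfM expRN.
rewrite -!scalemxAr -scalemxAl scalerA -rmorphM -expRD addNr expR0.
by rewrite scale1r.
Qed.

Lemma psi_shift n (A : 'M[C]_n) (u : R) : A^t* = A -> psi (A + u%:C%:M) = psi A.
Proof.
elim: n A => [|n IH] A AE //=.
by rewrite top_shift IH ?top_herm// polar.unlock pretwist_shift.
Qed.

Lemma gzexp_shift n (A : 'M[C]_n) (u : R) : A^t* = A ->
  gzexp (A + u%:C%:M) = (expR u)%:C *: gzexp A.
Proof.
move=> AE; rewrite gzexp.unlock psi_shift// fc_shift//.
rewrite (_ : fc _ A = (expR u)%:C *: fc expR A).
  by rewrite -scalemxAr -scalemxAl.
by rewrite fcZ//; apply: fc_ext => i; rewrite expRD mulrC.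
Qed.

Lemma herm0 n : (0 : 'M[C]_n)^t* = 0.
Proof. by apply/matrixP => i j; rewrite !mxE conjC0. Qed.

Lemma lam0 n i : lam (0 : 'M[C]_n) i = 0.
Proof.
have h := fc_cst 0 (herm0 n); rewrite -scalemx1 rmorph0 scale0r in h.
by rewrite -h (lam_fc (h := fun=> 0)) //; exact: herm0.
Qed.

Lemma top0 n : top (0 : 'M[C]_n.+1) = 0.
Proof. by rewrite top.unlock mulmx0 mul0mx. Qed.

(** The paths [gzpath A] start at [A] for this reason. *)
Lemma psi0 n : psi (0 : 'M[C]_n) = 1%:M.
Proof.
elim: n => [|n IH] //=; rewrite top0 IH blk1 mul1mx polar.unlock.
have h0 := herm0 n.
have -> : pretwist (0 : 'M[C]_n.+1) = 1%:M.
  have lsum0 m : lsum (0 : 'M[C]_m) 0 = 0.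
    by rewrite /lsum big1// => j _; rewrite lam0 expdd_diag expR0 ln1.
  rewrite pretwist.unlock sylv.unlock wfac.unlock top0.
  rewrite (fc_ext (h := fun=> 1)) => [|i]; last first.
    by rewrite lam0 /bfac !lsum0 !addr0 subr0 mul0r expR0.
  rewrite fc_cst// mulmx1 (fc2_ext (K' := fun _ _ => 1)) => [|i j]; last first.
    by rewrite !lam0 expdd_diag expR0 invr1.
  by rewrite fc2_cst// ?herm0// scale1r proj_split.
rewrite mul1mx mulmx1 adjmx1 (fc_ext (h := fun=> 1)) => [|i].
  by rewrite fc_cst// adjmx1.
have h1 := fc_cst 1 (herm0 n.+1); rewrite [RHS]/= in h1.
rewrite -[1%:M]h1 (lam_fc (h := fun=> 1))//; last exact: herm0.
by rewrite /rsqrt ln1 mulr0 expR0.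
Qed.

End Symmetries.

(** * Corners and block extensions *)

Section Corners.
Variable R : realType.
Local Notation C := R[i].

Lemma ord_widen_max n (i : 'I_n.+1) :
  (exists j, i = widen_ord (leqnSn n) j) \/ i = ord_max.
Proof.
have [i_n|] := ltnP i n; first by left; exists (Ordinal i_n); apply: val_inj.
by move=> ni; right; apply/val_inj/eqP; rewrite eqn_leq ni -ltnS ltn_ord.
Qed.

Lemma elast_row_mul n p (M : 'M[C]_(n.+1, p)) i : ((elast n)^t* *m M) 0 i = M ord_max i.
Proof.
rewrite mxE (bigD1 ord_max)//= big1 => [|j jm]; last first.
  by rewrite !mxE elastE (negPf jm) conjC0 mul0r.
by rewrite !mxE elastE eqxx conjC1 mul1r addr0.
Qed.

Lemma blkP n (M : 'M[C]_n.+1) (Z : 'M[C]_n) w :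
  (forall i j, M (widen_ord (leqnSn n) i) (widen_ord (leqnSn n) j) = Z i j) ->
  (forall i, M (widen_ord (leqnSn n) i) ord_max = 0) ->
  (forall i, M ord_max (widen_ord (leqnSn n) i) = 0) ->
  M ord_max ord_max = w -> M = blk Z w.
Proof.
move=> h1 h2 h3 h4; apply: border_ext; rewrite ?proj_blk ?elast_blk.
  apply/matrixP => i j; rewrite proj_mul; have [[k ->]|->] := ord_widen_max j.
    rewrite h1 mxE (bigD1 k)//= big1 => [|l lk]; last first.
      by rewrite projE (inj_eq (@widen_inj _)) eq_sym (negPf lk) mulr0.
    by rewrite projE eqxx mulr1 addr0.
  rewrite h2 mxE big1// => l _; rewrite projE (_ : _ == _ = false) ?mulr0//.
  by apply/negbTE; rewrite -val_eqE /= gtn_eqF.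
apply/matrixP => i j; rewrite ord1 elast_row_mul; have [[k ->]|->] := ord_widen_max j.
  rewrite h3 !mxE elastE (_ : _ == ord_max = false) ?conjC0 ?mulr0//.
  by apply/negbTE; rewrite -val_eqE /= ltn_eqF.
by rewrite h4 !mxE elastE eqxx conjC1 mulr1.
Qed.

Lemma corner_full T n (hn : (n <= n)%N) (A : 'M[T]_n) : corner hn A = A.
Proof. by apply/matrixP => i j; rewrite mxE; congr (A _ _); apply: val_inj. Qed.

Lemma corner_top k n (hk : (k <= n)%N) (hk' : (k <= n.+1)%N) (A : 'M[C]_n.+1) :
  corner hk' A = corner hk (top A).
Proof.
by rewrite topE; apply/matrixP => i j; rewrite !mxE; congr (A _ _); apply: val_inj.
Qed.

Lemma corner_pred k n (hk : (k.+1 <= n)%N) (hk' : (k <= n)%N) (A : 'M[C]_n) :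
  corner hk' A = top (corner hk A).
Proof.
by rewrite topE; apply/matrixP => i j; rewrite !mxE; congr (A _ _); apply: val_inj.
Qed.

Lemma corner_herm k n (hk : (k <= n)%N) (A : 'M[C]_n) : A^t* = A ->
  (corner hk A)^t* = corner hk A.
Proof. by move=> AE; apply/matrixP => i j; rewrite -[in RHS]AE !mxE. Qed.

Lemma extend_ul k n (hk : (k <= n)%N) (c : C) B i j :
  extend hk c B (widen_ord hk i) (widen_ord hk j) = B i j.
Proof.
rewrite castmxE (_ : cast_ord _ (widen_ord hk i) = lshift _ i); last exact: val_inj.
rewrite (_ : cast_ord _ (widen_ord hk j) = lshift _ j); last exact: val_inj.
by rewrite block_mxEul.
Qed.

Lemma extend_out k n (hk : (k <= n)%N) (c : C) B (i j : 'I_n) : (k <= i)%N || (k <= j)%N ->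
  extend hk c B i j = c *+ (i == j).
Proof.
have out (l : 'I_n) : (k <= l)%N -> exists r, cast_ord (esym (subnKC hk)) l = rshift k r.
  move=> kl; have lk : (l - k < n - k)%N by rewrite ltn_sub2r// (leq_ltn_trans kl).
  by exists (Ordinal lk); apply: val_inj; rewrite /= subnKC.
have inn (l : 'I_n) : (l < k)%N -> exists r, cast_ord (esym (subnKC hk)) l = lshift (n - k) r.
  by move=> lk; exists (Ordinal lk); apply: val_inj.
have eqE : (i == j) = (cast_ord (esym (subnKC hk)) i == cast_ord (esym (subnKC hk)) j).
  by rewrite (inj_eq (@cast_ord_inj _ _ _)).
rewrite castmxE eqE; have [/out[r ->]|/inn[r ->]] := leqP k i => /=.
  have [/out[q ->]|/inn[q ->]] := leqP k j; last first.
    by rewrite block_mxEdl mxE eq_rlshift mulr0n.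
  by rewrite block_mxEdr mxE eq_rshift.
by move=> /out[q ->]; rewrite block_mxEur mxE eq_lrshift mulr0n.
Qed.

Lemma extend_full n (hn : (n <= n)%N) (c : C) B : extend hn c B = B.
Proof.
apply/matrixP => i j; rewrite -[RHS](extend_ul hn c).
by congr (extend _ _ _ _ _); apply: val_inj.
Qed.

Lemma extend_top k n (hk : (k <= n)%N) (hk' : (k <= n.+1)%N) (c : C) B :
  extend hk' c B = blk (extend hk c B) c.
Proof.
have wE (i : 'I_k) : widen_ord (leqnSn n) (widen_ord hk i) = widen_ord hk' i.
  exact: val_inj.
apply: blkP => [i j|i|i|].
- have [kij|] := boolP ((k <= i)%N || (k <= j)%N).
    by rewrite !extend_out// (inj_eq (@widen_inj _)).
  rewrite negb_or -!ltnNge => /andP[ik jk].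
  rewrite (_ : i = widen_ord hk (Ordinal ik)); last exact: val_inj.
  rewrite (_ : j = widen_ord hk (Ordinal jk)); last exact: val_inj.
  by rewrite !wE !extend_ul.
- rewrite extend_out/= ?hk ?orbT// (_ : _ == ord_max = false) ?mulr0n//.
  by apply/negbTE; rewrite -val_eqE /= ltn_eqF.
- rewrite extend_out/= ?hk// (_ : ord_max == _ = false) ?mulr0n//.
  by apply/negbTE; rewrite -val_eqE /= gtn_eqF.
- by rewrite extend_out/= ?hk// eqxx.
Qed.

Lemma gz_lambdaE k n (hk : (k <= n)%N) (A : 'M[C]_n) i : gz_lambda A hk i = lam (corner hk A) i.
Proof. by rewrite lam.unlock. Qed.

Lemma le_pred k n : (k <= n.+1)%N -> k != n.+1 -> (k <= n)%N.
Proof. by move=> h ne; rewrite -ltnS ltn_neqAle ne. Qed.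

(** Induction on the size of the ambient matrix, the corner being fixed. *)
Lemma corner_ind k (P : forall n, (k <= n)%N -> Prop) :
  (forall hk : (k <= k)%N, P k hk) ->
  (forall n (hk : (k <= n)%N) (hk' : (k <= n.+1)%N), P n hk -> P n.+1 hk') ->
  forall n (hk : (k <= n)%N), P n hk.
Proof.
move=> P0 PS; elim=> [|n IH] hk.
  have k0 : k = 0%N by apply/eqP; rewrite -leqn0.
  by subst k.
have [e|ne] := eqVneq k n.+1; first by subst k.
exact: PS (IH (le_pred hk ne)).
Qed.

Lemma corner_gzexp k n (hk : (k <= n)%N) (A : 'M[C]_n) : A^t* = A ->
  corner hk (gzexp A) = gzexp (corner hk A).
Proof.
elim/(@corner_ind k): n / hk A => [hk|n hk hk' IH] A AE; first by rewrite !corner_full.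
by rewrite !(corner_top hk) top_gzexp// IH// top_herm.
Qed.

Lemma chainP n (A : 'M[C]_n) : interlaced_chain A <->
  forall k (hk : (k.+1 <= n)%N), strictly_interlaced (corner hk A).
Proof.
elim: n A => [|n IH] A //=; split=> [[Ai Bi] k hk|h].
  have [e|ne] := eqVneq k n; first by subst k; rewrite corner_full.
  have hk' : (k.+1 <= n)%N by rewrite ltn_neqAle ne.
  by rewrite (corner_top hk'); exact: (IH _).1.
split; first by have := h n (leqnn _); rewrite corner_full.
by apply/(IH _).2 => k hk; have := h k (leqW hk); rewrite (corner_top hk).
Qed.

Lemma Herm0P n (A : 'M[C]_n) : Herm0 A <-> A^t* = A /\ interlaced_chain A.
Proof.
rewrite /Herm0 /gz_open_cone /= chainP; split=> -[].
  move=> /HermP AE h; split=> // k hk i; have := h k hk i.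
  by rewrite !gz_lambdaE (corner_pred hk).
move=> AE h; split; first exact/HermP.
by move=> k hk i; have := h k hk i; rewrite !gz_lambdaE (corner_pred hk).
Qed.

Lemma gz_mu_gzexp n (A : 'M[C]_n) : A^t* = A -> gz_mu (gzexp A) = gz_lambda A.
Proof.
move=> AE; apply: functional_extensionality_dep => k.
apply: functional_extensionality_dep => hk; apply: funext => i.
by rewrite /gz_mu !gz_lambdaE corner_gzexp// lam_gzexp ?corner_herm//= expRK.
Qed.

Lemma fc_blk n (X : 'M[C]_n) h : X^t* = X -> fc h (blk X 0) = blk (fc h X) (h 0)%:C.
Proof.
move=> XE; have AE : (blk X 0)^t* = blk X 0 by rewrite blk_adj XE conjC0.
apply: border_ext; rewrite ?proj_blk ?elast_blk.
  by rewrite -(fc_intertwine h XE AE)// proj_blk.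
by apply: fc_eigr => //; rewrite elast_blk.
Qed.

(** A zero border stays zero, and the trace gives the last entry. *)
Lemma gzexp_blk n (X : 'M[C]_n) : X^t* = X -> gzexp (blk X 0) = blk (gzexp X) 1.
Proof.
move=> XE; have AE : (blk X 0)^t* = blk X 0 by rewrite blk_adj XE conjC0.
have blkE (Y : 'M[C]_n) w : blk Y w = bordered Y 0 w.
  apply: border_ext; rewrite ?proj_blk ?elast_blk ?proj_bordered ?elast_bordered.
    by rewrite mul0mx addr0.
  by rewrite (_ : (0 : 'cV[C]_n)^t* = 0) ?mul0mx ?add0r//; apply/matrixP => i j; rewrite !mxE conjC0.
rewrite gzexpS// !blkE top_bordered border_bordered !mulmx0 -blkE fc_blk// expR0.
by rewrite blkE tr_bordered addrAC subrr add0r.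
Qed.

Lemma extend_herm k n (hk : (k <= n)%N) (c : R) (B : 'M[C]_k) : B^t* = B ->
  (extend hk c%:C B)^t* = extend hk c%:C B.
Proof.
move=> BE; elim/(@corner_ind k): n / hk => [hk|n hk hk' IH]; first by rewrite extend_full.
by rewrite (extend_top hk) blk_adj IH conjC_real.
Qed.

Lemma gzexp_extend k n (hk : (k <= n)%N) (B : 'M[C]_k) : B^t* = B ->
  gzexp (extend hk 0 B) = extend hk 1 (gzexp B).
Proof.
move=> BE; elim/(@corner_ind k): n / hk => [hk|n hk hk' IH]; first by rewrite !extend_full.
by rewrite !(extend_top hk) gzexp_blk ?IH// (@extend_herm _ _ _ 0).
Qed.

Lemma conjg_unitary n (V A : 'M[C]_n) : V \is unitarymx -> conjg_mx V A = V *m A *m V^t*.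
Proof. by move=> Vu; rewrite /conjg_mx invmx_unitary. Qed.

Lemma diag_blk n (t : 'rV[C]_n.+1) :
  diag_mx t = blk (diag_mx (\row_i t 0 (widen_ord (leqnSn n) i))) (t 0 ord_max).
Proof.
apply: blkP => [i j|i|i|]; rewrite !mxE ?eqxx//.
- by rewrite (_ : _ == ord_max = false)//; apply/negbTE; rewrite -val_eqE /= ltn_eqF.
- by rewrite (_ : ord_max == _ = false)//; apply/negbTE; rewrite -val_eqE /= gtn_eqF.
Qed.

Lemma diag_unitary n (t : 'rV[C]_n) : torus t -> diag_mx t \is unitarymx.
Proof.
move=> t1; apply/unitarymxP; rewrite tr_diag_mx map_diag_mx mulmx_diag.
rewrite -diag_const_mx; congr diag_mx; apply/matrixP => i j; rewrite !mxE.
by rewrite -normCK t1 expr1n.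
Qed.

Lemma psi_diag n (t : 'rV[C]_n) (A : 'M[C]_n) : torus t -> A^t* = A ->
  psi (diag_mx t *m A *m (diag_mx t)^t*) = diag_mx t *m psi A *m (diag_mx t)^t*.
Proof.
elim: n t A => [|n IH] t A t1 AE; first by apply/matrixP => -[].
have t1' : torus (\row_i t 0 (widen_ord (leqnSn n) i)) by move=> i; rewrite mxE.
rewrite diag_blk; apply: psi_blk => //; first exact: diag_unitary.
by rewrite IH// top_herm.
Qed.

Lemma gzexp_diag n (t : 'rV[C]_n) (A : 'M[C]_n) : torus t -> A^t* = A ->
  gzexp (conjg_mx (diag_mx t) A) = conjg_mx (diag_mx t) (gzexp A).
Proof.
move=> t1 AE; have tu := diag_unitary t1.
by rewrite !conjg_unitary//; apply: gzexp_conj => //; exact: psi_diag.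
Qed.

End Corners.

(** * The action of the Gelfand-Zeitlin torus *)

Section TorusAction.
Variable R : realType.
Local Notation C := R[i].

Lemma extend_unitary k n (hk : (k <= n)%N) (Z : 'M[C]_k) : Z \is unitarymx ->
  extend hk 1 Z \is unitarymx.
Proof.
move=> Zu; elim/(@corner_ind k): n / hk => [hk|n hk hk' IH]; first by rewrite extend_full.
by rewrite (extend_top hk) blk_unitary// normr1.
Qed.

Lemma extend1 k n (hk : (k <= n)%N) : extend hk 1 1%:M = 1%:M :> 'M[C]_n.
Proof.
elim/(@corner_ind k): n / hk => [hk|n hk hk' IH]; first by rewrite extend_full.
by rewrite (extend_top hk) IH blk1.
Qed.

Lemma extendM k n (hk : (k <= n)%N) (Z Y : 'M[C]_k) :
  extend hk 1 Z *m extend hk 1 Y = extend hk 1 (Z *m Y).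
Proof.
elim/(@corner_ind k): n / hk => [hk|n hk hk' IH]; first by rewrite !extend_full.
by rewrite !(extend_top hk) blkM IH mulr1.
Qed.

Lemma top_blk_conj n (Z : 'M[C]_n) (A : 'M[C]_n.+1) :
  top (blk Z 1 *m A *m (blk Z 1)^t*) = Z *m top A *m Z^t*.
Proof. exact: (blk_conj Z 1 A).1. Qed.

Lemma corner_extend_conj k n (hk : (k <= n)%N) (Z : 'M[C]_k) (A : 'M[C]_n) :
  corner hk (extend hk 1 Z *m A *m (extend hk 1 Z)^t*) = Z *m corner hk A *m Z^t*.
Proof.
elim/(@corner_ind k): n / hk A => [hk|n hk hk' IH] A.
  by rewrite !extend_full !corner_full.
by rewrite (extend_top hk) !(corner_top hk) top_blk_conj IH.
Qed.

Lemma psi_extend k n (hk : (k <= n)%N) (Z Z' : 'M[C]_k) (A : 'M[C]_n) :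
  A^t* = A -> Z \is unitarymx ->
  psi (Z *m corner hk A *m Z^t*) = Z' *m psi (corner hk A) *m Z^t* ->
  psi (extend hk 1 Z *m A *m (extend hk 1 Z)^t*) =
  extend hk 1 Z' *m psi A *m (extend hk 1 Z)^t*.
Proof.
move=> AE Zu; elim/(@corner_ind k): n / hk A AE => [hk|n hk hk' IH] A AE.
  by rewrite !extend_full !corner_full.
rewrite (corner_top hk) !(extend_top hk) => pE; apply: psi_blk => //.
- exact: extend_unitary.
- exact: normr1.
- by apply: IH => //; exact: top_herm.
Qed.

Lemma chain_extend k n (hk : (k <= n)%N) (Z : 'M[C]_k) (A : 'M[C]_n) :
  Z \is unitarymx -> Z *m corner hk A *m Z^t* = corner hk A ->
  interlaced_chain A -> interlaced_chain (extend hk 1 Z *m A *m (extend hk 1 Z)^t*).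
Proof.
move=> Zu; elim/(@corner_ind k): n / hk A => [hk|n hk hk' IH] A.
  by rewrite !extend_full !corner_full => ->.
rewrite (corner_top hk) !(extend_top hk) => ZE [Ai Bi]; split; last first.
  by rewrite top_blk_conj; exact: IH.
have Eu := extend_unitary hk Zu; have Bu := blk_unitary Eu (normr1 C).
by move=> i; rewrite top_blk_conj !lam_unitary_conj.
Qed.

Lemma commute_diag n (V : 'M[C]_n) (d : 'I_n -> R) i j : injective d ->
  V *m diag_mx (\row_i (d i)%:C) = diag_mx (\row_i (d i)%:C) *m V -> i != j -> V i j = 0.
Proof.
move=> dI VE ij; have /matrixP/(_ i j) := VE; rewrite mul_mx_diag mul_diag_mx !mxE => h.
apply/eqP; rewrite -(inj_eq (mulfI (_ : (d j)%:C - (d i)%:C != 0))).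
  by rewrite mulr0 mulrBl mulrC h subrr.
by rewrite -rmorphB (inj_eq (@complexI _)) subr_eq0 (inj_eq dI) eq_sym.
Qed.

Lemma diagonalizers_quotient n (U W M D : 'M[C]_n) :
  U \is unitarymx -> W \is unitarymx -> U *m M *m U^t* = D -> W *m M *m W^t* = D ->
  (W *m U^t*) *m D = D *m (W *m U^t*).
Proof.
move=> Uu Wu UE WE; rewrite -{1}UE -WE !mulmxA (mulmx_adjK _ Uu).
by rewrite (mulmx_adjK _ Wu).
Qed.

(** When the spectrum is simple, two diagonalizers differ by a diagonal matrix. *)
Lemma diagonalizers_agree n (U W M : 'M[C]_n) (d : 'I_n -> R) (t : 'rV[C]_n) :
  U \is unitarymx -> W \is unitarymx -> injective d ->
  U *m M *m U^t* = diag_mx (\row_i (d i)%:C) ->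
  W *m M *m W^t* = diag_mx (\row_i (d i)%:C) ->
  U^t* *m diag_mx t *m U = W^t* *m diag_mx t *m W.
Proof.
move=> Uu Wu dI UE WE; pose V := W *m U^t*.
have VE := diagonalizers_quotient Uu Wu UE WE; rewrite -/V in VE.
have WV : W = V *m U by rewrite /V (mulmx_adjK _ Uu).
have VV : V^t* *m V = 1%:M.
  by rewrite /V adjmxM trmxCK !mulmxA (mulmx_adjK _ Wu) (unitarymxP Uu).
clearbody V.
have Vt : V *m diag_mx t = diag_mx t *m V.
  apply/matrixP => i j; rewrite mul_mx_diag mul_diag_mx !mxE.
  have [->|ij] := eqVneq i j; first by rewrite mulrC.
  by rewrite (commute_diag dI VE ij) mulr0 mul0r.
have -> : W^t* *m diag_mx t *m W = U^t* *m (V^t* *m (diag_mx t *m V)) *m U.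
  by rewrite WV adjmxM !mulmxA.
by rewrite -Vt (mulmxA (V^t*)) VV mul1mx.
Qed.

Section OneFactor.
Variables (k n : nat) (hk : (k <= n)%N).

Lemma gz_diagonalizerP (A : 'M[C]_n) : A^t* = A ->
  gz_diagonalizer hk A \is unitarymx /\
  gz_diagonalizer hk A *m corner hk A *m (gz_diagonalizer hk A)^t* =
    diag_mx (\row_i (lam (corner hk A) i)%:C).
Proof.
move=> AE; have BE := corner_herm hk AE; have Uu := eigbasis_unitary BE.
have dE : diag_mx (\row_i (gz_lambda A hk i)%:C) = diag_mx (\row_i (lam (corner hk A) i)%:C).
  by congr diag_mx; apply/matrixP => i j; rewrite !mxE gz_lambdaE.
pose D : set 'M[C]_k := [set U | U \is unitarymx /\
    conjg_mx U (corner hk A) = diag_mx (\row_i (gz_lambda A hk i)%:C)].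
have [|h1 h2] := @xgetPex _ 1%:M D.
  exists (eigbasis (corner hk A)); split=> //.
  rewrite conjg_unitary// dE; have := eigbasisE BE.
  move: (eigbasis _) Uu => U Uu BD; rewrite {1}BD !mulmxA (unitarymxP Uu) mul1mx.
  by rewrite -mulmxA (unitarymxP Uu) mulmx1.
by split=> //; rewrite -conjg_unitary// h2 dE.
Qed.

(** The unitary matrix, commuting with the corner of [A], by which [t] acts on [A]. *)
Definition gz_elem (t : 'rV[C]_k) (A : 'M[C]_n) : 'M[C]_k :=
  (gz_diagonalizer hk A)^t* *m diag_mx t *m gz_diagonalizer hk A.

Lemma gz_elem_unitary t A : A^t* = A -> torus t -> gz_elem t A \is unitarymx.
Proof.
move=> AE t1; have [Uu _] := gz_diagonalizerP AE.
apply: (mul_unitarymx _ Uu); apply: mul_unitarymx; last exact: diag_unitary.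
by rewrite trmxC_unitary.
Qed.

Lemma gz_act1E t A : A^t* = A -> torus t ->
  gz_act1 hk t A = extend hk 1 (gz_elem t A) *m A *m (extend hk 1 (gz_elem t A))^t*.
Proof.
move=> AE t1; have [Uu _] := gz_diagonalizerP AE.
rewrite /gz_act1 /= invmx_unitary// -/(gz_elem t A).
by apply: conjg_unitary; apply: extend_unitary; exact: gz_elem_unitary.
Qed.

Lemma gz_elem_corner t A : A^t* = A -> torus t ->
  gz_elem t A *m corner hk A *m (gz_elem t A)^t* = corner hk A.
Proof.
move=> AE t1; have [Uu UE] := gz_diagonalizerP AE; have tu := diag_unitary t1.
rewrite /gz_elem; set D := diag_mx _ in UE; move: (gz_diagonalizer hk A) Uu UE => U Uu UE.
have Vu : U^t* \is unitarymx by rewrite trmxC_unitary.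
have BD : corner hk A = U^t* *m D *m U.
  by rewrite -UE !mulmxA unitaryVmx// mul1mx (mulmx_adjK _ Uu).
have tD : diag_mx t *m D *m (diag_mx t)^t* = D.
  rewrite /D tr_diag_mx map_diag_mx !mulmx_diag; congr diag_mx.
  by apply/matrixP => i j; rewrite !mxE mulrAC -normCK t1 expr1n mul1r.
have h := unitary_conjM _ _ Vu; have h' := unitary_conj_adj (U^t*).
by rewrite trmxCK in h h'; rewrite BD h' !h tD.
Qed.

Lemma gz_act1_Herm0 t (A : 'M[C]_n) : Herm0 A -> torus t -> Herm0 (gz_act1 hk t A).
Proof.
move=> /Herm0P[AE Ac] t1; apply/Herm0P; rewrite gz_act1E//; split.
  exact: herm_conj.
by apply: chain_extend; rewrite ?gz_elem_unitary ?gz_elem_corner.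
Qed.

Lemma chain_corner (A : 'M[C]_n) : interlaced_chain A -> injective (lam (corner hk A)).
Proof.
move/chainP => h; case: k hk => [|m] hm; first by move=> [].
by move/lam_injP: (h m hm).
Qed.

(** [psi] of the corner carries a diagonalizer of the corner of [A] to one of the corner of
    [gzexp A], and therefore [gz_elem t A] to [gz_elem t (gzexp A)]. *)
Lemma gzexp_act1 t (A : 'M[C]_n) : Herm0 A -> torus t ->
  gzexp (gz_act1 hk t A) = gz_act1 hk t (gzexp A).
Proof.
move=> /Herm0P[AE Ac] t1; have BE := corner_herm hk AE; have GE := gzexp_herm AE.
rewrite !gz_act1E//; set Z := gz_elem t A.
have Zu : Z \is unitarymx by exact: gz_elem_unitary.
have Pu := psi_unitary BE; pose Z' := psi (corner hk A) *m Z *m (psi (corner hk A))^t*.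
rewrite (_ : gz_elem t (gzexp A) = Z'); last first.
  have [Uu UE] := gz_diagonalizerP AE; have [Wu WE] := gz_diagonalizerP GE.
  rewrite /gz_elem; set W := gz_diagonalizer hk (gzexp A) in Wu WE *.
  set U := gz_diagonalizer hk A in Uu UE *.
  pose U' := U *m (psi (corner hk A))^t*.
  have U'u : U' \is unitarymx by apply: (mul_unitarymx Uu); rewrite trmxC_unitary.
  have li : injective (lam (corner hk (gzexp A))).
    move=> i j; rewrite corner_gzexp// !lam_gzexp//= => /expR_inj.
    exact: chain_corner.
  have dE : diag_mx (\row_i (lam (corner hk (gzexp A)) i)%:C) =
      diag_mx (\row_i (expR (lam (corner hk A) i))%:C).
    congr diag_mx; apply/matrixP => i j; rewrite !mxE corner_gzexp// lam_gzexp//.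
  have AkE : corner hk A = U^t* *m diag_mx (\row_i (lam (corner hk A) i)%:C) *m U.
    by rewrite -UE !mulmxA unitaryVmx// mul1mx (mulmx_adjK _ Uu).
  have U'E : U' *m corner hk (gzexp A) *m U'^t* =
      diag_mx (\row_i (lam (corner hk (gzexp A)) i)%:C).
    rewrite dE corner_gzexp// gzexp.unlock /U' adjmxM trmxCK !mulmxA.
    rewrite (mulmx_adjK _ Pu) (mulmx_adjK _ Pu) (fc_diagonalized expR Uu AkE).1.
    by rewrite !mulmxA (unitarymxP Uu) mul1mx -mulmxA (unitarymxP Uu) mulmx1.
  rewrite -(diagonalizers_agree t U'u Wu li U'E WE).
  by rewrite /U' adjmxM trmxCK /Z' /Z /gz_elem -/U !mulmxA.
have pE : psi (Z *m corner hk A *m Z^t*) = Z' *m psi (corner hk A) *m Z^t*.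
  rewrite gz_elem_corner// /Z' (mulmx_adjK _ Pu) -mulmxA (unitarymxP Zu) mulmx1.
  by [].
apply: gzexp_conj => //; first exact: extend_unitary.
exact: psi_extend.
Qed.

End OneFactor.

Lemma gzexp_act n (A : 'M[C]_n) (t : forall k : 'I_n, 'rV[C]_k) : Herm0 A ->
  (forall k, torus (t k)) -> gzexp (gz_act t A) = gz_act t (gzexp A).
Proof.
move=> A0 t1; rewrite /gz_act; set F := fun (k : 'I_n) B => _.
have F0 k B : Herm0 B -> Herm0 (F k B) by move=> B0; exact: gz_act1_Herm0.
have FG k B : Herm0 B -> gzexp (F k B) = F k (gzexp B) by move=> B0; exact: gzexp_act1.
clearbody F; suff [] : Herm0 (foldr F A (enum 'I_n)) /\
  gzexp (foldr F A (enum 'I_n)) = foldr F (gzexp A) (enum 'I_n) by [].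
elim: (enum _) => [|k s [IH1 IH2]]; first by split.
by split; [exact: F0|rewrite /= FG// IH2].
Qed.

End TorusAction.

(** * Topology of the matrix spaces *)

Section Topology.
Variable R : realType.
Local Notation C := R[i].

Lemma normC_abs2 (z : C) : `|z| = (Num.sqrt (abs2 z))%:C.
Proof. by case: z => a b; rewrite normc_def. Qed.

Lemma mC_continuous (V : normedModType R) (D : set V) m n (F : V -> 'M[C]_(m, n)) x :
  mC D 0 F -> D x -> {for x, continuous F}.
Proof.
move=> Fc Dx; apply/cvg_ballP => e e0.
have eE : e = (complex.Re e)%:C by rewrite RRe_real// gtr0_real.
have re0 : 0 < complex.Re e by rewrite -ltcR -eE.
have := abs1_continuous Fc Dx re0; apply: filterS => y Fy; split=> // i j.
rewrite -ball_normE /= distrC normC_abs2 eE ltcR (le_lt_trans _ Fy)//.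
by have := abs1_entry (F y - F x) i j; rewrite !mxE.
Qed.

Lemma hcoord_continuous n : continuous (@hcoord R n).
Proof.
move=> A; have FF := nbhs_filter A; apply/cvg_ballP => e e0; have e20 : 0 < e / 2 by rewrite divr_gt0.
have [ce0 ceE] : 0 < (e / 2)%:C /\ True by rewrite ltcR.
have := nbhsx_ballx A _ ce0; apply: filterS => B [_ AB]; split=> // i j.
have := AB i j; rewrite -!ball_normE /= normC_abs2 ltcR.
have h1 := Re_le_sqrt (A i j - B i j); have h2 := Im_le_sqrt (A i j - B i j).
move: (Num.sqrt _) h1 h2 => s; rewrite ReD ImD ReN ImN !mxE => h1 h2 h3.
rewrite opprD addrACA (le_lt_trans (ler_normD _ _))// [e]splitr ltrD//.
  exact: le_lt_trans h3.
exact: le_lt_trans h3.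
Qed.

Lemma within_Herm_comp n (g : 'M[C]_n -> 'M[C]_n) :
  {within Herm R n, continuous g} <-> continuous (g \o @hmat R n).
Proof.
split=> gc.
  move=> X; have h := (subspace_continuousP (Herm R n) g).1 gc _ (hmat_Herm X).
  move=> U /h; rewrite /= => hU.
  have := mC_continuous (mC_hmat 0 openT) (I : setT X) hU.
  rewrite /= => hV; have h' : \forall Y \near X, Herm R n (hmat Y) -> (g @^-1` U) (hmat Y).
    exact: hV.
  by move: h'; apply: filterS => Y; apply; exact: hmat_Herm.
apply: (@subspace_eq_continuous _ _ _ ((g \o @hmat R n) \o @hcoord R n)).
  by move=> A /set_mem AH; rewrite /from_subspace /= hcoordK.
apply: continuous_subspaceT => A; apply: continuous_comp; last exact: gc.
exact: hcoord_continuous.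
Qed.

Lemma hermD_hmat n (D : set 'M[R]_n) : hermD D (@hmat R n).
Proof. by move=> X _; exact: hmat_herm. Qed.

Lemma gzexp_continuous n : {within Herm R n, continuous (@gzexp R n)}.
Proof.
apply/within_Herm_comp => X; apply: (mC_continuous _ (I : setT X)).
by apply: mC_gzexp; [exact: openT|exact: hermD_hmat|exact: mC_hmat openT].
Qed.

Lemma class_CZ (V W : normedModType R) k (D : set V) (f : V -> R) (w : W) : open D ->
  class_C k D f -> class_C k D (fun x => f x *: w).
Proof.
move=> oD; elim: k f => [|k IH] f /=.
  by move=> fc x Dx; apply: cvgZr_tmp; exact: fc.
move=> [fd fk]; split=> [x Dx|v].
  by apply: differentiableZl; exact: fd.
apply: (class_C_ext (f := fun x => 'D_v f x *: w)) => //; last exact: IH.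
move=> x Dx; rewrite !deriveE ?diffZl//; try exact: fd.
by apply: differentiableZl; exact: fd.
Qed.

Lemma class_C_mx (V : normedModType R) k (D : set V) n (F : V -> 'M[R]_n) : open D ->
  (forall i j, class_C k D (fun x => F x i j)) -> class_C k D F.
Proof.
move=> oD Fk; apply: (class_C_ext (f := fun x =>
  \sum_(p : 'I_n * 'I_n) F x p.1 p.2 *: delta_mx p.1 p.2)) => //.
  move=> x _; rewrite [RHS]matrix_sum_delta pair_big /=.
  by apply: eq_bigr.
by apply: class_C_sum => // p; exact: class_CZ.
Qed.

Lemma Herm_smoothP n (D : set 'M[C]_n) (f : 'M[C]_n -> 'M[C]_n) :
  open (@hmat R n @^-1` D) -> (forall k, mC (@hmat R n @^-1` D) k (f \o @hmat R n)) ->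
  Herm_smooth D f.
Proof.
move=> oD fk k; apply: class_C_mx => // i j; have [fR fI] := fk k i j.
apply: (class_C_ext (f := fun X => complex.Re ((f \o @hmat R n) X i j) +
  complex.Im ((f \o @hmat R n) X i j))) => // [X _|]; last exact: class_CD.
by rewrite /hcoord !mxE.
Qed.

Lemma gzexp_diffeo n : Herm_diffeo (Herm R n) (Herm_pos R n) (@gzexp R n).
Proof.
have preT : @hmat R n @^-1` Herm R n = setT.
  by apply/seteqP; split=> X // _; exact: hmat_Herm.
have preP : @hmat R n @^-1` Herm_pos R n = [set X | pos (hmat X)].
  by apply/seteqP; split=> X /=; rewrite Herm_posP.
split; last split.
- split.
  + by move=> A /HermP AE; apply/Herm_posP; exact: gzexp_pos.
  + move=> A B /set_mem/HermP AE /set_mem/HermP BE AB.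
    by rewrite -(gzlogK AE) AB gzlogK.
  + move=> P /Herm_posP Pp; exists (gzlog P); last exact: gzexpK.
    by apply/HermP; exact: gzlog_herm.
- apply: Herm_smoothP; rewrite preT; first exact: openT.
  by move=> k; apply: mC_gzexp; [exact: openT|exact: hermD_hmat|exact: mC_hmat openT].
exists (@gzlog R n); first by move=> A /set_mem/HermP; exact: gzlogK.
apply: Herm_smoothP; rewrite preP; first exact: pos_open.
move=> k; apply: mC_gzlog => //; first exact: pos_open.
by apply: mC_hmat; exact: pos_open.
Qed.

Lemma scalar0 n : (0 : R)%:C%:M = 0 :> 'M[C]_n.
Proof. by rewrite -scalemx1 rmorph0 scale0r. Qed.

Lemma lam_affine n (X : 'M[C]_n) (a b : R) i : X^t* = X -> 0 <= a ->
  lam (a%:C *: X + b%:C%:M) i = a * lam X i + b.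
Proof.
move=> XE a0; have YE : (a%:C *: X + b%:C%:M)^t* = a%:C *: X + b%:C%:M.
  by rewrite hermDscalar// hermZ.
rewrite -{1}(fc_id YE) fc_affine// (lam_fc (h := fun x => a * x + b))// => x y xy.
by rewrite lerD2r ler_wpM2l.
Qed.

Lemma top_affine n (X : 'M[C]_n.+1) (a b : R) :
  top (a%:C *: X + b%:C%:M) = a%:C *: top X + b%:C%:M.
Proof. by rewrite top_shift top.unlock -scalemxAr -scalemxAl. Qed.

Lemma chain_affine n (X : 'M[C]_n) (a b : R) : X^t* = X -> 0 < a ->
  interlaced_chain X -> interlaced_chain (a%:C *: X + b%:C%:M).
Proof.
elim: n X => [|n IH] X //= XE a0 [Xi Xc]; have BE := top_herm XE.
split; last by rewrite top_affine; exact: IH.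
move=> i; rewrite top_affine !lam_affine ?ltW//.
by have [h1 h2] := Xi i; rewrite !ltrD2r !ltr_pM2l.
Qed.

Lemma chain_gzexp n (X : 'M[C]_n) : X^t* = X -> interlaced_chain X ->
  interlaced_chain (gzexp X).
Proof.
elim: n X => [|n IH] X //= XE [Xi Xc]; have BE := top_herm XE.
split; last by rewrite top_gzexp//; exact: IH.
move=> i; rewrite top_gzexp// !lam_gzexp//=.
by have [h1 h2] := Xi i; rewrite !ltr_expR.
Qed.

Lemma realmxP n (A : 'M[C]_n) : A \is a realmx <-> map_mx Num.conj A = A.
Proof.
split=> [/realmxC//|h]; apply/mxOverP => i j; rewrite CrealE.
by apply/eqP; have /matrixP/(_ i j) := h; rewrite mxE.
Qed.

Lemma Sym0P n (A : 'M[C]_n) : Sym0 A <->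
  [/\ A^t* = A, interlaced_chain A & map_mx Num.conj A = A].
Proof.
split=> [[/Herm0P[AE Ac] /realmxP Ar]|[AE Ac Ar]]; first by [].
by split; [exact/Herm0P|exact/realmxP].
Qed.

(** The function [(exp (s x) - 1) / s + s] of [x] is the identity for [s = 0] and [exp] for
    [s = 1]. Conjugated by [psi (s A)] it gives a path from [A] to [gzexp A] that stays in
    Sym_0, being an affine function of [gzexp (s A)] for [s > 0]. *)
Definition gzpath n (A : 'M[C]_n) (s : R^o) : 'M[C]_n :=
  psi (s%:C *: A) *m (fc2 (@expdd R) (s%:C *: A) 0 A + s%:C%:M) *m (psi (s%:C *: A))^t*.

Lemma gzpath0 n (A : 'M[C]_n) : A^t* = A -> gzpath A 0 = A.
Proof.
move=> AE; rewrite /gzpath rmorph0 scale0r psi0 mul1mx adjmx1 mulmx1 raddf0 addr0.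
rewrite (fc2_ext (K' := fun _ _ => 1)) => [|i j]; last by rewrite !lam0 expdd_diag expR0.
by rewrite fc2_cst ?herm0// scale1r.
Qed.

Lemma gzpathE n (A : 'M[C]_n) (s : R) : A^t* = A -> s != 0 ->
  gzpath A s = (s^-1)%:C *: gzexp (s%:C *: A) + (s - s^-1)%:C%:M.
Proof.
move=> AE s0; have sE := hermZ s AE; have zE := herm0 R n.
have dd : s%:C *: fc2 (@expdd R) (s%:C *: A) 0 A = fc expR (s%:C *: A) - 1%:M.
  have /= := fc_increment sE zE (@expdd_eq R).
  rewrite subr0 (fc_ext (A := 0) (h := fun=> 1)) => [|i]; last by rewrite lam0 expR0.
  rewrite fc_cst// => ->; rewrite fc2_delta// [in RHS]fc2_delta// scaler_sumr.
  by apply: eq_bigr => p _; rewrite mxE scalerA.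
have {}dd : fc2 (@expdd R) (s%:C *: A) 0 A = (s^-1)%:C *: (fc expR (s%:C *: A) - 1%:M).
  by rewrite -dd scalerA -rmorphM mulVf// scale1r.
rewrite /gzpath dd gzexp.unlock; set Y := s%:C *: A in sE *; set P := psi Y.
have PP : P *m P^t* = 1%:M by exact: psiKV.
rewrite mulmxDr mulmxDl mul_mx_scalar -scalemxAl PP -scalemxAr -scalemxAl.
rewrite mulmxBr mulmxBl mulmx1 PP scalerBr -addrA; congr (_ + _).
by rewrite !scalemx1 -raddfN -raddfD /= addrC -rmorphB.
Qed.

Lemma gzpath1 n (A : 'M[C]_n) : A^t* = A -> gzpath A 1 = gzexp A.
Proof.
move=> AE; rewrite gzpathE ?oner_neq0// invr1 subrr scale1r scalar0 addr0.
by rewrite scale1r.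
Qed.

Lemma gzpath_Sym0 n (A : 'M[C]_n) (s : R) : Sym0 A -> 0 <= s -> Sym0 (gzpath A s).
Proof.
move=> As; have /Sym0P[AE Ac Ar] := As; rewrite le_eqVlt => /predU1P[<-|s0].
  by rewrite gzpath0.
have sE := hermZ s AE; have GE := gzexp_herm sE.
have sc : interlaced_chain (s%:C *: A).
  by have := chain_affine 0 AE s0 Ac; rewrite scalar0 addr0.
have sr : map_mx Num.conj (s%:C *: A) = s%:C *: A by rewrite map_mxZ /= conjC_real Ar.
rewrite gzpathE ?gt_eqF//; apply/Sym0P; split.
- by rewrite hermDscalar// hermZ.
- by apply: chain_affine; rewrite ?invr_gt0//; exact: chain_gzexp.
- have := gzexp_map_conj sE; rewrite sr; move: (gzexp _) => G GE'.
  by rewrite map_mxD map_mxZ -GE' map_scalar_mx; congr (_ *: _ + _%:M); exact: conjC_real.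
Qed.

Lemma gzpath_continuous n (A : 'M[C]_n) : A^t* = A -> continuous (gzpath A : R^o -> 'M[C]_n).
Proof.
move=> AE s; have oT := @openT R^o.
have sAk : mC setT 0 (fun s : R^o => s%:C *: A).
  apply: mCZ => //; last exact: mC_cst.
  by apply: cC_real => x _; exact: cvg_id.
have sAh : hermD [set: R^o] (fun s : R^o => s%:C *: A) by move=> x _; exact: hermZ.
apply: (mC_continuous (D := setT) (F := gzpath A) _ I).
have pk := mC_psi oT sAh sAk.
apply: mCM => //; last exact: mC_adj.
apply: mCM => //; apply: mCD => //.
  by apply: mC_fc2_expdd => //; [move=> x _; exact: herm0|exact: mC_cst|exact: mC_cst].
by apply: mC_scalar => //; apply: cC_real => x _; exact: cvg_id.
Qed.

Lemma gzexp_components n : preserves_Sym0_components (@gzexp R n).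
Proof.
move=> A As _ [X XA <-]; have Xs : Sym0 X := connected_component_sub XA.
have XE : X^t* = X by case/Sym0P: Xs.
rewrite (same_connected_component XA).
have Pc : connected (gzpath X @` `[(0 : R), 1]).
  apply: connected_continuous_connected; first exact: segment_connected.
  by apply: continuous_subspaceT; exact: gzpath_continuous.
apply: (connected_component_max _ _ Pc).
- by exists 0; [rewrite /= in_itv /= lexx ler01|exact: gzpath0].
- by move=> _ [s /= /itvP s01 <-]; apply: gzpath_Sym0 => //; rewrite s01.
- by exists 1; [rewrite /= in_itv /= lexx ler01|exact: gzpath1].
Qed.

End Topology.

(** * Uniqueness *)

Section SymComponents.
Variable R : realType.
Local Notation C := R[i].

Lemma lam_continuous (V : normedModType R) (D : set V) n (B : V -> 'M[C]_n) i :
  open D -> hermD D B -> mC D 0 B -> class_C 0 D (fun x => lam (B x) i).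
Proof.
move=> oD Bh Bc x Dx; apply/cvgrPdist_lt => e e0.
have := lam_near oD Bh Bc Dx e0; apply: filterS => y /(_ i).
by rewrite distrC.
Qed.

Lemma mC_fc_prod (V : normedModType R) (D : set V) n (B : V -> 'M[C]_n) (r : seq 'I_n) :
  open D -> hermD D B -> mC D 0 B ->
  mC D 0 (fun x => fc (fun s => \prod_(j <- r) (s - lam (B x) j)) (B x)).
Proof.
move=> oD Bh Bc; elim: r => [|j r IH].
  apply: (mC_ext oD (F := fun=> 1%:M)); last exact: mC_cst.
  by move=> x Dx; rewrite (fc_ext (h := fun=> 1)) ?fc_cst ?Bh// => i; rewrite big_nil.
apply: (mC_ext oD (F := fun x => (B x - (lam (B x) j)%:C%:M) *m
  fc (fun s => \prod_(j <- r) (s - lam (B x) j)) (B x))).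
  move=> x Dx; have BE := Bh x Dx.
  rewrite -{1}(fc_id BE) -(fc_cst _ BE) fcB// fcM//.
  by apply: fc_ext => i; rewrite big_cons.
apply: mCM => //; apply: mCD => //; apply: mCN => //; apply: mC_scalar => //.
by apply: cC_real => //; exact: lam_continuous.
Qed.

(** Up to the factor in [border_signE] this is the [i]th coordinate of the border in an
    eigenbasis of the corner; contrary to the eigenbasis it is continuous. *)
Definition border_sign n (i : 'I_n.+1) (X : 'M[C]_n.+2) : C :=
  ((elast n)^t* *m fc (fun s => \prod_(j <- rem i (enum 'I_n.+1)) (s - lam (top X) j)) (top X)
     *m border X) 0 0.

Lemma rem_root n (i l : 'I_n) (y : 'I_n -> R) : l != i ->
  \prod_(j <- rem i (enum 'I_n)) (y l - y j) = 0.
Proof.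
move=> li; have lr : l \in rem i (enum 'I_n).
  by rewrite (mem_rem_uniq _ (enum_uniq _)) inE li mem_enum.
by rewrite (big_rem l lr) /= subrr mul0r.
Qed.

Definition sign_factor n (i : 'I_n.+1) (B : 'M[C]_n.+1) : C :=
  ((elast n)^t* *m (eigbasis B)^t*) 0 i *
  (\prod_(j <- rem i (enum 'I_n.+1)) (lam B i - lam B j))%:C.

Lemma border_signE n (i : 'I_n.+1) (X : 'M[C]_n.+2) :
  border_sign i X = sign_factor i (top X) * (eigbasis (top X) *m border X) i 0.
Proof.
rewrite /border_sign fc.unlock !mulmxA -(mulmxA _ _ (border X)) mul_mx_diag.
rewrite mxE (bigD1 i)//= big1 => [|l li].
  by rewrite addr0 [X in X * _]mxE [X in _ * X * _]mxE.
by rewrite [X in X * _]mxE [X in _ * X * _]mxE rem_root// mulr0 mul0r.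
Qed.

(** An eigenvector of a corner whose last coordinate vanishes is an eigenvector of
    the preceding corner. *)
Lemma eigvec_last n (B : 'M[C]_n.+1) (v : 'cV[C]_n.+1) i : B^t* = B -> strictly_interlaced B ->
  v != 0 -> B *m v = (lam B i)%:C *: v -> (elast n)^t* *m v != 0.
Proof.
move=> BE Bi v0 vx; apply/eqP => ev.
have vE : v = (proj n)^t* *m (proj n *m v).
  by apply: border_ext; rewrite !mulmxA ?projKV ?mul1mx// elast_projC !mul0mx ev.
have pv0 : proj n *m v != 0 by apply: contraNneq v0 => e; rewrite vE e mulmx0.
have [|l] := eigenvector_lam (top_herm BE) pv0 (x := lam B i).
  by rewrite top.unlock -mulmxA -vE -mulmxA vx scalemxAr.
by move/eqP; rewrite (negPf (interlaced_neq Bi _ _)).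
Qed.

Lemma sign_factor_neq0 n (i : 'I_n.+1) (B : 'M[C]_n.+1) : B^t* = B -> strictly_interlaced B ->
  sign_factor i B != 0.
Proof.
move=> BE Bi; rewrite mulf_neq0//; last first.
  rewrite (inj_eq (@complexI R) _ 0) prodf_seq_neq0; apply/allP => j.
  rewrite (mem_rem_uniq _ (enum_uniq _)) inE => /andP[ji _] /=.
  by rewrite subr_eq0 (inj_eq (lam_injP Bi)) eq_sym.
have v0 : col i ((eigbasis B)^t*) != 0.
  apply/eqP => /(congr1 (mulmx (eigbasis B))); rewrite -colM eigbasisKV// mulmx0.
  by move/matrixP/(_ i 0); rewrite !mxE eqxx => /eqP; rewrite oner_eq0.
have := eigvec_last BE Bi v0 (eigbasis_col BE i); rewrite -colM.
apply: contraNneq => h; apply/eqP/matrixP => a b; rewrite !ord1 !mxE.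
by rewrite mxE in h.
Qed.

Lemma border_map_conj n (A : 'M[C]_n.+1) :
  border (map_mx Num.conj A) = map_mx Num.conj (border A).
Proof. by rewrite border.unlock !map_mxM proj_real elast_real. Qed.

Lemma border_sign_real n (i : 'I_n.+1) (X : 'M[C]_n.+2) : X^t* = X ->
  map_mx Num.conj X = X -> complex.Im (border_sign i X) = 0.
Proof.
move=> XE Xr; have BE := top_herm XE.
have Br : map_mx Num.conj (top X) = top X by rewrite -top_map_conj Xr.
have br : map_mx Num.conj (border X) = border X by rewrite -border_map_conj Xr.
rewrite /border_sign; set h := fun s => _.
have hr : map_mx Num.conj (fc h (top X)) = fc h (top X) by rewrite -fc_map_conj// Br.
move: (fc h _) (border X) hr br => P b Pr br.
have Mr : map_mx Num.conj ((elast n)^t* *m P *m b) = (elast n)^t* *m P *m b.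
  by rewrite !map_mxM br Pr -adj_map_conj elast_real.
by have /matrixP/(_ 0 0) := Mr; rewrite mxE; case: (_ 0 0) => x y [] /=; lra.
Qed.

Lemma border_sign_continuous n (i : 'I_n.+1) :
  continuous (fun X : 'M[R]_n.+2 => complex.Re (border_sign i (hmat X))).
Proof.
have hk : mC [set: 'M[R]_n.+2] 0 (@hmat R n.+2) by exact: mC_hmat openT.
 have hh := @hermD_hmat R n.+2 setT.
have Bk := mC_top openT hk; have Bh := hermD_top hh.
have := mC_fc_prod (rem i (enum 'I_n.+1)) openT Bh Bk => pk.
suff : mC [set: 'M[R]_n.+2] 0 (fun X => (elast n)^t* *m
   fc (fun s => \prod_(j <- rem i (enum 'I_n.+1)) (s - lam (top (hmat X)) j)) (top (hmat X))
     *m border (hmat X)).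
  by move=> /(_ 0 0)[+ _] X => /(_ X I).
have bk := mC_border openT hk.
by apply: mCM; [exact: openT| |exact: bk]; apply: mCM; [exact: openT|exact: mC_cst|exact: pk].
Qed.

Lemma top_continuous n : continuous (@top R n).
Proof.
move=> A; have FF := nbhs_filter A; apply/cvg_ballP => e e0.
have := nbhsx_ballx A _ e0; apply: filterS => B [_ AB]; split=> // i j.
by rewrite !topE !mxE; exact: AB.
Qed.

Lemma connected_neq0_sign (E : set R) x y : connected E -> E x -> E y ->
  (forall z, E z -> z != 0) -> x ^+ 2 = y ^+ 2 -> x = y.
Proof.
move=> /connected_intervalP Ei Ex Ey E0 /eqP; rewrite eqf_sqr => /orP[/eqP//|/eqP xy].
have [] : ~ E 0 by move=> /E0; rewrite eqxx.
have [y0|y0] := leP 0 y.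
  by apply: (Ei _ _ Ex Ey); rewrite xy oppr_le0 y0.
by apply: (Ei _ _ Ey Ex); rewrite xy oppr_ge0 ltW.
Qed.

(** The corners agree by induction. The coordinates of the borders agree up to sign by the
    secular equation, and the sign is constant on [S] by continuity of [border_sign]. *)
Lemma gz_lambda_inj n (S : set 'M[C]_n) A A' : connected S -> S `<=` Sym0 (n := n) ->
  S A -> S A' -> (forall k (hk : (k <= n)%N), lam (corner hk A) = lam (corner hk A')) ->
  A = A'.
Proof.
elim: n S A A' => [|n IH] S A A' Sc SS SA SA' lAA'; first by apply/matrixP => -[].
have [AE [Ai Ac] Ar] := (Sym0P _).1 (SS _ SA); have BE := top_herm AE.
have [A'E [A'i A'c] A'r] := (Sym0P _).1 (SS _ SA').
have tE : top A = top A'.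
  apply: (IH (@top R n @` S)).
  - apply: connected_continuous_connected => //.
    by apply: continuous_subspaceT; exact: top_continuous.
  - move=> _ [X /SS/Sym0P[XE [_ Xc] Xr] <-]; apply/Sym0P; split=> //.
      exact: top_herm.
    by rewrite -top_map_conj Xr.
  - by exists A.
  - by exists A'.
  - by move=> k hk; have := lAA' k (leqW hk); rewrite !(corner_top hk).
have lE : lam A = lam A' by have := lAA' _ (leqnn _); rewrite !corner_full.
have trE : \tr A = \tr A'.
  rewrite -(fc_id AE) -(fc_id A'E) !fc_trace//; congr (_%:C).
  by apply: eq_bigr => i _; rewrite lE.
apply: herm_ext => //.
(* border_sign requires a corner of positive size *)
case: n => [|n] in IH S A A' Sc SS SA SA' lAA' AE Ai Ac Ar BE A'E A'i A'c A'r tE lE trE *.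
  by apply/matrixP => -[].
rewrite -[LHS]mul1mx -[RHS]mul1mx -(eigbasisVK BE) -!mulmxA; congr (_ *m _).
apply/matrixP => i j; rewrite ord1 {j}.
have Bi := lam_injP Ac.1.
have K0 := sign_factor_neq0 i BE Ac.1.
apply: (mulfI K0); rewrite -border_signE tE -border_signE.
have aE : abs2 ((eigbasis (top A) *m border A) i 0) =
    abs2 ((eigbasis (top A) *m border A') i 0).
  have q0 : \prod_(k | k != i) (lam (top A) i - lam (top A) k) != 0.
    by apply/prodf_neq0 => k ki; rewrite subr_eq0 (inj_eq Bi) eq_sym.
  apply/oppr_inj/(mulIf q0); rewrite -secular_eq// {1 3}tE [RHS](_ : _ =
    - abs2 ((eigbasis (top A') *m border A') i 0) *
    \prod_(k | k != i) (lam (top A') i - lam (top A') k)); last by rewrite tE.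
  by rewrite -secular_eq// lE.
have sI := border_sign_real i AE Ar; have sI' := border_sign_real i A'E A'r.
suff : complex.Re (border_sign i A) = complex.Re (border_sign i A').
  by case: (border_sign i A) (border_sign i A') sI sI' => [a b] [c d] /= -> -> ->.
pose F (X : 'M[R]_n.+2) := complex.Re (border_sign i (hmat X)).
have Fh X : S X -> F (hcoord X) = complex.Re (border_sign i X).
  by case/SS/Sym0P => XE _ _; rewrite /F hcoordK//; exact/HermP.
apply: (@connected_neq0_sign (F @` (@hcoord R n.+2 @` S))).
- apply: connected_continuous_connected; last first.
    by apply: continuous_subspaceT; exact: border_sign_continuous.
  apply: connected_continuous_connected => //.
  by apply: continuous_subspaceT; exact: hcoord_continuous.
- by exists (hcoord A); [exists A|exact: Fh].
- by exists (hcoord A'); [exists A'|exact: Fh].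
- move=> _ [_ [X SX <-] <-]; rewrite Fh//; have [XE [Xi Xc] Xr] := (Sym0P _).1 (SS _ SX).
  have := border_sign_real i XE Xr.
  have : border_sign i X != 0.
    rewrite border_signE mulf_neq0//.
      by apply: sign_factor_neq0; [exact: top_herm|exact: Xc.1].
    exact: (strictP XE (lam_injP Xc.1)).1 Xi i.
  case: (border_sign i X) => a b /= h b0; apply: contraNneq h => a0.
  by rewrite a0 b0.
have abs2_Re (z : C) : complex.Im z = 0 -> complex.Re z ^+ 2 = abs2 z.
  by move=> z0; rewrite /abs2 z0 expr0n addr0.
rewrite (abs2_Re _ sI) (abs2_Re _ sI') !border_signE -tE.
by rewrite !abs2M aE.
Qed.

End SymComponents.

Section Uniqueness.
Variable R : realType.
Local Notation C := R[i].

Lemma pos_corner k n (hk : (k <= n)%N) (P : 'M[C]_n) : pos P -> pos (corner hk P).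
Proof.
elim/(@corner_ind k): n / hk P => [hk|n hk hk' IH] P Pp; first by rewrite corner_full.
by rewrite (corner_top hk); apply: IH; exact: pos_top.
Qed.

Lemma gz_mu_inj n (P Q : 'M[C]_n) : pos P -> pos Q -> gz_mu P = gz_mu Q ->
  forall k (hk : (k <= n)%N), lam (corner hk P) = lam (corner hk Q).
Proof.
move=> Pp Qp PQ k hk; apply: funext => i.
have := congr1 (fun x : gz_array R n => x k hk i) PQ; rewrite /gz_mu !gz_lambdaE.
by apply: ln_inj; rewrite posrE; [case: (pos_corner hk Pp)|case: (pos_corner hk Qp)].
Qed.

Section SingleFactor.
Variable n : nat.

Lemma gz_act1_unit k (hk : (k <= n)%N) (t : 'rV[C]_k) (A : 'M[C]_n) : A^t* = A ->
  (forall i, t 0 i = 1) -> gz_act1 hk t A = A.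
Proof.
move=> AE t1; have tt : torus t by move=> i; rewrite t1 normr1.
have [Uu _] := gz_diagonalizerP hk AE.
rewrite gz_act1E// /gz_elem (_ : diag_mx t = 1%:M).
  by rewrite mulmx1 unitaryVmx// extend1 mul1mx adjmx1 mulmx1.
rewrite -diag_const_mx; congr diag_mx; apply/matrixP => i j.
by rewrite ord1 t1 mxE.
Qed.

Lemma gz_act1_herm k (hk : (k <= n)%N) (t : 'rV[C]_k) (A : 'M[C]_n) : A^t* = A -> torus t ->
  (gz_act1 hk t A)^t* = gz_act1 hk t A.
Proof. by move=> AE t1; rewrite gz_act1E// herm_conj. Qed.

(** All the other factors are given the value [1]. *)
Lemma gz_act_single (m : 'I_n) (t : 'rV[C]_m) : torus t ->
  exists2 T : forall k : 'I_n, 'rV[C]_k, (forall k, torus (T k)) &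
    forall A, A^t* = A -> gz_act T A = gz_act1 (ltnW (ltn_ord m)) t A.
Proof.
move=> t1; pose tau (i : nat) : C := if insub i is Some i then t 0 i else 1.
have tauE (i : 'I_m) : tau i = t 0 i by rewrite /tau valK.
pose T (k : 'I_n) : 'rV[C]_k := \row_i (if k == m then tau i else 1).
have Tm : T m = t by apply/matrixP => i j; rewrite ord1 mxE eqxx tauE.
have T1 k : k != m -> forall i, T k 0 i = 1 by move=> km i; rewrite mxE (negPf km).
have Tt k : torus (T k).
  have [->|km] := eqVneq k m; first by rewrite Tm.
  by move=> i; rewrite T1// normr1.
exists T => // A AE; rewrite /gz_act.
set F := fun (k : 'I_n) B => _.
have F1 k B : k != m -> B^t* = B -> F k B = B.
  by move=> km BE; apply: gz_act1_unit => //; exact: T1.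
have Fm : F m = gz_act1 (ltnW (ltn_ord m)) t by rewrite /F Tm.
rewrite -Fm.
have FE B : B^t* = B -> (F m B)^t* = F m B by move=> BE; rewrite Fm gz_act1_herm.
clearbody F.
have notin s : m \notin s -> foldr F A s = A.
  elim: s => [//|k s IH]; rewrite inE negb_or eq_sym => /andP[km ms] /=.
  by rewrite IH// F1.
have : uniq (enum 'I_n) by exact: enum_uniq.
have : m \in enum 'I_n by rewrite mem_enum.
elim: (enum _) => [//|k s IH]; rewrite inE /= => /orP[/eqP <-|ms] /andP[ks us].
  by rewrite notin.
rewrite IH// F1 ?FE//; apply: contraNneq ks => ->; exact: ms.
Qed.

Lemma gz_elem_eq k (hk : (k <= n)%N) (t : 'rV[C]_k) (A B : 'M[C]_n) :
  corner hk A = corner hk B -> gz_elem hk t A = gz_elem hk t B.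
Proof. by move=> AB; rewrite /gz_elem /gz_diagonalizer /gz_lambda AB. Qed.

Lemma gz_act1K k (hk : (k <= n)%N) (t : 'rV[C]_k) (A : 'M[C]_n) : A^t* = A -> torus t ->
  gz_act1 hk (map_mx Num.conj t) (gz_act1 hk t A) = A.
Proof.
move=> AE t1; have t1' : torus (map_mx Num.conj t) by move=> i; rewrite mxE norm_conjC.
have A'E := gz_act1_herm hk AE t1.
have ZE : gz_elem hk (map_mx Num.conj t) (gz_act1 hk t A) = gz_elem hk (map_mx Num.conj t) A.
  by apply: gz_elem_eq; rewrite gz_act1E// corner_extend_conj gz_elem_corner.
have E1 := gz_act1E hk A'E t1'; have E2 := gz_act1E hk AE t1.
rewrite E1 ZE E2 {E1 E2 ZE A'E}; set Z := gz_elem hk t A; set Y := gz_elem hk _ A.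
have YE : Y = Z^t*.
  rewrite /Y /Z /gz_elem adjmxM adjmxM trmxCK tr_diag_mx map_diag_mx mulmxA.
  by [].
have Eu := extend_unitary hk (gz_elem_unitary hk AE t1); rewrite -/Z in Eu.
have EY : extend hk 1 Y = (extend hk 1 Z)^t*.
  have YZ : Y *m Z = 1%:M by rewrite YE unitaryVmx// gz_elem_unitary.
  rewrite -[LHS]mulmx1 -(unitarymxP Eu) mulmxA extendM YZ extend1 mul1mx.
  by [].
by rewrite EY trmxCK unitary_conjK.
Qed.

End SingleFactor.

Lemma corner_extend_sub k j n (hkj : (k <= j)%N) (hj : (j <= n)%N) (hk : (k <= n)%N)
    (Z : 'M[C]_k) (A : 'M[C]_n) :
  corner hj (extend hk 1 Z *m A *m (extend hk 1 Z)^t*) =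
  extend hkj 1 Z *m corner hj A *m (extend hkj 1 Z)^t*.
Proof.
elim/(@corner_ind j): n / hj hk A => [hj|n hj hj' IH] hk A.
  by rewrite !corner_full (bool_irrelevance hk hkj).
rewrite !(corner_top hj) (extend_top (leq_trans hkj hj)) top_blk_conj.
exact: IH.
Qed.

(** Phases making the border real: the conjugate of a diagonalizer of a real matrix
    with simple spectrum differs from it by phases, whose square roots are used. *)
Lemma real_phases m (B U : 'M[C]_m) (b : 'cV[C]_m) (y : 'I_m -> R) :
  U \is unitarymx -> U *m B *m U^t* = diag_mx (\row_i (y i)%:C) -> injective y ->
  map_mx Num.conj B = B ->
  exists2 t : 'rV[C]_m, torus t &
    map_mx Num.conj (U^t* *m diag_mx t *m U *m b) = U^t* *m diag_mx t *m U *m b.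
Proof.
move=> Uu UE yI Br; pose U' := map_mx Num.conj U.
have U'u : U' \is unitarymx.
  apply/unitarymxP; rewrite /U' adj_map_conj -map_mxM (unitarymxP Uu).
  by rewrite map_scalar_mx /= conjC1.
have U'E : U' *m B *m U'^t* = diag_mx (\row_i (y i)%:C).
  rewrite /U' -{1}Br adj_map_conj -!map_mxM UE map_diag_mx; congr diag_mx.
  by apply/matrixP => i j; rewrite !mxE; exact: conjC_real.
(* V is diagonal with phases as entries; s consists of square roots of their conjugates *)
pose V := U' *m U^t*.
have VE := diagonalizers_quotient Uu U'u UE U'E; rewrite -/V in VE.
have Vu : V \is unitarymx by apply: (mul_unitarymx U'u); rewrite trmxC_unitary.
have VU : U' = V *m U by rewrite /V (mulmx_adjK _ Uu).
clearbody V.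
have Voff i j : i != j -> V i j = 0 by exact: commute_diag VE.
have V1 i : `|V i i| = 1.
  have /matrixP/(_ i i) := unitarymxP Vu; rewrite mxE (bigD1 i)//= big1 => [|j ji].
    rewrite addr0 !mxE eqxx -normCK => /eqP; rewrite sqrp_eq1// => /eqP //.
  by rewrite Voff 1?eq_sym// mul0r.
pose be i := (U *m b) i 0; pose s i := sqrtC (Num.conj (V i i)).
have s1 i : `|s i| = 1.
  have : `|s i| ^+ 2 = 1 by rewrite -normrX sqrtCK norm_conjC V1.
  by move/eqP; rewrite sqrp_eq1// => /eqP.
pose t : 'rV[C]_m := \row_i (if be i == 0 then 1 else s i * (`|be i| / be i)).
exists t => [i|].
  rewrite mxE; case: eqP => [_|/eqP b0]; first exact: normr1.
  by rewrite normrM s1 mul1r normrM normfV normr_id divff// normr_eq0.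
have tb i : t 0 i * be i = s i * `|be i|.
  rewrite mxE; case: eqP => [->|/eqP b0]; first by rewrite normr0 !mulr0.
  by rewrite -mulrA divfK.
have conj_s i : Num.conj (V i i) * Num.conj (s i) = s i.
  by rewrite -(sqrtCK (Num.conj (V i i))) -/(s i) expr2 -mulrA -normCK s1 expr1n mulr1.
clearbody t.
have wE : V^t* *m map_mx Num.conj (diag_mx t *m (U *m b)) = diag_mx t *m (U *m b).
  apply/matrixP => i j; rewrite ord1 mxE (bigD1 i)//= big1 => [|k ki]; last first.
    by rewrite !mxE Voff ?conjC0 ?mul0r// eq_sym.
  rewrite addr0 mul_diag_mx !mxE -[\sum_(_ | _) _](_ : be i = _); last by rewrite /be mxE.
  rewrite tb rmorphM /= (conj_Creal (normr_real _)) mulrA conj_s.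
  by [].
rewrite -!mulmxA map_mxM -adj_map_conj -/U' VU adjmxM -mulmxA wE.
by [].
Qed.

Lemma bordered_map_conj n (B : 'M[C]_n) b c :
  map_mx Num.conj (bordered B b c) =
  bordered (map_mx Num.conj B) (map_mx Num.conj b) (Num.conj c).
Proof.
apply: border_ext; rewrite ?proj_bordered ?elast_bordered.
  rewrite -{1}proj_real -map_mxM proj_bordered map_mxD !map_mxM -adj_map_conj.
  by rewrite proj_real elast_real.
rewrite -{1}elast_real adj_map_conj -map_mxM elast_bordered map_mxD map_mxZ map_mxM.
by rewrite -!adj_map_conj proj_real elast_real.
Qed.

Lemma herm_real n (A : 'M[C]_n.+1) : A^t* = A -> map_mx Num.conj (top A) = top A ->
  map_mx Num.conj (border A) = border A -> map_mx Num.conj A = A.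
Proof.
move=> AE tr br; rewrite -(borderedK AE) bordered_map_conj tr br; congr bordered.
by rewrite rmorphB /= !herm_tr// top_herm.
Qed.

(** Phases in an eigenbasis of the real corner make the next border real. *)
Lemma real_corner_step n (m : 'I_n) (hm : (m <= n)%N) (hm1 : (m.+1 <= n)%N) (A : 'M[C]_n) :
  Herm0 A -> map_mx Num.conj (corner hm A) = corner hm A ->
  exists2 t : 'rV[C]_m, torus t &
    map_mx Num.conj (corner hm1 (gz_act1 hm t A)) = corner hm1 (gz_act1 hm t A).
Proof.
move=> /Herm0P[AE Ac] Br; have [Uu UE] := gz_diagonalizerP hm AE.
have tM : top (corner hm1 A) = corner hm A by rewrite -corner_pred.
have [t t1 tr] := real_phases (border (corner hm1 A)) Uu UE (chain_corner Ac) Br.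
exists t => //; rewrite gz_act1E//; set Z := gz_elem hm t A.
have Zu : Z \is unitarymx by exact: gz_elem_unitary.
have mm : (m <= m)%N by [].
rewrite (corner_extend_sub (leqnSn m)) (extend_top mm) extend_full.
have [tE bE] := blk_conj Z 1 (corner hm1 A).
apply: herm_real; first by rewrite herm_conj// corner_herm.
  by rewrite tE tM gz_elem_corner.
by rewrite bE conjC1 scale1r.
Qed.

Section UniqueMap.
Variables (n : nat) (g : 'M[C]_n -> 'M[C]_n).
Hypothesis gP : is_gz_map g.

(** The values of [g] and [gzexp] lie in the same component and have corners with the same
    eigenvalues. *)
Lemma gz_map_Sym0 A : Sym0 A -> g A = gzexp A.
Proof.
case: gP => gpos _ gmu _ gcomp As; have [AE Ac Ar] := (Sym0P _).1 As.
have AH : Herm R n A by exact/HermP.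
have gAp : pos (g A) by apply/Herm_posP; exact: gpos.
have AA := connected_component_refl As.
apply: (gz_lambda_inj (component_connected (A := Sym0 (n := n)) (x := A))).
- exact: connected_component_sub.
- by apply: (gcomp A As); exists A.
- by apply: (gzexp_components As); exists A.
- exact: gz_mu_inj gAp (gzexp_pos AE) (etrans (gmu A AH) (esym (gz_mu_gzexp AE))).
Qed.

(** Downward induction on the size [m] of a real corner. *)
Lemma gz_map_real_corner m (hm : (m <= n)%N) A : Herm0 A ->
  map_mx Num.conj (corner hm A) = corner hm A -> g A = gzexp A.
Proof.
have [d dE] : exists d, (d + m = n)%N by exists (n - m)%N; rewrite subnK.
elim: d m hm A dE => [|d IH] m hm A dE A0 Ar.
  have e : m = n by rewrite -dE.
  subst m; rewrite corner_full in Ar; apply: gz_map_Sym0.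
  by have [AE Ac] := (Herm0P _).1 A0; apply/Sym0P.
have m_n : (m < n)%N by rewrite -dE addSn ltnS leq_addl.
have [AE Ac] := (Herm0P _).1 A0.
have [t t1 tr] := real_corner_step (m := Ordinal m_n) m_n A0 Ar.
set A' := gz_act1 _ t A in tr.
have A'0 : Herm0 A' by exact: gz_act1_Herm0.
have A'E : A'^t* = A' by case/Herm0P: A'0.
have gA' : g A' = gzexp A' by apply: (IH m.+1 m_n) => //; rewrite addnS -addSn.
have s1 : torus (map_mx Num.conj t) by move=> i; rewrite mxE norm_conjC.
have [T T1 TE] := gz_act_single (m := Ordinal m_n) s1.
have AA' : A = gz_act T A'.
  have E : gz_act T A' = gz_act1 hm (map_mx Num.conj t) A'.
    by apply: etrans (TE _ A'E) _; congr gz_act1; exact: bool_irrelevance.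
  exact: esym (etrans E (gz_act1K hm AE t1)).
case: gP => gpos _ _ gact _; have gA'p : pos (g A').
  by apply/Herm_posP; apply: gpos; exact/HermP.
by rewrite AA' gact// gA' gzexp_act.
Qed.

Lemma gz_map_Herm0 A : Herm0 A -> g A = gzexp A.
Proof.
move=> A0; apply: (gz_map_real_corner (hm := leq0n n) A0).
by apply/matrixP => -[].
Qed.

Lemma continuous_mC (V : normedModType R) m p (F : V -> 'M[C]_(m, p)) :
  continuous F -> mC setT 0 F.
Proof.
move=> Fc i j; suff h x e : 0 < e -> \forall y \near x,
    `|complex.Re (F x i j) - complex.Re (F y i j)| < e /\
    `|complex.Im (F x i j) - complex.Im (F y i j)| < e.
  split=> x _; apply/cvgrPdist_lt => e /(h x); apply: filterS => y [].
    by [].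
  by [].
move=> e0; have ce0 : 0 < e%:C by rewrite ltcR.
have := Fc x => /cvg_ballP /(_ _ ce0); apply: filterS => y [_ /(_ i j)].
rewrite -ball_normE /= normC_abs2 ltcR => h.
rewrite -!ReN -!ImN -ReD -ImD.
by split; apply: le_lt_trans h; [exact: Re_le_sqrt|exact: Im_le_sqrt].
Qed.

(** By density of Herm_0. *)
Lemma gz_map_unique A : Herm R n A -> g A = gzexp A.
Proof.
move=> AH; rewrite -(hcoordK AH); move: (hcoord A) (I : [set: 'M[R]_n] (hcoord A)).
have gc : continuous (g \o @hmat R n) by apply/within_Herm_comp; case: gP.
have oT := @openT 'M[R]_n.
apply: mx_eq_generic => //.
- exact: continuous_mC gc.
- by apply: mC_gzexp; [exact: openT|exact: hermD_hmat|exact: mC_hmat openT].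
- by move=> X _ Xc; apply: gz_map_Herm0; apply/Herm0P; split=> //; exact: hmat_herm.
Qed.

End UniqueMap.

End Uniqueness.

Theorem theorem1p2 (R : realType) :
  exists gamma : forall n : nat, 'M[R[i]]_n -> 'M[R[i]]_n,
  forall n : nat, (1 <= n)%N ->
  [/\ is_gz_map (gamma n),
      (forall g : 'M[R[i]]_n -> 'M[R[i]]_n,
         is_gz_map g -> forall A, Herm R n A -> g A = gamma n A),
      Herm_diffeo (Herm R n) (Herm_pos R n) (gamma n)
    & [/\ (forall (t : 'rV[R[i]]_n) (A : 'M[R[i]]_n),
             torus t -> Herm R n A ->
             gamma n (conjg_mx (diag_mx t) A)
             = conjg_mx (diag_mx t) (gamma n A)),
          (forall (A : 'M[R[i]]_n) (u : R), Herm R n A ->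
             gamma n (A + (u%:C)%:M) = (expR u)%:C *: gamma n A),
          (forall A : 'M[R[i]]_n, Herm R n A ->
             gamma n (map_mx Num.conj A) = map_mx Num.conj (gamma n A))
        & (forall (k : nat) (hk : (k <= n)%N), (1 <= k)%N ->
             (forall A : 'M[R[i]]_n, Herm R n A ->
                corner hk (gamma n A) = gamma k (corner hk A)) /\
             (forall B : 'M[R[i]]_k, Herm R k B ->
                gamma n (extend hk 0 B) = extend hk 1 (gamma k B)))]].
Proof.
exists (fun n => @gzexp R n) => n _; split.
- split.
  + by move=> A /HermP AE; apply/Herm_posP; exact: gzexp_pos.
  + exact: gzexp_continuous.
  + by move=> A /HermP; exact: gz_mu_gzexp.
  + by move=> A A0 t t1; exact: gzexp_act.
  + exact: gzexp_components.
- by move=> g gP A; exact: gz_map_unique.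
- exact: gzexp_diffeo.
- split.
  + by move=> t A t1 /HermP; exact: gzexp_diag.
  + by move=> A u /HermP; exact: gzexp_shift.
  + by move=> A /HermP; exact: gzexp_map_conj.
  + move=> k hk _; split=> [A /HermP|B /HermP].
      exact: corner_gzexp.
    exact: gzexp_extend.
Qed.
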